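(* Let $k\ge2$ and consider the family of logistic max-stable distributions, with exponent functions $$V_\theta(z)=\left(z_1^{-1/\theta}+\cdots+z_k^{-1/\theta}\right)^\theta,\quad z\in(0,\infty)^k,\qquad\theta\in\Theta=(0,1),$$ i.e. with distribution functions $\exp\{-V_\theta(z)\}$ and densities $f_\theta$. The logistic model $\{f_\theta,\theta\in(0,1)\}$ is differentiable in quadratic mean at any $\theta_0\in(0,1)$. Furthermore, if the Fisher information $I_{\theta_0}$ is non-singular, the maximum likelihood estimator $\hat\theta_n^{\mathrm{mle}}$ based on $n$ independent observations with density $f_{\theta_0}$ is asymptotically normal and efficient as $n\to\infty$, that is, $\sqrt n(\hat\theta_n^{\mathrm{mle}}-\theta_0)\stackrel{d}{\to}\mathcal N(0,I_{\theta_0}^{-1})$.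
   Context: The model with parameter space $\Theta\subset\mathbb{R}^D$ (here $D=1$) is differentiable in quadratic mean at $\theta_0\in\mathrm{int}(\Theta)$ if there is a measurable function $\dot\ell_{\theta_0}:\mathbb{R}^k\to\mathbb{R}^D$ such that $\int_{\mathbb{R}^k}\big(\sqrt{f_{\theta_0+h}(z)}-\sqrt{f_{\theta_0}(z)}-\frac12h^T\dot\ell_{\theta_0}(z)\sqrt{f_{\theta_0}(z)}\big)^2\mathrm{d}z=o(\|h\|^2)$ as $h\to0$ (densities are $0$ outside $(0,\infty)^k$). The Fisher information is $I_{\theta_0}=\int\{\partial_\theta\log f_{\theta_0}(z)\}\{\partial_\theta\log f_{\theta_0}(z)\}^Tf_{\theta_0}(z)\,\mathrm{d}z$. Convention: ''the maximum likelihood estimator $\hat\theta_n^{\mathrm{mle}}$'' denotes a suitable sequence of local maxima of the log-likelihood $\theta\mapsto\sum_{i=1}^n\log f_\theta(Z^{(i)})$; the assertion is that there exists a sequence of estimators which, almost surely, are local maxima of the log-likelihood for all sufficiently large $n$, and which satisfies the stated convergence. *)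

(* Defs.v *)
From HB Require Import structures.
From mathcomp Require Import all_boot all_order all_algebra.
From mathcomp Require Import finmap.
From mathcomp Require Import all_classical all_reals all_analysis.

Set Implicit Arguments.
Unset Strict Implicit.
Unset Printing Implicit Defensive.

Import Order.TTheory GRing.Theory Num.Theory.
Import numFieldNormedType.Exports.

Local Open Scope classical_set_scope.
Local Open Scope ring_scope.

Lemma sigma_finite_measure_pack d (T : measurableType d) (R : realType)
    (mu : set T -> \bar R) :
  mu set0 = 0%E -> (forall A, 0 <= mu A)%E -> semi_sigma_additive mu ->
  sigma_finite setT mu ->
  exists m : {sigma_finite_measure set T -> \bar R}, mu = m :> (set _ -> _).
Proof.
move=> mu0 mu_ge0 mu_sigma sf.
pose M : {measure set T -> \bar R} :=
  HB.pack mu (isMeasure.Build _ _ _ mu mu0 mu_ge0 mu_sigma).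
pose N : {sigma_finite_measure set T -> \bar R} :=
  HB.pack (Measure.sort M) (Measure_isSigmaFinite.Build _ _ _ (Measure.sort M) sf).
by exists N.
Qed.

Section lebesgue_tuple.
Context {R : realType}.

(* The first factor carries the sigma-algebra on which the library defines
   lebesgue_measure; it is convertible to the default one on R. *)
Definition tcons n (x : measurableTypeR R * n.-tuple R) : n.+1.-tuple R :=
  [the n.+1.-tuple R of x.1 :: x.2].

Lemma measurable_tcons n : measurable_fun setT (@tcons n).
Proof. exact: (measurable_cons measurable_fst measurable_snd). Qed.

(* Lebesgue measure on R^n, as an iterated product; see lebesgue_tuple_box. *)
Fixpoint lebesgue_tuple n : set (n.-tuple R) -> \bar R :=
  match n with
  | 0 => \d_([tuple] : 0.-tuple R)
  | m.+1 => pushforward (lebesgue_measure \x @lebesgue_tuple m)%E (@tcons m)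
  end.

Definition tuple_box n (A : set R) (B : set (n.-tuple R)) :
    set (n.+1.-tuple R) :=
  [set t : n.+1.-tuple R |
    A (tnth t ord0) /\ B ([tuple of behead t] : n.-tuple R)].

Lemma measurable_tuple_box n (A : set R) (B : set (n.-tuple R)) :
  measurable A -> measurable B -> measurable (tuple_box A B).
Proof.
move=> mA mB; apply: (@measurableI _ _
  ((fun t : n.+1.-tuple R => tnth t ord0) @^-1` A)
  ((fun t : n.+1.-tuple R => ([tuple of behead t] : n.-tuple R)) @^-1` B)).
  by rewrite -[X in measurable X]setTI; exact: measurable_tnth.
by rewrite -[X in measurable X]setTI; exact: measurable_behead.
Qed.

Lemma preimage_tcons_box n (A : set R) (B : set (n.-tuple R)) :
  @tcons n @^-1` tuple_box A B = A `*` B.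
Proof.
have E (x : measurableTypeR R * n.-tuple R) :
    ([tuple of behead (tcons x)] : n.-tuple R) = x.2.
  exact/val_inj.
apply/seteqP; split=> -[a b]; rewrite /tuple_box /=.
  by move=> -[hA]; rewrite ?(E (a, b)); split.
by move=> -[hA hB]; rewrite ?(E (a, b)); split.
Qed.

Lemma lebesgue_tuple_sigma_finite_measure n :
  exists m : {sigma_finite_measure set (n.-tuple R) -> \bar R},
    @lebesgue_tuple n = m :> (set _ -> _).
Proof.
elim: n => [|n [m Em]] /=.
  by exists (\d_([tuple] : 0.-tuple R)).
rewrite Em.
pose lm : {measure set (measurableTypeR R) -> \bar R} := @lebesgue_measure R.
set mu := pushforward _ _.
have mpre (A : set (n.+1.-tuple R)) :
    measurable A -> measurable (@tcons n @^-1` A).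
  by move=> mA; rewrite -[X in measurable X]setTI; exact: measurable_tcons.
have mu0 : mu set0 = 0%E.
  by rewrite /mu /pushforward preimage_set0 (measure0 (lm \x m)%E).
have mu_ge0 A : (0 <= mu A)%E by exact: (measure_ge0 (lm \x m)%E).
have mu_sigma : semi_sigma_additive mu.
  move=> F mF tF mUF; rewrite /mu /pushforward preimage_bigcup.
  apply: (@measure_semi_sigma_additive _ _ _ (lm \x m)%E).
  - by move=> i; exact: mpre.
  - apply/trivIsetP => /= i j _ _ ij; rewrite -preimage_setI.
    by move/trivIsetP : tF => /(_ _ _ _ _ ij) ->//; rewrite preimage_set0.
  - by rewrite -preimage_bigcup; exact: mpre.
apply: sigma_finite_measure_pack => //.
have [F [TF ndF mF]] :=
  (sigma_finiteP setT lm).1 (sigma_finiteT (@lebesgue_measure R)).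
have [G [TG ndG mG]] := (sigma_finiteP setT m).1 (sigma_finiteT m).
exists (fun i => tuple_box (F i) (G i)).
  apply/esym; rewrite -subTset => t _.
  have : setT (tnth t ord0) by [].
  rewrite TF => -[i _ Fi].
  have : setT ([tuple of behead t] : n.-tuple R) by [].
  rewrite TG => -[j _ Gj].
  exists (maxn i j) => //; split.
    by move/subsetPset : (ndF _ _ (leq_maxl i j)); exact.
  by move/subsetPset : (ndG _ _ (leq_maxr i j)); exact.
move=> i; have [mFi Fioo] := mF i; have [mGi Gioo] := mG i.
split; first exact: measurable_tuple_box.
rewrite /mu /pushforward preimage_tcons_box.
rewrite (@product_measure1E _ _ _ _ _ lm m)//.
by rewrite lte_mul_pinfty// ge0_fin_numE.
Qed.

Let lebesgue_tuple0 n : @lebesgue_tuple n set0 = 0%E.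
Proof. by have [m ->] := lebesgue_tuple_sigma_finite_measure n. Qed.

Let lebesgue_tuple_ge0 n A : (0 <= @lebesgue_tuple n A)%E.
Proof. by have [m ->] := lebesgue_tuple_sigma_finite_measure n. Qed.

Let lebesgue_tuple_sigma_additive n : semi_sigma_additive (@lebesgue_tuple n).
Proof.
have [m ->] := lebesgue_tuple_sigma_finite_measure n.
exact: measure_semi_sigma_additive.
Qed.

HB.instance Definition _ n := isMeasure.Build _ _ _ (@lebesgue_tuple n)
  (lebesgue_tuple0 n) (@lebesgue_tuple_ge0 n)
  (@lebesgue_tuple_sigma_additive n).

Let lebesgue_tuple_sigma_finite n : sigma_finite setT (@lebesgue_tuple n).
Proof.
have [m ->] := lebesgue_tuple_sigma_finite_measure n.
exact: sigma_finiteT.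
Qed.

HB.instance Definition _ n := Measure_isSigmaFinite.Build _ _ _
  (@lebesgue_tuple n) (lebesgue_tuple_sigma_finite n).

Lemma lebesgue_tuple_box n (A : 'I_n -> set R) :
  (forall i, measurable (A i)) ->
  @lebesgue_tuple n [set t | forall i, A i (tnth t i)] =
  (\prod_(i < n) lebesgue_measure (A i))%E.
Proof.
elim: n A => [|n IH] A mA.
  by rewrite big_ord0 /= diracE mem_set// => i; case: i.
rewrite big_ord_recl.
have -> : [set t : n.+1.-tuple R | forall i, A i (tnth t i)] =
    tuple_box (A ord0) [set t | forall i : 'I_n, A (lift ord0 i) (tnth t i)].
  have E (t : n.+1.-tuple R) i :
      tnth ([tuple of behead t] : n.-tuple R) i = tnth t (lift ord0 i).
    by rewrite [in RHS](tuple_eta t) tnthS.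
  apply/seteqP; split=> t /=.
    by move=> At; split=> // i; rewrite E.
  move=> [A0 At] i; case: (unliftP ord0 i) => [j|] ->//.
  by rewrite -E; exact: At.
have mB : measurable
    [set t : n.-tuple R | forall i, A (lift ord0 i) (tnth t i)].
  rewrite (_ : [set t | _] = \bigcap_(i in [set: 'I_n])
     ((fun t : n.-tuple R => tnth t i) @^-1` A (lift ord0 i))).
    apply: fin_bigcap_measurable => // i _.
    by rewrite -[X in measurable X]setTI; exact: measurable_tnth.
  by apply/seteqP; split=> t /= At i => [_|]; exact: At.
rewrite /= /pushforward preimage_tcons_box.
rewrite (product_measure1E lebesgue_measure (@lebesgue_tuple n))//.
  by congr (_ * _)%E; exact: IH.
exact: mA.
Qed.

End lebesgue_tuple.

Section logistic_model.
Context {R : realType} (k : nat).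
Implicit Types (theta : R) (z : k.-tuple R) (G : k.-tuple R -> R).

Definition positive_orthant : set (k.-tuple R) :=
  [set z | forall i, 0 < tnth z i].

Definition logistic_exponent theta z : R :=
  (\sum_(i < k) tnth z i `^ (- theta^-1)) `^ theta.

Definition logistic_cdf theta z : R :=
  if `[< positive_orthant z >] then expR (- logistic_exponent theta z) else 0.

Definition tuple_set z (i : 'I_k) (x : R) : k.-tuple R :=
  [tuple if j == i then x else tnth z j | j < k].

Definition partial (i : 'I_k) G z : R :=
  derive1 (fun x => G (tuple_set z i x)) (tnth z i).

Definition mixed_partial G : k.-tuple R -> R := foldr partial G (enum 'I_k).

(* A density is determined only almost everywhere, whereas log-likelihoods and
   their local maxima depend on the version; this is the usual one, the k-th
   order mixed partial derivative of the distribution function, continuous on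
   the positive orthant and 0 outside. *)
Definition logistic_density theta z : R :=
  if `[< positive_orthant z >] then mixed_partial (logistic_cdf theta) z else 0.

Definition logistic_parameters : set R := [set` `]0, 1[].

End logistic_model.

Section parametric_model.
Context {R : realType} (k : nat).
Variable f : R -> k.-tuple R -> R.

(* The limit as h -> 0 of (integral / h^2) is 0, i.e. the integral, which
   vanishes at h = 0, is o(h^2). The integral is extended-real valued, so the
   limit also asserts that it is finite for small h. *)
Definition dqm (theta0 : R) : Prop :=
  exists2 l : k.-tuple R -> R, measurable_fun setT l &
    ((h ^+ 2)^-1%:E * \int[@lebesgue_tuple R k]_z
      ((Num.sqrt (f (theta0 + h) z) - Num.sqrt (f theta0 z)
        - 2^-1 * h * l z * Num.sqrt (f theta0 z)) ^+ 2)%:E)%E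
    @[h --> 0^'] --> 0%E.

Definition fisher_information (theta0 : R) : \bar R :=
  (\int[@lebesgue_tuple R k]_z
    (derive1 (fun theta => ln (f theta z)) theta0 ^+ 2 * f theta0 z)%:E)%E.

Definition log_likelihood n (x : n.-tuple (k.-tuple R)) (theta : R) : R :=
  \sum_(i < n) ln (f theta (tnth x i)).

End parametric_model.

Definition local_maximum {R : realType} (Theta : set R) (L : R -> R) (t : R) :=
  Theta t /\ \forall s \near t, Theta s -> L s <= L t.

Section probability.
Context d {Omega : measurableType d} {R : realType} (P : probability Omega R).

Definition has_density k (X : {RV P >-> k.-tuple R}) (g : k.-tuple R -> R) :=
  forall A, measurable A ->
    distribution P X A = (\int[@lebesgue_tuple R k]_(z in A) (g z)%:E)%E.

Definition mutually_independent d' (T : measurableType d')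
    (I : choiceType) (X : I -> {RV P >-> T}) :=
  forall (J : {fset I}) (A : I -> set T), (forall i, measurable (A i)) ->
    P (\bigcap_(i in [set` J]) (X i @^-1` A i)) =
    (\prod_(i <- J) P (X i @^-1` A i))%E.

Definition cvg_in_distribution (X : nat -> Omega -> R)
    (mu : set (measurableTypeR R) -> \bar R) :=
  forall g : R -> R, continuous g -> (exists M, forall x, `|g x| <= M) ->
    ('E_P[g \o X n])%E @[n --> \oo] --> (\int[mu]_x (g x)%:E)%E.

Definition sample k (Z : nat -> {RV P >-> k.-tuple R}) (n : nat) (w : Omega) :
  n.-tuple (k.-tuple R) := [tuple Z i w | i < n].

End probability.

(* Main.v *)
Require Import Defs.
From HB Require Import structures.
From mathcomp Require Import all_boot all_order all_algebra.
From mathcomp Require Import finmap.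
From mathcomp Require Import all_classical all_reals all_analysis.
From mathcomp Require Import measurable_realfun lebesgue_measure.
From mathcomp Require Import ring lra.

(** Write x_i = ln z_i, S = sum_i exp (- x_i / theta) and V = S^theta. The
    distribution function exp (- V) depends on z through S only, and S is a sum
    of functions of one coordinate. So each partial derivative differentiates
    the function of S once more and contributes one factor, and the density is
    phi_k (S) times a product over the coordinates, where
    phi_k (s) = (- d/ds)^k exp (- s^theta) is a combination with nonnegative
    coefficients of the functions s^(theta j - k) exp (- s^theta)
    ([phi_derive], [logistic_densityE]). Integrating the coordinates one after
    the other undoes these derivatives, whence total mass 1 ([logistic_mass]).

    Quadratic mean differentiability and the moments of the score rest on two
    estimates, both locally uniform in theta. First, the log-density is smooth
    in theta, and its derivatives are bounded by powers of the envelope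
    1 + sum_i (|x_i| + 1/z_i): it is built from S, V and a polynomial in V whose
    coefficients are nonnegative and whose constant coefficient stays away from
    0, by operations that preserve such bounds ([tame_log_density]). Second, any
    power of the envelope times the density is dominated by an integrable
    product of functions of one coordinate ([density_domination]). As z_i tends
    to 0, exp (- V) with V >= 1/z_i decays fast enough; as z_i grows, the power
    of S leaves a decay of order z_i^(- 1 - 1/k) in each coordinate. Integrals
    of the density against derivatives of the log-density can therefore be
    differentiated under the integral sign: the score is centered, and the mean
    of its derivative is minus its second moment, the Fisher information
    ([score_centered], [information_identity]). Likewise the second derivative
    of the root of the density has a dominated square; so the squared remainder
    of its first order expansion integrates to O(h^4) ([logistic_dqm]).

    The asymptotic part is Cramer's argument. By the strong law, applied to the
    first two derivatives of the log-density at theta0 and to a Lipschitz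
    constant of the second one, almost surely the log-likelihood is eventually
    strictly concave on a fixed small interval around theta0, and its derivative
    changes sign there. The zero of this derivative is a local maximum; it is
    also the supremum of the rational points of the interval where the
    derivative is positive, and hence a measurable function of the sample
    ([likelihood_root], [likelihood_root_ae]). By the mean value theorem the
    error of this estimator, multiplied by sqrt n, is the normalized sum of the
    scores divided by a slope that tends to the Fisher information; so the
    central limit theorem gives the limit law ([likelihood_root_normal]). The
    strong law is proved from fourth moments ([slln]), and the central limit
    theorem by exchanging the summands with Gaussian variables one by one
    ([clt_smooth]); test functions with three bounded derivatives are enough,
    because three moving averages make a continuous function that smooth
    ([smooth_approximation], [cvg_in_distribution_smooth]). *)

Set Implicit Arguments.
Unset Strict Implicit.
Unset Printing Implicit Defensive.

Import Order.TTheory GRing.Theory Num.Theory.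
Import numFieldNormedType.Exports.

Local Open Scope classical_set_scope.
Local Open Scope ring_scope.

Notation intR mu f := (mu.-integrable setT (EFin \o f)) (only parsing).

(** * Real analysis *)

Section real_analysis.
Context {R : realType}.
Implicit Types f df g : R -> R.

Lemma is_derive_eq f (x a b : R) : is_derive x 1 f a -> a = b -> is_derive x 1 f b.
Proof. by move=> ? <-. Qed.

Lemma is_derive_continuous f (x a : R) : is_derive x 1 f a -> {for x, continuous f}.
Proof. by move=> [d _]; apply/differentiable_continuous/derivable1_diffP. Qed.

(** The derivation rules below are phrased with explicit lambda abstractions, so
    that [is_derive_eq] can differentiate an expression by one term that
    mirrors its syntax, leaving an algebraic identity. *)
Lemma der_cst (x c : R) : is_derive x 1 (fun=> c) 0.
Proof. exact: is_derive_cst. Qed.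

Lemma der_id (x : R) : is_derive x 1 (fun y => y) 1.
Proof. exact: is_derive_id. Qed.

Lemma derD f g (x a b : R) : is_derive x 1 f a -> is_derive x 1 g b ->
  is_derive x 1 (fun y => f y + g y) (a + b).
Proof. exact: is_deriveD. Qed.

Lemma derN f (x a : R) : is_derive x 1 f a -> is_derive x 1 (fun y => - f y) (- a).
Proof. exact: is_deriveN. Qed.

Lemma derB f g (x a b : R) : is_derive x 1 f a -> is_derive x 1 g b ->
  is_derive x 1 (fun y => f y - g y) (a - b).
Proof. exact: is_deriveB. Qed.

Lemma derM f g (x a b : R) : is_derive x 1 f a -> is_derive x 1 g b ->
  is_derive x 1 (fun y => f y * g y) (a * g x + f x * b).
Proof.
by move=> df dg; have := is_deriveM df dg; rewrite addrC [_ *: a]mulrC.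
Qed.

Lemma derV f (x a : R) : f x != 0 -> is_derive x 1 f a ->
  is_derive x 1 (fun y => (f y)^-1) (- (a / f x ^+ 2)).
Proof.
move=> fx df; have := is_deriveV fx df.
by rewrite scaleNr [_ *: a]mulrC.
Qed.

Lemma der_comp f g (x a b : R) : is_derive (g x) 1 f a -> is_derive x 1 g b ->
  is_derive x 1 (fun y => f (g y)) (a * b).
Proof. exact: is_derive1_comp. Qed.

Lemma der_exp f (x a : R) : is_derive x 1 f a ->
  is_derive x 1 (fun y => expR (f y)) (expR (f x) * a).
Proof. by move=> df; apply: (der_comp (is_derive_expR _)). Qed.

Lemma der_ln f (x a : R) : 0 < f x -> is_derive x 1 f a ->
  is_derive x 1 (fun y => ln (f y)) ((f x)^-1 * a).
Proof. by move=> fx df; apply: (der_comp (is_derive1_ln fx)). Qed.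

Lemma der_sum n (h : 'I_n -> R -> R) (x : R) (dh : 'I_n -> R) :
  (forall i, is_derive x 1 (h i) (dh i)) ->
  is_derive x 1 (fun y => \sum_i h i y) (\sum_i dh i).
Proof.
move=> H; have -> : (fun y => \sum_i h i y) = \sum_i h i.
  by apply/funext => y; rewrite fct_sumE.
exact: is_derive_sum.
Qed.

Lemma mean_value f df (u v : R) :
  (forall t, Num.min u v <= t <= Num.max u v -> is_derive t 1 f (df t)) ->
  exists2 c, Num.min u v <= c <= Num.max u v & f v - f u = df c * (v - u).
Proof.
wlog uv : u v / u <= v.
  move=> H hf; case/orP: (le_total u v) => [uv|vu].
    exact: H.
  have [|c hc E] := H v u vu.
    by move=> t ht; apply: hf; rewrite minC maxC.
  by exists c; [rewrite minC maxC|rewrite -opprB E -mulrN opprB].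
rewrite min_l// max_r// => hf.
have [t||c] := @MVT_segment R f df u v uv.
- by rewrite in_itv/= => /andP[ut tv]; apply: hf; rewrite !ltW.
- apply: derivable_within_continuous => t; rewrite in_itv/= => ht.
  by have [] := hf _ ht.
- by rewrite in_itv/= => hc E; exists c.
Qed.

Lemma mean_value_bound f df (u v C : R) :
  (forall t, Num.min u v <= t <= Num.max u v -> is_derive t 1 f (df t) /\ `|df t| <= C) ->
  `|f v - f u| <= C * `|v - u|.
Proof.
move=> H; have [|c hc ->] := @mean_value f df u v.
  by move=> t /H[].
by rewrite normrM ler_wpM2r//; have [] := H _ hc.
Qed.

(** Applied repeatedly this gives Taylor estimates: each integration from [x]
    gains a power of the distance to [x]. *)
Lemma taylor_step f df (x r C : R) n : 0 <= C ->
  (forall t, `|t - x| <= r -> is_derive t 1 f (df t)) ->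
  (forall t, `|t - x| <= r -> `|df t| <= C * `|t - x| ^+ n) ->
  forall t, `|t - x| <= r -> `|f t - f x| <= C * `|t - x| ^+ n.+1.
Proof.
move=> C0 hd hb t ht.
have key s : Num.min x t <= s <= Num.max x t -> `|s - x| <= `|t - x|.
  rewrite ge_min le_max; case/andP.
  have [xt|tx] := leP x t.
    rewrite (ger0_norm (_ : 0 <= t - x)) ?subr_ge0//.
    by rewrite ler_norml => /orP[] h1 /orP[] h2; lra.
  rewrite (ltr0_norm (_ : t - x < 0)) ?subr_lt0//.
  by rewrite ler_norml => /orP[] h1 /orP[] h2; lra.
rewrite exprSr mulrA.
apply: (@mean_value_bound f df) => s /key hs; split.
  by apply: hd; exact: le_trans ht.
apply: (le_trans (hb _ (le_trans hs ht))).
by rewrite ler_wpM2l// lerXn2r// nnegrE.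
Qed.

Definition vanishes_off (K : R) f := forall x, K < `|x| -> f x = 0.

(** Heine's theorem on the segment where [f] lives; outside of it [f] is zero. *)
Lemma uniform_continuity f K : continuous f -> vanishes_off K f ->
  forall e : R, 0 < e -> exists2 d : R, 0 < d & forall x y, `|x - y| <= d -> `|f x - f y| <= e.
Proof.
move=> cf f0 e e0.
have /compact_near_coveringP hc := @segment_compact R (- (K + 1)) (K + 1).
have /nbhs_ballP[d /= d0 hd] : \forall d \near (0:R), `[- (K+1), K+1] `<=`
    [set x | forall y, `|x - y| <= d -> `|f x - f y| <= e].
  apply: (hc R (nbhs (0:R)) (fun d x => forall y, `|x - y| <= d -> `|f x - f y| <= e) _) => x _.
  have /cvgrPdist_le /(_ _ (divr_gt0 e0 (ltr0n _ 2))) /nbhs_ballP[r /= r0 hr] := cf x.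
  have r20 : 0 < r / 2 by rewrite divr_gt0.
  exists (ball x (r / 2), ball 0 (r / 2)) => /=.
    by split; apply: nbhsx_ballx.
  move=> [x' d] [/= h1 h2] y hy.
  have := hr x' _; have := hr y _; rewrite /ball/= in h1 h2 *.
  move: h2; rewrite sub0r normrN => h2; have := ler_norm d => h3.
  have := ler_normD (x - x') (x' - y); rewrite addrA subrK => h4.
  move=> /(_ ltac:(lra)) h5 /(_ ltac:(lra)) h6.
  have := ler_normD (f x' - f x) (f x - f y); rewrite addrA subrK (distrC (f x') (f x)).
  lra.
exists (Num.min 1 (d / 2)); first by rewrite lt_min ltr01 divr_gt0.
move=> x y; rewrite le_min => /andP[h1 h2].
have [hx|hx] := leP `|x| (K + 1).
  apply: (hd (d / 2)) => //=.
    by rewrite /ball/= sub0r normrN gtr0_norm ?divr_gt0// ltr_pdivrMr// ltr_pMr// ltr1n.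
  by rewrite in_itv/= -ler_norml.
have h3 : K < `|y| by have := ler_normB x (x - y); have := ler_normB y (y - x); rewrite !subKr (distrC y); lra.
by rewrite !f0 ?subrr ?normr0 ?ltW//; lra.
Qed.

(** The moving average of [f] over a window of width [e] is one degree smoother
    than [f], and each of its values is a value of [f] nearby. Iterating this
    replaces a continuous function by a smooth one. *)
Lemma average_step f K (e : R) : continuous f -> vanishes_off K f -> 0 < e ->
  exists h : R -> R, [/\ (forall x : R, is_derive x 1 h ((f (x + e) - f x) / e)),
    vanishes_off (K + e) h & forall x, exists2 c, x <= c <= x + e & h x = f c].
Proof.
move=> cf f0 e0.
have intf : intR lebesgue_measure f.
  have -> : EFin \o f = (EFin \o f) \_ `[- K, K]%classic.
    apply/funext => x; rewrite patchE; case: ifPn => //=.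
    rewrite notin_setE/= in_itv/= -ler_norml => /negP; rewrite -ltNge => /f0 ->//.
  apply/integrable_restrict => //=; rewrite setTI.
  apply: continuous_compact_integrable; first exact: segment_compact.
  exact: continuous_subspaceT.
pose G x := (\int[lebesgue_measure]_(t in `]-oo, x]) f t).
have dG (x : R) : is_derive x 1 G (f x).
  have [d1 d2] : derivable G x 1 /\ derive1 G x = f x.
    apply: (@continuous_FTC1 R f -oo%O x (x + 1)) => //.
    - by rewrite ltrDl.
    - exact: (integrableS _ _ (subsetT _)).
    - by rewrite /Order.lt/=.
    - exact: cf.
  apply: DeriveDef => //; rewrite -derive1E; exact: d2.
exists (fun x => (G (x + e) - G x) / e); split.
- move=> x.
  apply: (is_derive_eq (derM (derB (der_comp (dG _) (derD (der_id _) (der_cst _ _)))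
    (dG _)) (der_cst _ _))).
  by ring.
- move=> x hx.
  have [c hc ->] := @mean_value G f x (x + e) (fun t _ => dG t).
  move: hc; rewrite min_l ?max_r ?lerDl ?(ltW e0)// => /andP[h1 h2].
  rewrite f0 ?mul0r//.
  have := ler_normB c (c - x); rewrite subKr (ger0_norm (_ : 0 <= c - x)) ?subr_ge0//; lra.
- move=> x.
  have [c hc ->] := @mean_value G f x (x + e) (fun t _ => dG t).
  move: hc; rewrite min_l ?max_r ?lerDl ?(ltW e0)// => hc.
  by exists c => //; rewrite addrC addKr mulfK// gt_eqF.
Qed.

(** The half-line is exhausted by the intervals starting at 1/(n+1); [f] may be
    singular at 0. *)
Lemma FTC_positive_axis f (F : R -> R) (l l0 : R) :
  (forall x, 0 < x -> 0 <= f x) -> (forall x, 0 < x -> {for x, continuous f}) ->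
  (forall x : R, 0 < x -> is_derive x 1 F (f x)) ->
  F x @[x --> +oo] --> l -> F x @[x --> 0^'+] --> l0 ->
  (\int[lebesgue_measure]_(x in [set x | (0 < x)%R]) (f x)%:E = (l - l0)%:E)%E.
Proof.
move=> f0 cf dF Fl Fl0.
have pos n : 0 < (n.+1%:R : R)^-1 by [].
have E : [set x : R | 0 < x] = \bigcup_n `[(n.+1%:R)^-1, +oo[%classic.
  apply/seteqP; split => x /=.
    move=> x0; exists (Num.truncn x^-1) => //=; rewrite in_itv/= andbT.
    rewrite -[leRHS]invrK lef_pV2 ?posrE ?invr_gt0//.
    by apply/ltW; rewrite truncnS_gt.
  by move=> [n _] /=; rewrite in_itv/= andbT; exact: lt_le_trans.
have H : (\int[lebesgue_measure]_(x in `[(n.+1%:R)^-1%R, +oo[) (f x)%:E)%E @[n --> \oo] -->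
    (\int[lebesgue_measure]_(x in [set x | (0 < x)%R]) (f x)%:E)%E.
  rewrite E; apply: ge0_nondecreasing_set_cvg_integral => //=.
  - apply/nondecreasing_seqP => n; rewrite subsetEset => x /=.
    rewrite !in_itv/= !andbT; apply: le_trans; rewrite lef_pV2 ?posrE//.
    by rewrite ler_nat.
  - move=> n; apply/measurable_EFinP.
    apply: subspace_continuous_measurable_fun => //.
    apply: continuous_in_subspaceT => x; rewrite inE/= in_itv/= andbT => h.
    by apply: cf; exact: lt_le_trans h.
  - by move=> n x; rewrite in_itv/= andbT => h; rewrite lee_fin f0//; exact: lt_le_trans h.
have H2 n : (\int[lebesgue_measure]_(x in `[(n.+1%:R)^-1%R, +oo[) (f x)%:E = (l - F n.+1%:R^-1)%:E)%E.
  rewrite (@ge0_continuous_FTC2y R f F _ l)//.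
  - by move=> x h; rewrite f0//; exact: lt_le_trans h.
  - apply: continuous_in_subspaceT => x; rewrite inE/= in_itv/= andbT => h.
    by apply: cf; exact: lt_le_trans h.
  - by move=> x h; have [] := dF _ (lt_trans (pos n) h).
  - apply: cvg_at_right_filter; exact: (is_derive_continuous (dF _ (pos n))).
  - move=> x; rewrite in_itv/= andbT => h; rewrite derive1E.
    by have [_ ] := dF _ (lt_trans (pos n) h).
move: H; under eq_fun do rewrite H2.
move=> H; apply: (cvg_unique _ H) => //.
apply: cvg_EFin; first exact: nearW.
apply: cvgB; first exact: cvg_cst.
have : F n.+1%:R^-1 @[n --> \oo] --> l0.
  apply: (cvg_at_rightP F 0 l0).1 => //; split => //.
  exact: cvg_harmonic.
by [].
Qed.
End real_analysis.

(** * Integration of real-valued functions *)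

Section integration.
Context d {T : measurableType d} {R : realType} (mu : {measure set T -> \bar R}).
Implicit Types f g : T -> R.

Lemma intR_measurable f : intR mu f -> measurable_fun setT f.
Proof. by move=> /measurable_int /measurable_EFinP. Qed.

Lemma intR_le f g : measurable_fun setT f -> (forall x, `|f x| <= g x) ->
  intR mu g -> intR mu f.
Proof.
move=> mf fg; apply: le_integrable => //; first exact/measurable_EFinP.
by move=> x _; rewrite /= lee_fin; apply: (le_trans (fg x)); exact: ler_norm.
Qed.

Lemma intRD f g : intR mu f -> intR mu g ->
  intR mu (fun x => f x + g x).
Proof. by move=> hf hg; have := integrableD measurableT hf hg. Qed.

Lemma intRZ f c : intR mu f ->
  intR mu (fun x => c * f x).
Proof. by move=> hf; have := integrableZl measurableT c hf. Qed.

Lemma intRN f : intR mu f ->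
  intR mu (fun x => - f x).
Proof. by move=> hf; have := integrableN hf. Qed.

Lemma intRB f g : intR mu f -> intR mu g ->
  intR mu (fun x => f x - g x).
Proof. by move=> hf hg; apply: intRD => //; exact: intRN. Qed.

Lemma intR_norm f : intR mu f ->
  intR mu (fun x => `|f x|).
Proof. by move=> hf; have := integrable_abse hf. Qed.

Lemma RintD f g : intR mu f -> intR mu g ->
  \int[mu]_x (f x + g x) = \int[mu]_x f x + \int[mu]_x g x.
Proof. exact: RintegralD. Qed.

Lemma RintB f g : intR mu f -> intR mu g ->
  \int[mu]_x (f x - g x) = \int[mu]_x f x - \int[mu]_x g x.
Proof. exact: RintegralB. Qed.

Lemma RintZ f c : intR mu f ->
  \int[mu]_x (c * f x) = c * \int[mu]_x f x.
Proof. exact: RintegralZl. Qed.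

Lemma Rint_le f g : intR mu f -> intR mu g ->
  (forall x, f x <= g x) -> \int[mu]_x f x <= \int[mu]_x g x.
Proof. by move=> hf hg fg; exact: le_Rintegral. Qed.

Lemma Rint_norm_le f g : intR mu f -> intR mu g ->
  (forall x, `|f x| <= g x) -> `|\int[mu]_x f x| <= \int[mu]_x g x.
Proof.
move=> hf hg fg; apply: (le_trans (le_normr_Rintegral measurableT hf)).
by apply: Rint_le => //; exact: intR_norm.
Qed.

Lemma RintE f : intR mu f ->
  (\int[mu]_x (f x)%:E = (\int[mu]_x f x)%R%:E)%E.
Proof. by move=> hf; rewrite fineK//; exact: (integrable_fin_num measurableT hf). Qed.

Lemma ge0_intR f C : measurable_fun setT f -> (forall x, 0 <= f x) ->
  (\int[mu]_x (f x)%:E <= C%:E)%E -> intR mu f.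
Proof.
move=> mf f0 fC; apply/integrableP; split; first exact/measurable_EFinP.
under eq_integral do rewrite /= ger0_norm//.
by apply: (le_lt_trans fC); rewrite ltry.
Qed.

End integration.

Section integration_probability.
Context d {T : measurableType d} {R : realType} (mu : probability T R).
Implicit Types f g : T -> R.

Lemma intR_bounded f C : measurable_fun setT f -> (forall x, `|f x| <= C) ->
  intR mu f.
Proof.
move=> mf fC; apply: measurable_bounded_integrable => //.
  by rewrite [X in (X < _)%E](@probability_setT _ _ _ mu) ltry.
exists C; split; first by rewrite num_real.
by move=> y Cy x _; apply: (le_trans (fC x)); exact: ltW.
Qed.

Lemma intR_cst c : intR mu (fun=> c).
Proof. by apply: (@intR_bounded _ `|c|). Qed.

Lemma Rint_cst c : \int[mu]_x c = c.
Proof. by rewrite Rintegral_cst// [X in fine X](@probability_setT _ _ _ mu) mulr1. Qed.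

Lemma Rint_bounded f C : measurable_fun setT f -> (forall x, `|f x| <= C) ->
  `|\int[mu]_x f x| <= C.
Proof.
move=> mf fC; rewrite -[leRHS]Rint_cst; apply: Rint_norm_le => //.
  exact: intR_bounded fC.
exact: intR_cst.
Qed.

End integration_probability.

Section density.
Context d {T : measurableType d} {R : realType}.
Variables (mu nu : {measure set T -> \bar R}) (p : T -> R).
Hypotheses (mp : measurable_fun setT p) (p0 : forall x, 0 <= p x).
Hypothesis nuE : forall A, measurable A -> nu A = (\int[mu]_(x in A) (p x)%:E)%E.

Import HBNNSimple.
Local Open Scope ereal_scope.

(** Both sides are determined by simple functions through monotone
    convergence, and on indicator functions the identity is the definition of
    a density. *)
Lemma ge0_integral_density (f : T -> \bar R) : measurable_fun setT f ->
  (forall x, 0 <= f x) -> \int[nu]_x f x = \int[mu]_x (f x * (p x)%:E).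
Proof.
move=> mf f0; pose h := nnsfun_approx measurableT mf.
have mpE : measurable_fun setT (EFin \o p) by exact/measurable_EFinP.
have -> : \int[nu]_x f x = lim (\int[nu]_x (EFin \o h n) x @[n --> \oo]).
  have fE x : f x = lim ((EFin \o h n) x @[n --> \oo]).
    by apply/esym/cvg_lim => //; exact: cvg_nnsfun_approx.
  under eq_integral do rewrite fE.
  apply: monotone_convergence => //.
  - by move=> n; exact/measurable_EFinP/measurable_funP.
  - by move=> n x _ /=; rewrite lee_fin.
  - by move=> x _ a b ab; rewrite lee_fin; exact/lefP/nd_nnsfun_approx.
have -> : \int[mu]_x (f x * (p x)%:E) =
    lim (\int[mu]_x ((EFin \o h n) x * (p x)%:E) @[n --> \oo]).
  have fg x : f x * (p x)%:E = lim (((EFin \o h n) x * (p x)%:E) @[n --> \oo]).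
    by apply/esym/cvg_lim => //; apply: cvgeZr => //; exact: cvg_nnsfun_approx.
  under eq_integral do rewrite fg.
  apply: monotone_convergence => //.
  - by move=> n; apply/emeasurable_funM => //; exact/measurable_EFinP.
  - by move=> n x _ /=; rewrite mule_ge0 ?lee_fin.
  - by move=> x _ a b ab/=; rewrite lee_wpmul2r ?lee_fin//; exact/lefP/nd_nnsfun_approx.
suff suf n : \int[mu]_x ((EFin \o h n) x * (p x)%:E) = \int[nu]_x (EFin \o h n) x.
  by congr (limn _); apply/funext => n; rewrite suf.
transitivity (\int[nu]_x
   (\sum_(y \in range (h n)) (y * \1_(h n @^-1` [set y]) x)%:E)); last first.
  by apply: eq_integral => t tE; rewrite /= fimfunE -fsumEFin.
have indich m r : measurable_fun setT (fun x => (r * \1_(h m @^-1` [set r]) x)%:E).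
  by apply: (measurable_comp measurableT) => //; exact: measurable_funM.
rewrite ge0_integral_fsum//; last by move=> m y _; exact: nnfun_muleindic_ge0.
transitivity (\int[mu]_x (\sum_(y \in range (h n))
    (y * \1_(h n @^-1` [set y]) x)%:E * (p x)%:E)).
  under [RHS]eq_integral => x xE.
    rewrite -ge0_mule_fsuml => [|y]; last exact: nnfun_muleindic_ge0.
    rewrite fsumEFin // -(fimfunE _ x); over.
  by [].
rewrite ge0_integral_fsum//; last 2 first.
  - by move=> y; apply: emeasurable_funM.
  - by move=> m y _; apply: mule_ge0; rewrite ?lee_fin//; exact: nnfun_muleindic_ge0.
apply: eq_fsbigr => r rhn.
under [RHS]eq_integral do rewrite EFinM.
rewrite integralZl_indic_nnsfun => //.
under eq_integral do rewrite EFinM -muleA.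
rewrite ge0_integralZl//.
- under eq_integral do rewrite muleC.
  rewrite (eq_integral ((EFin \o p) \_ (h n @^-1` [set r]))); last first.
    by move=> x xE; rewrite epatch_indic.
  by rewrite -integral_mkcond -nuE// integral_indic// setIT.
- by apply: emeasurable_funM => //; exact/measurable_EFinP.
- by move=> t Et; rewrite mule_ge0 ?lee_fin.
- by move: rhn; rewrite inE => -[t _ <-]; rewrite lee_fin.
Qed.

Lemma intR_density (f : T -> R) : measurable_fun setT f ->
  intR mu ((fun x => f x * p x)%R) ->
  intR nu f.
Proof.
move=> mf /integrableP[_ h]; apply/integrableP; split; first exact/measurable_EFinP.
rewrite ge0_integral_density//; last by apply/measurable_EFinP/measurableT_comp.
apply: le_lt_trans h; rewrite le_eqVlt; apply/orP; left; apply/eqP.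
by apply: eq_integral => x _ /=; rewrite -EFinM normrM (ger0_norm (p0 x)).
Qed.

Lemma Rint_density (f : T -> R) : measurable_fun setT f ->
  intR mu ((fun x => f x * p x)%R) ->
  (\int[nu]_x f x = \int[mu]_x (f x * p x))%R.
Proof.
move=> mf hf.
have mE : measurable_fun setT (EFin \o f) by exact/measurable_EFinP.
rewrite /Rintegral integralE [in RHS]integralE; congr (fine (_ - _)).
- rewrite ge0_integral_density//; last exact: measurable_funepos.
  apply: eq_integral => x _; rewrite !funeposE/= EFinM.
  by rewrite -!(EFinM,EFin_max) maxr_pMl// mul0r.
- rewrite ge0_integral_density//; last exact: measurable_funeneg.
  apply: eq_integral => x _; rewrite !funenegE/= -!(EFinN,EFin_max,EFinM).
  by rewrite maxr_pMl// mul0r mulNr.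
Qed.

End density.

(** * Differentiation under the integral sign *)

Section derivative_of_constant_integral.
Context d {T : measurableType d} {R : realType} (mu : {measure set T -> \bar R}).

(** This is the form in which differentiation under the integral sign produces
    moment identities: differentiating a normalization such as total mass 1
    gives a centering property. *)
Lemma Rint_derivative_eq0 (f df : R -> T -> R) (u v a c : R) (G : T -> R) :
  u < a < v ->
  (forall x, u < x < v -> intR mu (f x)) ->
  (forall x y, u < x < v -> is_derive x 1 (f ^~ y) (df x y)) ->
  (forall x y, u < x < v -> `|df x y| <= G y) ->
  intR mu G ->
  (forall x, u < x < v -> \int[mu]_y f x y = c) ->
  \int[mu]_y df a y = 0.
Proof.
move=> ha fi fd fG Gi fc.
have E x y : u < x < v -> partial1of2 f x y = df x y.
  by move=> hx; rewrite partial1of2E; have [_] := fd _ y hx.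
have I x : `]u, v[%classic x = (u < x < v) by rewrite /= in_itv.
have H := @cvg_differentiation_under_integral R d T mu f setT measurableT a u v.
have {}H : h^-1 *: ((\int[mu]_y f (h + a) y) - \int[mu]_y f a y) @[h --> 0^'] --> \int[mu]_y (partial1of2 f a y).
  apply: (H _ _ _ G) => //; rewrite ?I//; try by move=> x; rewrite I; exact: fi.
  - by move=> x y; rewrite I => hx _; have [] := fd _ y hx.
  - by move=> y; apply: le_trans (fG _ y ha).
  - by move=> x y; rewrite I => hx _; rewrite E//; exact: fG.
have -> : \int[mu]_y df a y = \int[mu]_y partial1of2 f a y.
  by apply: eq_Rintegral => y _; rewrite E.
apply: (cvg_unique _ H) => //=.
apply: cvg_near_cst.
have [h1 h2] := andP ha.
near=> h.
rewrite !fc ?subrr ?scaler0//.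
have : `|h| < Num.min (a - u) (v - a).
  near: h; apply: dnbhs0_lt; by rewrite lt_min !subr_gt0 h1.
by rewrite lt_min !ltr_norml => /andP[/andP[? ?] /andP[? ?]]; apply/andP; split; lra.
Unshelve. all: by end_near. Qed.
End derivative_of_constant_integral.

(** * Gaussian integrals *)

Section gaussian.
Context {R : realType}.
Notation leb := (@lebesgue_measure R).
Notation N01 := (@normal_prob R 0 1).

Lemma normal_pdf_exp (m s x : R) : 0 < s ->
  normal_pdf m s x = (s * Num.sqrt (pi *+ 2))^-1 * expR (- ((x - m) ^+ 2 / (s ^+ 2 *+ 2))).
Proof.
move=> s0; rewrite normal_pdfE ?gt_eqF// /normal_peak /normal_fun mulNr.
congr (_^-1 * _); rewrite -mulrnAr sqrtrM ?sqr_ge0// sqrtr_sqr ger0_norm//.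
exact: ltW.
Qed.

Lemma ge0_integral_normal m s (f : R -> \bar R) : measurable_fun setT f ->
  (forall x, 0 <= f x)%E ->
  (\int[normal_prob m s]_x f x = \int[leb]_x (f x * (normal_pdf m s x)%:E))%E.
Proof.
move=> mf f0; apply: ge0_integral_density => //.
  exact: measurable_normal_pdf.
exact: normal_pdf_ge0.
Qed.

(** The substitution w = y + s u. *)
Lemma gaussian_affine (f : R -> R) (y s : R) : continuous f -> (forall x, 0 <= f x) ->
  0 < s ->
  (\int[N01]_u (f (y + s * u))%:E = \int[normal_prob y s]_w (f w)%:E)%E.
Proof.
move=> cf f0 s0.
have mf := continuous_measurable_fun cf.
have maff : measurable_fun setT (fun u : R => y + s * u).
  by apply: measurable_funD => //; apply: measurable_funM.
transitivity (\int[leb]_u ((f (y + s * u))%:E * (normal_pdf 0 1 u)%:E))%E.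
  apply: (@ge0_integral_normal 0 1 (fun u => (f (y + s * u))%:E)).
    by apply/measurable_EFinP; exact: (measurableT_comp mf maff).
  by move=> x; rewrite lee_fin.
transitivity (\int[leb]_w ((f w)%:E * (normal_pdf y s w)%:E))%E; last first.
  apply/esym/(@ge0_integral_normal y s (EFin \o f)).
    exact/measurable_EFinP.
  by move=> x; rewrite lee_fin.
have dF (x : R) : is_derive x 1 (fun u : R => y + s * u) s.
  apply: (is_derive_eq (derD (der_cst _ _) (derM (der_cst _ _) (der_id _)))).
  by rewrite mul0r mulr1 !add0r.
have F'E : derive1 (fun u : R => y + s * u) = cst s.
  by apply/funext => x; rewrite derive1E; have [_] := dF x.
under [in RHS]eq_integral do rewrite -EFinM.
rewrite (@increasing_ge0_integration_by_substitutionT _ (fun u => y + s * u)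
   (fun w => f w * normal_pdf y s w))//.
- apply: eq_integral => u _; rewrite F'E /= !fctE -EFinM; congr EFin.
  rewrite -mulrA; congr (_ * _); rewrite !normal_pdf_exp//.
  have -> : (y + s * u - y) ^+ 2 / (s ^+ 2 *+ 2) = (u - 0) ^+ 2 / (1 ^+ 2 *+ 2).
    by field; rewrite gt_eqF.
  set c := Num.sqrt _; have c0 : 0 < c by rewrite sqrtr_gt0 mulrn_wgt0// pi_gt0.
  by field; rewrite !gt_eqF.
- by move=> a b ab; rewrite ltrD2l ltr_pM2l.
- by rewrite F'E => x; exact: cvg_cst.
- by rewrite F'E; exact: is_cvg_cst.
- by rewrite F'E; exact: is_cvg_cst.
- apply/cvgrNyPle => A.
  near=> x.
  rewrite -lerBrDl -ler_pdivlMl// mulrC; near: x; exact: nbhs_ninfty_le.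
- apply/cvgryPge => A.
  near=> x.
  rewrite -lerBlDl -ler_pdivrMl// mulrC; near: x; exact: nbhs_pinfty_ge.
- move=> x; apply: cvgM; first exact: cf.
  by apply: continuous_normal_pdf; rewrite gt_eqF.
- by move=> x; rewrite mulr_ge0// normal_pdf_ge0.
Unshelve. all: by end_near. Qed.

(** Completing the square in [u]: the joint density of a Gaussian and of its
    noisy observation factors through the marginal and the conditional
    densities. *)
Lemma gaussian_complete_square (y s t u w : R) : 0 < s -> 0 < t ->
  let r := Num.sqrt (s ^+ 2 + t ^+ 2) in
  normal_pdf (y + s * u) t w * normal_pdf 0 1 u =
  normal_pdf y r w * normal_pdf (s * (w - y) / r ^+ 2) (t / r) u.
Proof.
move=> s0 t0 r.
have r2 : r ^+ 2 = s ^+ 2 + t ^+ 2 by rewrite sqr_sqrtr// addr_ge0// sqr_ge0.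
have r0 : 0 < r by rewrite sqrtr_gt0 addr_gt0// exprn_gt0.
rewrite !normal_pdf_exp ?divr_gt0//.
set c := Num.sqrt _; have c0 : 0 < c by rewrite sqrtr_gt0 mulrn_wgt0// pi_gt0.
rewrite mulrACA -expRD [in RHS]mulrACA -expRD; congr (_ * expR _).
  by field; rewrite !gt_eqF.
rewrite !exprMn !exprVn r2; have : s ^+ 2 + t ^+ 2 != 0 by rewrite -r2 expf_neq0 ?gt_eqF.
by move=> h; field; rewrite h !gt_eqF.
Qed.

(** The sum of two independent Gaussians is Gaussian. By Tonelli's theorem and
    [gaussian_complete_square] the conditional density integrates to 1. *)
Lemma gaussian_semigroup (f : R -> R) (y s t : R) : continuous f -> (forall x, 0 <= f x) ->
  0 < s -> 0 < t ->
  (\int[N01]_u \int[N01]_v (f (y + s * u + t * v))%:E =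
   \int[N01]_w (f (y + Num.sqrt (s ^+ 2 + t ^+ 2) * w))%:E)%E.
Proof.
move=> cf f0 s0 t0; set r := Num.sqrt _.
have r0 : 0 < r by rewrite sqrtr_gt0 addr_gt0// exprn_gt0.
have mf := continuous_measurable_fun cf.
have mfE : measurable_fun setT (EFin \o f) by exact/measurable_EFinP.
have mk : measurable_fun setT (fun uw : R * R => normal_pdf (y + s * uw.1) t uw.2 * normal_pdf 0 1 uw.1).
  under eq_fun do rewrite !normal_pdf_exp//.
  repeat (apply: measurable_funM => //).
    apply: measurableT_comp => //.
    apply: measurableT_comp => //.
    apply: measurable_funM => //; apply: measurable_funX.
    apply: measurable_funB => //; apply: measurable_funD => //.
    by apply: measurable_funM.
  apply: measurableT_comp => //.
  apply: measurableT_comp => //.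
  apply: measurable_funM => //; apply: measurable_funX.
  exact: measurable_funB.
have mfk : measurable_fun setT (fun uw : R * R => (f uw.2 * (normal_pdf (y + s * uw.1) t uw.2 * normal_pdf 0 1 uw.1))%:E).
  apply/measurable_EFinP; apply: measurable_funM => //.
  exact: measurableT_comp.
have inner u : (\int[N01]_v (f (y + s * u + t * v))%:E =
    \int[leb]_w (f w * normal_pdf (y + s * u) t w)%:E)%E.
  rewrite (gaussian_affine (y + s * u) cf f0 t0).
  rewrite (@ge0_integral_normal _ _ (EFin \o f))//.
have inner2 u : ((\int[N01]_v (f (y + s * u + t * v))%:E) * (normal_pdf 0 1 u)%:E =
    \int[leb]_w (f w * (normal_pdf (y + s * u) t w * normal_pdf 0 1 u))%:E)%E.
  rewrite inner -ge0_integralZr//=.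
  - by apply: eq_integral => w _; rewrite -EFinM mulrA.
  - apply/measurable_EFinP; apply: measurable_funM => //; exact: measurable_normal_pdf.
  - by move=> w _; rewrite lee_fin mulr_ge0// normal_pdf_ge0.
  - by rewrite lee_fin normal_pdf_ge0.
have mg : measurable_fun setT (fun uw : R * R => (f uw.2 * normal_pdf (y + s * uw.1) t uw.2)%:E).
  have -> : (fun uw : R * R => (f uw.2 * normal_pdf (y + s * uw.1) t uw.2)%:E) =
    (fun uw : R * R => (f uw.2 * (normal_pdf (y + s * uw.1) t uw.2 * normal_pdf 0 1 uw.1))%:E
       * (normal_pdf 0 1 uw.1)^-1%:E)%E.
    apply/funext => uw; rewrite -EFinM -!mulrA mulfV ?mulr1// normal_pdf_exp//.
    rewrite mulf_neq0 ?gt_eqF ?expR_gt0//.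
    by rewrite invr_gt0 mulr_gt0// sqrtr_gt0 mulrn_wgt0// pi_gt0.
  apply: emeasurable_funM => //; apply/measurable_EFinP.
  under eq_fun do rewrite normal_pdf_exp// invfM -expRN opprK.
  apply: measurable_funM => //; apply: measurableT_comp => //.
  apply: measurable_funM => //; apply: measurable_funX.
  exact: measurable_funB.
have outer : measurable_fun setT (fun u => \int[N01]_v (f (y + s * u + t * v))%:E)%E.
  under eq_fun do rewrite inner.
  apply: (@measurable_fun_fubini_tonelli_F _ _ (measurableTypeR R) (measurableTypeR R) R leb
    (fun uw : R * R => (f uw.2 * normal_pdf (y + s * uw.1) t uw.2)%:E)) => //.
  by move=> uw; rewrite lee_fin mulr_ge0// normal_pdf_ge0.
transitivity (\int[leb]_u ((\int[N01]_v (f (y + s * u + t * v))%:E) * (normal_pdf 0 1 u)%:E))%E.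
  apply: (@ge0_integral_normal 0 1 (fun u => \int[N01]_v (f (y + s * u + t * v))%:E)%E) => //.
  by move=> u; apply: integral_ge0 => v _; rewrite lee_fin.
under eq_integral do rewrite inner2.
rewrite (@fubini_tonelli _ _ (measurableTypeR R) (measurableTypeR R) R leb leb
    (fun uw : R * R => (f uw.2 * (normal_pdf (y + s * uw.1) t uw.2 * normal_pdf 0 1 uw.1))%:E))//=; last first.
  by move=> uw; rewrite lee_fin !mulr_ge0// normal_pdf_ge0.
rewrite (gaussian_affine y cf f0 r0).
rewrite (@ge0_integral_normal _ _ (EFin \o f))//.
apply: eq_integral => w _.
under eq_integral do rewrite gaussian_complete_square// mulrA EFinM.
rewrite ge0_integralZl//=.
- by rewrite integral_normal_pdf mule1 EFinM.
- apply/measurable_EFinP; exact: measurable_normal_pdf.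
- by move=> u _; rewrite lee_fin normal_pdf_ge0.
- by rewrite lee_fin mulr_ge0// normal_pdf_ge0.
Qed.

Lemma measurable_mgf (t : R) : measurable_fun setT (fun u : R => expR (t * u - t ^+ 2 / 2)).
Proof.
apply: measurableT_comp => //; exact: measurable_funB.
Qed.

(** The integrand times the standard density is the density of the normal law
    with mean [t]. *)
Lemma gaussian_mgf (t : R) :
  (\int[N01]_u (expR (t * u - t ^+ 2 / 2))%:E = 1)%E.
Proof.
have mf : measurable_fun setT (fun u : R => expR (t * u - t ^+ 2 / 2)).
  exact: measurable_mgf.
rewrite (@ge0_integral_normal 0 1 (fun u => (expR (t * u - t ^+ 2 / 2))%:E)).
- rewrite -[RHS](@integral_normal_pdf R t 1); apply: eq_integral => u _.
  rewrite -EFinM !normal_pdf_exp// mulrCA -expRD; congr ((_ * expR _)%:E).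
  by field.
- exact/measurable_EFinP.
- by move=> u; rewrite lee_fin expR_ge0.
Qed.

Lemma gaussian_intR_exp (t : R) : intR N01 (fun u => expR (t * u)).
Proof.
have -> : (fun u => expR (t * u)) = (fun u => expR (t ^+ 2 / 2) * expR (t * u - t ^+ 2 / 2)).
  by apply/funext => u; rewrite -expRD addrC subrK.
apply: intRZ; apply: (@ge0_intR _ _ _ _ _ 1).
- exact: measurable_mgf.
- by move=> u; exact: expR_ge0.
- by rewrite gaussian_mgf.
Qed.

(** The first two moments follow from [gaussian_mgf] by differentiating twice
    with respect to [t] at 0. *)
Lemma gaussian_moments :
  [/\ intR N01 (fun u => u),
      intR N01 (fun u => u ^+ 2),
      intR N01 (fun u => `|u| ^+ 3),
      \int[N01]_u u = 0 & \int[N01]_u (u ^+ 2) = 1].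
Proof.
(* One integrable function for all the bounds below: it dominates
   exp |u| (|u| + 1)^3 because 1 + |u| <= exp |u|. The factor 100 is generous. *)
pose G (u : R) := 100 * (expR (4 * u) + expR ((-4) * u)).
have Gi : intR N01 G.
  by apply: intRZ; apply: intRD; exact: gaussian_intR_exp.
have eG (u : R) n : (n <= 3)%N -> expR `|u| * (`|u| + 1) ^+ n <= expR (4 * u) + expR ((-4) * u).
  move=> n3; apply: (@le_trans _ _ (expR (4 * `|u|))).
    apply: (@le_trans _ _ (expR `|u| * (`|u| + 1) ^+ 3)).
      by rewrite ler_wpM2l ?expR_ge0// ler_weXn2l// lerDr.
    have -> : 4 * `|u| = `|u| + 3%:R * `|u| by ring.
    rewrite expRD expRM_natl ler_wpM2l ?expR_ge0//.
    by rewrite lerXn2r ?nnegrE ?expR_ge0 ?addr_ge0// addrC expR_ge1Dx.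
  have [u0|u0] := ger0P u.
    by rewrite lerDl expR_ge0.
  by rewrite mulrN mulNr lerDr expR_ge0.
have e1 (u : R) : 1 <= expR `|u| by rewrite -expR0 ler_expR.
have bnd (u : R) (p : R) n : (n <= 3)%N -> p <= 100 * (`|u| + 1) ^+ n -> p <= G u.
  move=> n3 hp; apply: (le_trans hp); rewrite ler_wpM2l//.
  apply: le_trans (eG u n n3); rewrite ler_peMl// exprn_ge0// addr_ge0//.
have i1 : intR N01 (fun u => u).
  apply: (intR_le _ _ Gi) => // u; apply: (bnd _ _ 1%N) => //.
  by have := normr_ge0 u; rewrite expr1; nra.
have i2 : intR N01 (fun u => u ^+ 2).
  apply: (intR_le _ _ Gi) => //.
  move=> u; rewrite normrX; apply: (bnd _ _ 2%N) => //.
  by have := normr_ge0 u; nra.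
have i3 : intR N01 (fun u => `|u| ^+ 3).
  apply: (intR_le _ _ Gi) => //; first by apply: measurable_funX; apply: measurableT_comp; first exact: normr_measurable.
  move=> u; rewrite normrX normr_id; apply: (bnd _ _ 3%N) => //.
  apply: (@le_trans _ _ ((`|u| + 1) ^+ 3)).
    by rewrite lerXn2r ?nnegrE ?addr_ge0// lerDl.
  by rewrite ler_peMl ?exprn_ge0 ?addr_ge0//; lra.
(* Its successive derivatives in t are f times the Hermite polynomials in u - t. *)
pose f (t u : R) := expR (t * u - t ^+ 2 / 2).
have fi t : intR N01 (f t).
  apply: (@ge0_intR _ _ _ _ _ 1).
  - exact: measurable_mgf.
  - by move=> u; exact: expR_ge0.
  - by rewrite gaussian_mgf.
have f1 t : \int[N01]_u f t u = 1.
  by apply: EFin_inj; rewrite -RintE// gaussian_mgf.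
have d1 (t u : R) : is_derive t 1 (f ^~ u) ((u - t) * f t u).
  apply: (is_derive_eq (der_exp (derB (derM (der_id _) (der_cst _ _))
    (derM (derM (der_id _) (der_id _)) (der_cst _ _))))).
  by rewrite /f expr2; field.
have d2 (t u : R) : is_derive t 1 (fun t => (u - t) * f t u) (((u - t) ^+ 2 - 1) * f t u).
  apply: (is_derive_eq (derM (derB (der_cst _ _) (der_id _)) (d1 t u))).
  by ring.
have ut (t u : R) : -1 < t < 1 -> `|u - t| <= `|u| + 1.
  move=> /andP[h1 h2]; apply: (le_trans (ler_normB _ _)); rewrite lerD2l ler_norml; apply/andP; split; lra.
have fb (t u : R) : -1 < t < 1 -> f t u <= expR `|u|.
  move=> /andP[h1 h2]; rewrite ler_expR.
  have : t * u <= `|u|.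
    apply: (le_trans (ler_norm _)); rewrite normrM ler_piMl// ler_norml; apply/andP; split; lra.
  by have := sqr_ge0 t; lra.
have f0 (t u : R) : 0 <= f t u by exact: expR_ge0.
have B (t u p : R) n : (n <= 3)%N -> -1 < t < 1 -> `|p| <= 100 * (`|u| + 1) ^+ n -> `|p * f t u| <= G u.
  move=> n3 ht hp; rewrite normrM (ger0_norm (f0 _ _)).
  apply: (@le_trans _ _ ((100 * (`|u| + 1) ^+ n) * expR `|u|)).
    by apply: ler_pM => //; exact: fb.
  by rewrite -mulrA ler_wpM2l// mulrC; exact: eG.
have b1 (t u : R) : -1 < t < 1 -> `|(u - t) * f t u| <= G u.
  move=> ht; apply: (B _ _ _ 1%N) => //; have := ut t u ht; have := normr_ge0 u.
  by rewrite expr1; lra.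
have b2 (t u : R) : -1 < t < 1 -> `|((u - t) ^+ 2 - 1) * f t u| <= G u.
  move=> ht; apply: (B _ _ _ 2%N) => //; have := ut t u ht; have := normr_ge0 u => h1 h2.
  apply: (le_trans (ler_normB _ _)); rewrite normrX normr1.
  by have := normr_ge0 (u - t); nra.
have I1 t : -1 < t < 1 -> intR N01 (fun u => (u - t) * f t u).
  move=> ht; apply: (intR_le _ _ Gi); last by move=> u; exact: b1.
  apply: measurable_funM; first exact: measurable_funB.
  exact: (intR_measurable (fi t)).
have m1 t : -1 < t < 1 -> \int[N01]_u ((u - t) * f t u) = 0.
  move=> ht; apply: (@Rint_derivative_eq0 _ _ _ N01 f (fun t u => (u - t) * f t u) (-1) 1 t 1 G) => //.
have m2 : \int[N01]_u (((u - 0) ^+ 2 - 1) * f 0 u) = 0.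
  apply: (@Rint_derivative_eq0 _ _ _ N01 (fun t u => (u - t) * f t u) (fun t u => ((u - t) ^+ 2 - 1) * f t u) (-1) 1 0 0 G) => //.
  by rewrite ltrN10 ltr01.
have f00 u : f 0 u = 1 by rewrite /f mul0r expr0n/= mul0r subr0 expR0.
split => //.
- rewrite -[RHS](m1 0) ?ltrN10 ?ltr01//; apply: eq_Rintegral => u _.
  by rewrite f00 subr0 mulr1.
- apply/eqP; rewrite -subr_eq0 -[X in _ - X](Rint_cst N01 1) -RintB//; last exact: intR_cst.
  rewrite -[X in _ == X]m2; apply/eqP/eq_Rintegral => u _.
  by rewrite f00 subr0 mulr1.
Qed.

End gaussian.

(** * Independent observations *)

Section boxes.
Context d {T : measurableType d}.

(** A generating pi-system of the product sigma-algebra. *)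
Definition tuple_boxes n : set (set (n.-tuple T)) :=
  [set A | exists2 C : 'I_n -> set T, (forall i, measurable (C i)) &
    A = [set t | forall i, C i (tnth t i)]].
Arguments tuple_boxes n : clear implicits.

Lemma tuple_box_measurable n (C : 'I_n -> set T) : (forall i, measurable (C i)) ->
  measurable [set t : n.-tuple T | forall i, C i (tnth t i)].
Proof.
move=> mC; rewrite (_ : [set t | _] = \bigcap_(i in [set: 'I_n])
   ((fun t : n.-tuple T => tnth t i) @^-1` C i)).
  apply: fin_bigcap_measurable => // i _.
  by rewrite -[X in measurable X]setTI; exact: measurable_tnth.
by apply/seteqP; split=> t /= At i => [_|]; exact: At.
Qed.

Lemma tuple_boxes_setI n : setI_closed (tuple_boxes n).
Proof.
move=> _ _ [C mC ->] [D mD ->]; exists (fun i => C i `&` D i).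
  by move=> i; exact: measurableI.
apply/seteqP; split => t /=.
  by move=> [h1 h2] i; split.
by move=> h; split => i; have [] := h i.
Qed.

Lemma measurable_tuple_boxes n (A : set (n.-tuple T)) : measurable A -> <<s tuple_boxes n >> A.
Proof.
apply: smallest_sub; first exact: smallest_sigma_algebra.
move: A => _; case: n => [|m]; first by rewrite big_ord0.
rewrite -bigcup_mkord_ord; apply: bigcup_sub => i Ii _ [B mB <-].
apply: sub_sigma_algebra; exists (fun j => if j == inord i then B else setT).
  by move=> j; case: ifP.
rewrite setTI; apply/seteqP; split => t /=.
  by move=> tB j; case: eqP => // ->.
by move=> /(_ (inord i)); rewrite eqxx.
Qed.
End boxes.
Arguments tuple_boxes {d T} n.

Section independence.
Context d {Omega : measurableType d} {R : realType} (P : probability Omega R).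
Context d' {T : measurableType d'} (Q : probability T R).
Variable Z : nat -> {RV P >-> T}.
Hypothesis Zind : mutually_independent Z.
Hypothesis ZQ : forall i A, measurable A -> P (Z i @^-1` A) = Q A.

Definition sample_of n (w : Omega) : n.-tuple T := [tuple Z i w | i < n].

Lemma measurable_sample_of n : measurable_fun setT (sample_of n).
Proof.
apply/measurable_fun_tnthP => i.
rewrite (_ : _ \o _ = Z i); first exact: measurable_funPT.
by apply/funext => w; rewrite /= tnth_mktuple.
Qed.

Lemma sample_of_box n (C : 'I_n -> set T) (B : set T) : (forall i, measurable (C i)) ->
  measurable B ->
  P (sample_of n @^-1` [set t | forall i, C i (tnth t i)] `&` Z n @^-1` B) =
  (P (sample_of n @^-1` [set t | forall i, C i (tnth t i)]) * Q B)%E.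
Proof.
move=> mC mB.
pose A (i : nat) : set T := if (insub i : option 'I_n) is Some j then C j else B.
have mA i : measurable (A i) by rewrite /A; case: insubP.
have AC (i : 'I_n) : A i = C i by rewrite /A valK.
have An : A n = B by rewrite /A insubF// ltnn.
pose F m : {fset nat} := [fset x in iota 0 m]%fset.
have hF m i : (i \in F m) = (i < m)%N by rewrite in_fset/= mem_iota add0n.
have E : sample_of n @^-1` [set t | forall i, C i (tnth t i)] =
    \bigcap_(i in [set` F n]) (Z i @^-1` A i).
  apply/seteqP; split => w /=.
    move=> h i /=; rewrite hF => hi.
    by have := h (Ordinal hi); rewrite tnth_mktuple -AC.
  move=> h i; rewrite tnth_mktuple -AC; apply: h => /=.
  by rewrite hF.
have FS : F n.+1 = (n |` F n)%fset.
  by apply/fsetP => i; rewrite in_fset1U !hF ltnS leq_eqVlt.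
have E2 : sample_of n @^-1` [set t | forall i, C i (tnth t i)] `&` Z n @^-1` B =
    \bigcap_(i in [set` F n.+1]) (Z i @^-1` A i).
  rewrite E; apply/seteqP; split => w /=.
    move=> [h1 h2] i /=; rewrite hF ltnS leq_eqVlt.
    move=> /orP[/eqP ->|hi]; first by rewrite An.
    by apply: h1 => /=; rewrite hF.
  move=> h; split.
    by move=> i /=; rewrite hF => hi; apply: h => /=; rewrite hF ltnS ltnW.
  by have := h n; rewrite An; apply => /=; rewrite hF.
rewrite E2 E !Zind// FS big_fsetU1 ?hF ?ltnn//= An ZQ//.
by rewrite muleC.
Qed.

(** By the definition of mutual independence this holds for boxes, and two
    finite measures that agree on a generating pi-system coincide. *)
Lemma sample_of_rectangle n (A : set (n.-tuple T)) (B : set T) : measurable A ->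
  measurable B ->
  P (sample_of n @^-1` A `&` Z n @^-1` B) = (P (sample_of n @^-1` A) * Q B)%E.
Proof.
move=> mA mB.
have mD : measurable (Z n @^-1` B).
  by rewrite -[X in measurable X]setTI; exact: measurable_funPT.
have q0 : 0 <= fine (Q B) by exact: fine_ge0.
pose m1' : {measure set (n.-tuple T) -> \bar R} := pushforward (mrestr P mD) (sample_of n).
pose m2' : {measure set (n.-tuple T) -> \bar R} :=
  mscale (NngNum q0) (pushforward P (sample_of n)).
pose m1 := m1' (@measurable_sample_of n); pose m2 := m2' (@measurable_sample_of n).
have QE : Q B = (fine (Q B))%:E by rewrite fineK// fin_num_measure.
suff : m1 A = m2 A.
  rewrite /m1 /m2 /m1' /m2' /= /mscale /= /pushforward /mrestr /= => ->.
  by rewrite muleC [in RHS]QE.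
apply: (@g_sigma_algebra_measure_unique _ R _ (tuple_boxes n) _ (fun=> setT)).
- by move=> _ [C mC ->]; exact: tuple_box_measurable.
- move=> _; exists (fun=> setT) => //.
  by apply/seteqP; split.
- by apply/seteqP; split => // t _; exists 0%N.
- exact: tuple_boxes_setI.
- move=> _ [C mC ->].
  rewrite /m1 /m2 /m1' /m2' /= /mscale /= /pushforward /mrestr /=.
  by rewrite sample_of_box// muleC [in LHS]QE.
- move=> _; rewrite /m1 /m1' /= /pushforward /mrestr /=.
  by apply: (le_lt_trans (probability_le1 _ _)); rewrite ?ltry// preimage_setT setTI.
- exact: measurable_tuple_boxes.
Qed.

Lemma measurable_sample_next n : measurable_fun setT (fun w => (sample_of n w, Z n w)).
Proof. by apply: measurable_fun_pair => //; exact: measurable_sample_of. Qed.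

(** The joint law of the first [n] observations and the next one is a product
    measure, because it has the right value on rectangles; so Tonelli's theorem
    applies. All computations with independent variables below are recursions
    on [n] through this lemma. *)
Lemma ge0_integral_sample_of_next n (F : n.-tuple T * T -> \bar R) :
  measurable_fun setT F -> (forall x, 0 <= F x)%E ->
  (\int[P]_w F (sample_of n w, Z n w) = \int[P]_w \int[Q]_z F (sample_of n w, z))%E.
Proof.
move=> mF F0.
pose mp' : {measure set (n.-tuple T * T) -> \bar R} := pushforward P (fun w => (sample_of n w, Z n w)).
pose mp := mp' (@measurable_sample_next n).
pose X : {RV P >-> n.-tuple T} :=
  HB.pack (sample_of n) (isMeasurableFun.Build _ _ _ _ (sample_of n) (@measurable_sample_of n)).
pose mX : probability (n.-tuple T) R := distribution P X.
transitivity (\int[mp]_x F x)%E.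
  rewrite /mp /mp'/= ge0_integral_pushforward//; exact: measurable_sample_next.
transitivity (\int[(mX \x Q)%E]_x F x)%E.
  apply: eq_measure_integral => /= A mA _; apply/esym.
  apply: (@product_measure_unique _ _ _ _ R mX Q mp) => //= B C mB mC.
  by rewrite /mp /mp' /mX /distribution /= /pushforward /= -sample_of_rectangle.
rewrite fubini_tonelli1// /mX.
rewrite ge0_integral_distribution//.
- exact: measurable_fun_fubini_tonelli_F.
- by move=> x; apply: integral_ge0.
Qed.

(** Adding the bound [M] makes [F] nonnegative and reduces the claim to
    [ge0_integral_sample_of_next]. *)
Lemma Rint_sample_of_next n (F : n.-tuple T * T -> R) M : measurable_fun setT F ->
  (forall x, `|F x| <= M) ->
  [/\ measurable_fun setT (fun x => \int[Q]_z F (x, z)),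
   (forall x, `|\int[Q]_z F (x, z)| <= M) &
   \int[P]_w F (sample_of n w, Z n w) = \int[P]_w \int[Q]_z F (sample_of n w, z)].
Proof.
move=> mF FM.
have mFx x : measurable_fun setT (fun z => F (x, z)) by exact: measurableT_comp.
have iFx x : intR Q (fun z => F (x, z)).
  by apply: (@intR_bounded _ _ _ _ _ M).
have FM0 x : 0 <= F x + M by have := FM x; rewrite ler_norml => /andP[]; lra.
have mFM : measurable_fun setT (fun x => (F x + M)%:E).
  by apply/measurable_EFinP; exact: measurable_funD.
have E x : (\int[Q]_z (F (x, z) + M)%:E = (\int[Q]_z F (x, z) + M)%R%:E)%E.
  rewrite RintE; last by apply: intRD => //; exact: intR_cst.
  by rewrite RintD ?Rint_cst//; exact: intR_cst.
have mG : measurable_fun setT (fun x => \int[Q]_z F (x, z)).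
  have : measurable_fun setT (fun x => \int[Q]_z (F (x, z) + M)%:E)%E.
    by apply: (@measurable_fun_fubini_tonelli_F _ _ _ _ R Q (fun x => (F x + M)%:E)) => // x; rewrite lee_fin.
  under eq_fun do rewrite E.
  move/measurable_EFinP => h.
  rewrite (_ : (fun x => _) = (fun x => \int[Q]_z F (x, z) + M - M)); last first.
    by apply/funext => x; rewrite addrK.
  exact: measurable_funB.
have GM x : `|\int[Q]_z F (x, z)| <= M by exact: Rint_bounded.
split => //.
have mS := @measurable_sample_of n.
have i1 : intR P (fun w => F (sample_of n w, Z n w)).
  apply: (@intR_bounded _ _ _ _ _ M) => //.
  by apply: (measurableT_comp mF); exact: measurable_sample_next.
have i2 : intR P (fun w => \int[Q]_z F (sample_of n w, z)).
  apply: (@intR_bounded _ _ _ _ _ M) => //.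
  exact: (measurableT_comp mG).
apply: (@addIr _ M); apply: EFin_inj.
have K (G : Omega -> R) : intR P G ->
    ((\int[P]_w G w + M)%R%:E = \int[P]_w (G w + M)%:E)%E.
  move=> iG; rewrite RintE; last by apply: intRD => //; exact: intR_cst.
  by rewrite RintD ?Rint_cst//; exact: intR_cst.
rewrite !K//.
rewrite (@ge0_integral_sample_of_next n (fun x => (F x + M)%:E))//.
  by apply: eq_integral => w _; rewrite E.
Qed.

Section partial_sums.
Variable h : T -> R.
Hypothesis mh : measurable_fun setT h.

Definition tuple_sum n (x : n.-tuple T) : R := \sum_(i < n) h (tnth x i).

Definition sample_sum n (w : Omega) : R := tuple_sum (sample_of n w).

Lemma measurable_tuple_sum n : measurable_fun setT (@tuple_sum n).
Proof.
apply: measurable_sum => i.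
by apply: measurableT_comp => //; exact: measurable_tnth.
Qed.

Lemma measurable_sample_sum n : measurable_fun setT (sample_sum n).
Proof. by apply: (measurableT_comp (@measurable_tuple_sum n)); exact: measurable_sample_of. Qed.

Lemma sample_sumS n w : sample_sum n.+1 w = sample_sum n w + h (Z n w).
Proof.
rewrite /sample_sum /tuple_sum big_ord_recr/= !tnth_mktuple; congr (_ + _).
by apply: eq_bigr => i _; rewrite !tnth_mktuple.
Qed.

Hypothesis h1 : intR Q h.
Hypothesis h2 : intR Q (fun z => h z ^+ 2).
Hypothesis hc : \int[Q]_z h z = 0.
Let v := \int[Q]_z h z ^+ 2.

(** Expanding the square of a sum plus a new term, the cross term vanishes
    because [h] is centered. *)
Lemma sample_sum_second_moment n : (\int[P]_w (sample_sum n w ^+ 2)%:E = (n%:R * v)%:E)%E.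
Proof.
elim: n => [|n IH].
  under eq_integral do rewrite /sample_sum /tuple_sum big_ord0 expr0n/=.
  by rewrite integral0 mul0r.
under eq_integral do rewrite sample_sumS.
rewrite (@ge0_integral_sample_of_next n (fun x => ((tuple_sum x.1 + h x.2) ^+ 2)%:E)); last 2 first.
- apply/measurable_EFinP; apply: measurable_funX; apply: measurable_funD.
    by apply: measurableT_comp => //; exact: measurable_tuple_sum.
  exact: measurableT_comp.
- by move=> x; rewrite lee_fin sqr_ge0.
have inner s : (\int[Q]_z ((s + h z) ^+ 2)%:E = (s ^+ 2 + v)%:E)%E.
  have E : (fun z => (s + h z) ^+ 2) = (fun z => s ^+ 2 + (2 * s * h z + h z ^+ 2)).
    by apply/funext => z; ring.
  have i1 : intR Q (fun z => 2 * s * h z) by exact: intRZ.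
  have i2 : intR Q (fun z => 2 * s * h z + h z ^+ 2) by exact: intRD.
  have i3 := intR_cst Q (s ^+ 2).
  have i4 := intRD i3 i2.
  rewrite (RintE (f := fun z => (s + h z) ^+ 2)) E // RintD// RintD// Rint_cst RintZ// hc.
  by congr EFin; rewrite /v; ring.
under eq_integral do rewrite /= inner.
rewrite (_ : (fun w => _) = (fun w => (sample_sum n w ^+ 2)%:E + v%:E)%E)//.
have v0 : 0 <= v by apply: Rintegral_ge0 => z _; exact: sqr_ge0.
rewrite ge0_integralD//.
- rewrite IH integral_cst// [X in (_ + _ * X)%E](@probability_setT _ _ _ P) mule1 -EFinD.
  by congr EFin; rewrite -natr1; ring.
- by move=> w _; rewrite lee_fin sqr_ge0.
- by apply/measurable_EFinP; apply: measurable_funX; exact: measurable_sample_sum.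
Qed.

Hypothesis h3 : intR Q (fun z => h z ^+ 3).
Hypothesis h4 : intR Q (fun z => h z ^+ 4).
Let m3 := \int[Q]_z h z ^+ 3.
Let m4 := \int[Q]_z h z ^+ 4.
(* The term 4 s m3 of the expansion of E (s + h)^4 is at most 2 s^2 + 2 m3^2,
   and the recursion adds (6 v + 2) n v + 2 m3^2 + m4 <= C (2 n + 1). *)
Let C := (6 * v + 2) * v + 2 * m3 ^+ 2 + m4.

(** In the recursion the terms that are odd in the new variable either vanish
    or are absorbed by the even ones, so each step adds at most a constant plus
    a multiple of the second moment, which is linear in [n]. *)
Lemma sample_sum_fourth_moment n : (\int[P]_w (sample_sum n w ^+ 4)%:E <= (n%:R ^+ 2 * C)%:E)%E.
Proof.
have v0 : 0 <= v by apply: Rintegral_ge0 => z _; exact: sqr_ge0.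
have m40 : 0 <= m4 by apply: Rintegral_ge0 => z _; exact: (@exprn_even_ge0 _ 4).
have C0 : 0 <= C by rewrite /C; have := sqr_ge0 m3; nra.
elim: n => [|n IH].
  under eq_integral do rewrite /sample_sum /tuple_sum big_ord0 expr0n/=.
  by rewrite integral0 lee_fin expr0n/= mul0r.
under eq_integral do rewrite sample_sumS.
have mF : measurable_fun setT (fun x : n.-tuple T * T => ((tuple_sum x.1 + h x.2) ^+ 4)%:E).
  apply/measurable_EFinP; apply: measurable_funX; apply: measurable_funD.
    by apply: measurableT_comp => //; exact: measurable_tuple_sum.
  exact: measurableT_comp.
have F0 (x : n.-tuple T * T) : (0 <= ((tuple_sum x.1 + h x.2) ^+ 4)%:E)%E.
  by rewrite lee_fin (@exprn_even_ge0 _ 4).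
rewrite (ge0_integral_sample_of_next mF F0)/=.
have inner s : (\int[Q]_z ((s + h z) ^+ 4)%:E = (s ^+ 4 + 6 * s ^+ 2 * v + 4 * s * m3 + m4)%:E)%E.
  have E : (fun z => (s + h z) ^+ 4) = (fun z => s ^+ 4 + (4 * s ^+ 3 * h z + (6 * s ^+ 2 * h z ^+ 2 + (4 * s * h z ^+ 3 + h z ^+ 4)))).
    by apply/funext => z; ring.
  have i1 : intR Q (fun z => 4 * s ^+ 3 * h z) by exact: intRZ.
  have i2 : intR Q (fun z => 6 * s ^+ 2 * h z ^+ 2) by exact: intRZ.
  have i3 : intR Q (fun z => 4 * s * h z ^+ 3) by exact: intRZ.
  have i5 := intRD i3 h4.
  have i6 := intRD i2 i5.
  have i7 := intRD i1 i6.
  have i8 := intR_cst Q (s ^+ 4).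
  have i9 := intRD i8 i7.
  rewrite (RintE (f := fun z => (s + h z) ^+ 4)) E// RintD// RintD// RintD// RintD// Rint_cst !RintZ// hc.
  by congr EFin; rewrite /v /m3 /m4; ring.
have mp k : measurable_fun setT (fun w => (sample_sum n w ^+ k)%:E).
  by apply/measurable_EFinP; apply: measurable_funX; exact: measurable_sample_sum.
apply: (@le_trans _ _ (\int[P]_w ((sample_sum n w ^+ 4)%:E + ((6 * v + 2)%:E * (sample_sum n w ^+ 2)%:E + (2 * m3 ^+ 2 + m4)%:E)))%E).
  apply: ge0_le_integral => //.
  - by move=> w _; apply: integral_ge0 => z _; exact: (F0 (sample_of n w, z)).
  - apply: (measurableT_comp (f := fun x => (\int[Q]_z ((tuple_sum x + h z) ^+ 4)%:E)%E)); last exact: measurable_sample_of.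
    under eq_fun do rewrite inner.
    have mt := @measurable_tuple_sum n.
    apply/measurable_EFinP; apply: measurable_funD => //; apply: measurable_funD.
      apply: measurable_funD; first exact: measurable_funX.
      by apply: measurable_funM => //; apply: measurable_funM => //; exact: measurable_funX.
    by apply: measurable_funM => //; exact: measurable_funM.
  - by do !apply: emeasurable_funD => //; exact: emeasurable_funM.
  - move=> w _; rewrite inner -!(EFinM,EFinD) lee_fin -/(sample_sum n w).
    by have := sqr_ge0 (sample_sum n w - m3); nra.
have p2 w : (0 <= (6 * v + 2)%:E * (sample_sum n w ^+ 2)%:E)%E.
  by rewrite -EFinM lee_fin; have := sqr_ge0 (sample_sum n w); nra.
have p4 w : (0 <= (sample_sum n w ^+ 4)%:E)%E by rewrite lee_fin (@exprn_even_ge0 _ 4).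
have c0 : (0 <= (2 * m3 ^+ 2 + m4)%:E)%E by rewrite lee_fin; have := sqr_ge0 m3; nra.
have q2 : measurable_fun setT (fun w => (6 * v + 2)%:E * (sample_sum n w ^+ 2)%:E)%E.
  exact: emeasurable_funM.
have q4 : measurable_fun setT (fun w => (6 * v + 2)%:E * (sample_sum n w ^+ 2)%:E + (2 * m3 ^+ 2 + m4)%:E)%E.
  exact: emeasurable_funD.
rewrite ge0_integralD//; try by move=> w _; exact: adde_ge0.
rewrite ge0_integralD//.
rewrite ge0_integralZl//; try (by move=> w _; rewrite lee_fin sqr_ge0); try (by rewrite lee_fin; lra).
rewrite sample_sum_second_moment integral_cst// [X in (_ + (_ + _ * X))%E](@probability_setT _ _ _ P) mule1.
apply: (@le_trans _ _ ((n%:R ^+ 2 * C)%:E + ((6 * v + 2)%:E * (n%:R * v)%:E + (2 * m3 ^+ 2 + m4)%:E))%E).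
  exact: leeD.
rewrite -!(EFinM,EFinD) lee_fin -natr1.
have n0 : 0 <= n%:R :> R by [].
rewrite /C; have := sqr_ge0 m3.
set a := m3 ^+ 2; move=> a0; have := mulr_ge0 v0 v0; nra.
Qed.
End partial_sums.

End independence.

(** * Strong law of large numbers *)

Section power_integrability.
Context d {T : measurableType d} {R : realType} (Q : probability T R).

Lemma intR_pow_le4 (h : T -> R) k : measurable_fun setT h ->
  intR Q (fun z => h z ^+ 4) -> (k <= 4)%N ->
  intR Q (fun z => `|h z| ^+ k).
Proof.
move=> mh h4 k4; apply: (@intR_le _ _ _ _ _ (fun z => 1 + h z ^+ 4)).
- by apply: measurable_funX; exact: measurableT_comp.
- move=> z; rewrite normrX normr_id.
  have E : h z ^+ 4 = `|h z| ^+ 4 by rewrite -normrX ger0_norm// (@exprn_even_ge0 _ 4).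
  rewrite E; have [h1|h1] := leP `|h z| 1.
    apply: (@le_trans _ _ 1); first by rewrite exprn_ile1.
    by rewrite lerDl exprn_ge0.
  apply: (@le_trans _ _ (`|h z| ^+ 4)); first by rewrite ler_weXn2l// ltW.
  by rewrite lerDr.
- by apply: intRD => //; exact: intR_cst.
Qed.

Lemma intR_pow4 (h : T -> R) k : measurable_fun setT h ->
  intR Q (fun z => h z ^+ 4) -> (k <= 4)%N ->
  intR Q (fun z => h z ^+ k).
Proof.
move=> mh h4 k4; apply: (intR_le _ _ (intR_pow_le4 mh h4 k4)).
  exact: measurable_funX.
by move=> z; rewrite normrX.
Qed.

Lemma intR_pow4_id (h : T -> R) : measurable_fun setT h ->
  intR Q (fun z => h z ^+ 4) -> intR Q h.
Proof. by move=> mh h4; have := @intR_pow4 h 1 mh h4 isT. Qed.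

(** Convexity of the fourth power. *)
Lemma intR_pow4_center (h : T -> R) c : measurable_fun setT h ->
  intR Q (fun z => h z ^+ 4) ->
  intR Q (fun z => (h z - c) ^+ 4).
Proof.
move=> mh h4.
apply: (@intR_le _ _ _ _ _ (fun z => 8 * h z ^+ 4 + 8 * c ^+ 4)).
- by apply: measurable_funX; exact: measurable_funB.
- move=> z; rewrite ger0_norm ?(@exprn_even_ge0 _ 4)//.
  have H (a b : R) : (a - b) ^+ 2 <= 2 * (a ^+ 2 + b ^+ 2) by have := sqr_ge0 (a + b); nra.
  have := H (h z) c; have := H (h z ^+ 2) (- c ^+ 2); have := sqr_ge0 (h z - c).
  have -> : (h z - c) ^+ 4 = ((h z - c) ^+ 2) ^+ 2 by rewrite -exprM.
  have -> : h z ^+ 4 = (h z ^+ 2) ^+ 2 by rewrite -exprM.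
  have -> : c ^+ 4 = (c ^+ 2) ^+ 2 by rewrite -exprM.
  have := sqr_ge0 (h z); have := sqr_ge0 c.
  move: ((h z - c) ^+ 2) (h z ^+ 2) (c ^+ 2) => x a b hb ha hx h1 h2.
  have h3 : x ^+ 2 <= (2 * (a + b)) ^+ 2 by rewrite lerXn2r ?nnegrE//; lra.
  by have := sqr_ge0 (a - b); nra.
- by apply: intRD; [exact: intRZ|exact: intR_cst].
Qed.

End power_integrability.

Section slln.
Context d {Omega : measurableType d} {R : realType} (P : probability Omega R).
Context d' {T : measurableType d'} (Q : probability T R).
Variable Z : nat -> {RV P >-> T}.
Hypothesis Zind : mutually_independent Z.
Hypothesis ZQ : forall i A, measurable A -> P (Z i @^-1` A) = Q A.

(** Comparison with a telescoping sum; only the uniform bound 2 matters. *)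
Lemma sum_inv_sqr n : \sum_(0 <= i < n) (i.+1%:R ^- 2 : R) <= 2 * (1 - n.+1%:R^-1).
Proof.
elim: n => [|n IH]; first by rewrite big_geq// invr1 subrr mulr0.
rewrite big_nat_recr//=; apply: (le_trans (lerD IH (lexx _))).
rewrite -subr_ge0.
have p1 : 0 < n.+1%:R :> R by [].
have p2 : 0 < n.+2%:R :> R by [].
have E : n.+2%:R = n.+1%:R + 1 :> R by rewrite -natr1.
have -> : 2 * (1 - n.+2%:R^-1) - (2 * (1 - n.+1%:R^-1) + n.+1%:R ^- 2) =
   n%:R / (n.+1%:R ^+ 2 * n.+2%:R) :> R.
  rewrite E -natr1; field.
  by rewrite -natr1 in p1; rewrite !gt_eqF//; lra.
by rewrite divr_ge0// mulr_ge0// exprn_ge0.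
Qed.

(** The fourth moment of the average of [n] terms is of order 1/n^2, which is
    summable; so the sum of the fourth powers of the averages is almost surely
    finite, and its terms tend to 0. *)
Lemma slln_centered (h : T -> R) : measurable_fun setT h ->
  intR Q (fun z => h z ^+ 4) -> \int[Q]_z h z = 0 ->
  {ae P, forall w, n%:R^-1 * sample_sum Z h n w @[n --> \oo] --> 0}.
Proof.
move=> mh h4 hc.
have h1 := intR_pow4_id mh h4.
have h2 := @intR_pow4 _ _ _ Q h 2 mh h4 isT.
have h3 := @intR_pow4 _ _ _ Q h 3 mh h4 isT.
have [C C0 HC] : exists2 C : R, 0 <= C &
    forall n, (\int[P]_w (sample_sum Z h n w ^+ 4)%:E <= (n%:R ^+ 2 * C)%:E)%E.
  exists ((6 * (\int[Q]_z h z ^+ 2) + 2) * (\int[Q]_z h z ^+ 2) +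
     2 * (\int[Q]_z h z ^+ 3) ^+ 2 + \int[Q]_z h z ^+ 4).
    have v0 : 0 <= \int[Q]_z h z ^+ 2 by apply: Rintegral_ge0 => z _; exact: sqr_ge0.
    have m40 : 0 <= \int[Q]_z h z ^+ 4 by apply: Rintegral_ge0 => z _; exact: (@exprn_even_ge0 _ 4).
    by have := sqr_ge0 (\int[Q]_z h z ^+ 3); nra.
  by move=> n; exact: (sample_sum_fourth_moment Zind ZQ mh h1 h2 hc h3 h4).
(* The index is shifted to avoid dividing by 0; the shift is undone at the end. *)
pose u n w : R := (n.+1%:R^-1 * sample_sum Z h n.+1 w) ^+ 4.
have u0 n w : 0 <= u n w by exact: (@exprn_even_ge0 _ 4).
have mp n : measurable_fun setT (sample_sum Z h n) by exact: measurable_sample_sum.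
have mu n : measurable_fun setT (fun w => (u n w)%:E).
  by apply/measurable_EFinP; apply: measurable_funX; exact: measurable_funM.
have iu n : (\int[P]_w (u n w)%:E <= (C * n.+1%:R ^- 2)%:E)%E.
  rewrite /u; under eq_integral do rewrite exprMn EFinM.
  rewrite ge0_integralZl//.
  - apply: (@le_trans _ _ ((n.+1%:R^-1 ^+ 4)%:E * (n.+1%:R ^+ 2 * C)%:E)%E).
      by rewrite lee_wpmul2l// lee_fin exprn_ge0.
    rewrite -EFinM lee_fin le_eqVlt; apply/orP; left; apply/eqP.
    by field; rewrite nat1r.
  - by apply/measurable_EFinP; exact: measurable_funX.
  - by move=> w _; rewrite lee_fin (@exprn_even_ge0 _ 4).
have isum : (\int[P]_w (\sum_(n <oo) (u n w)%:E) <= (2 * C)%:E)%E.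
  rewrite integral_nneseries//; last by move=> n w _; rewrite lee_fin.
  apply: lime_le.
    by apply: is_cvg_nneseries => n _ _; apply: integral_ge0 => w _; rewrite lee_fin.
  apply: nearW => n.
  apply: (@le_trans _ _ (\sum_(0 <= i < n) (C * i.+1%:R ^- 2)%:E)%E).
    by apply: lee_sum => i _; exact: iu.
  rewrite sumEFin lee_fin -mulr_sumr mulrC; apply: ler_wpM2r => //.
  apply: (le_trans (sum_inv_sqr n)).
  by rewrite ler_piMr// gerBl.
have [/=] : {ae P, forall w, (\sum_(n <oo) (u n w)%:E)%E \is a fin_num}.
  have : P.-integrable setT (fun w => (\sum_(n <oo) (u n w)%:E)%E).
    apply/integrableP; split.
      by apply: ge0_emeasurable_sum => // n w _ _; rewrite lee_fin.
    apply: (@le_lt_trans _ _ (2 * C)%:E); last by rewrite ltry.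
    apply: le_trans isum; rewrite le_eqVlt; apply/orP; left; apply/eqP.
    apply: eq_integral => w _; rewrite gee0_abs// nneseries_ge0// => n _ _.
    by rewrite lee_fin.
  by move/(integrable_ae measurableT); apply: filterS => w /(_ I).
move=> A [mA A0 sA]; exists A; split => // w /= nw; apply: sA => /= fw; apply: nw.
have : (\sum_(N <= k <oo) (u k w)%:E)%E @[N --> \oo] --> 0%E.
  by apply: nneseries_tail_cvg; [move: fw; rewrite fin_numE => /andP[_]; rewrite -ltey|move=> k; rewrite lee_fin].
move=> tail.
have ut n : ((u n w)%:E <= \sum_(n <= k <oo) (u k w)%:E)%E.
  have := @nneseries_lim_ge R (fun k => (u k w)%:E) xpredT n n.+1.
  by rewrite big_nat1; apply => k _ _; rewrite lee_fin.
have cu : u n w @[n --> \oo] --> 0.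
  move/fine_cvgP : tail => [ft ct].
  apply: (@squeeze_cvgr _ _ _ _ (cst 0) _ _ _ _ _ ct); last exact: cvg_cst.
  near=> n; rewrite u0/= -lee_fin fineK//.
  by near: n.
have c1 : n.+1%:R^-1 * sample_sum Z h n.+1 w @[n --> \oo] --> 0.
  apply/cvgr0Pnorm_lt => e e0.
  move/cvgr0Pnorm_lt : cu => /(_ (e ^+ 4) (exprn_gt0 _ e0)).
  apply: filterS => n; rewrite normrX.
  by rewrite !ltNge; apply: contra => he; rewrite lerXn2r// nnegrE ltW.
by move: c1; rewrite (cvg_shiftS (fun n => n%:R^-1 * sample_sum Z h n w)).
Unshelve. all: by end_near. Qed.

Lemma slln (h : T -> R) : measurable_fun setT h ->
  intR Q (fun z => h z ^+ 4) ->
  {ae P, forall w, n%:R^-1 * sample_sum Z h n w @[n --> \oo] --> \int[Q]_z h z}.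
Proof.
move=> mh h4; set m := \int[Q]_z h z.
have mg : measurable_fun setT (fun z => h z - m) by exact: measurable_funB.
have i1 := intR_pow4_id mh h4.
have := @slln_centered _ mg (intR_pow4_center m mh h4).
rewrite RintB//; last exact: intR_cst.
rewrite Rint_cst subrr => /(_ erefl).
apply: filterS => w c.
have -> : (fun n => n%:R^-1 * sample_sum Z h n w) =
    (fun n => n%:R^-1 * sample_sum Z (fun z => h z - m) n w + n%:R^-1 * (n%:R * m)).
  apply/funext => n; rewrite /sample_sum /tuple_sum sumrB sumr_const card_ord mulrBr.
  by rewrite -[m *+ n]mulr_natl subrK.
rewrite -[X in _ --> X]add0r; apply: cvgD => //.
apply: cvg_near_cst; near=> n.
rewrite mulrA mulVf ?mul1r// pnatr_eq0 -lt0n; near: n; exact: nbhs_infty_gt.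
Unshelve. all: by end_near. Qed.
End slln.

(** * Central limit theorem for smooth test functions *)

Section test_functions.
Context {R : realType}.
Implicit Types (g : R -> R) (B : R).
Notation N01 := (@normal_prob R 0 1).

(** Bounded Lipschitz functions with a second order Taylor expansion whose
    remainder is uniformly cubic. The coefficients [g1] and [g2], morally g' and
    g''/2, are required to be continuous and bounded so that the expansion can
    be integrated against a Gaussian law, see [heat_taylor_test]. *)
Definition smooth_test g B := [/\ 0 <= B, (forall x, `|g x| <= B),
  (forall x y, `|g x - g y| <= B * `|x - y|) &
  exists g1 g2 : R -> R, [/\ continuous g1 /\ (forall x, `|g1 x| <= B),
    continuous g2 /\ (forall x, `|g2 x| <= B) &
    forall y x, `|g (y + x) - g y - g1 y * x - g2 y * x ^+ 2| <= B * `|x| ^+ 3]].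

(** What remains of [smooth_test] when the coefficients are allowed to depend
    on the point in an arbitrary way; this is all that [lindeberg_swap] uses. *)
Definition taylor_test g B := [/\ 0 <= B, (forall x, `|g x| <= B),
  (forall x y, `|g x - g y| <= B * `|x - y|) &
  forall y, exists a b, forall x,
    `|g (y + x) - g y - a * x - b * x ^+ 2| <= B * `|x| ^+ 3].

Lemma lipschitz_continuous g B : (forall x y, `|g x - g y| <= B * `|x - y|) -> continuous g.
Proof.
move=> gB x; apply/cvgrPdist_le => e e0; near=> y.
apply: (le_trans (gB x y)).
apply: (@le_trans _ _ ((`|B| + 1) * `|x - y|)).
  by rewrite ler_wpM2r//; have := ler_norm B; lra.
rewrite -ler_pdivlMl ?ltr_wpDl// mulrC.
near: y; apply: (@cvgr_dist_le _ _ _ _ _ id x); first exact: cvg_id.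
by rewrite divr_gt0// ltr_wpDl.
Unshelve. all: by end_near. Qed.

(** The law of [y] perturbed by a centered Gaussian of standard deviation [t],
    tested against [g]; time is measured by the standard deviation. *)
Definition heat (t : R) g (y : R) : R := \int[N01]_u g (y + t * u).

Lemma measurable_affine_comp g (y t : R) : continuous g ->
  measurable_fun setT (fun u : R => g (y + t * u)).
Proof.
move=> cg; apply: (measurableT_comp (continuous_measurable_fun cg)).
by apply: measurable_funD => //; exact: mulrl_measurable.
Qed.

Lemma intR_affine_comp g B (y t : R) : continuous g -> (forall x, `|g x| <= B) ->
  intR N01 (fun u : R => g (y + t * u)).
Proof.
move=> cg gB; apply: (@intR_bounded _ _ _ _ _ B) => //.
exact: measurable_affine_comp.
Qed.

(** Averaging the expansions of [g] at the points y + t u gives an expansion of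
    the average, with the same constant. *)
Lemma heat_taylor_test g B t : smooth_test g B -> taylor_test (heat t g) B.
Proof.
move=> [B0 gB gL [g1 [g2 [[c1 b1] [c2 b2] gT]]]].
have cg := lipschitz_continuous gL.
split => //.
- by move=> y; apply: Rint_bounded => //; exact: measurable_affine_comp.
- move=> x y; rewrite /heat -RintB; [|exact: intR_affine_comp gB..].
  apply: Rint_bounded.
    by apply: measurable_funB; exact: measurable_affine_comp.
  by move=> u; apply: (le_trans (gL _ _)); rewrite opprD addrACA subrr addr0.
- move=> y; exists (heat t g1 y), (heat t g2 y) => x.
  have i0 := intR_affine_comp (y + x) t cg gB.
  have i1 := intR_affine_comp y t cg gB.
  have i2 := intRZ x (intR_affine_comp y t c1 b1).
  have i3 := intRZ (x ^+ 2) (intR_affine_comp y t c2 b2).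
  have -> : heat t g (y + x) - heat t g y - heat t g1 y * x - heat t g2 y * x ^+ 2 =
    \int[N01]_u (g (y + x + t * u) - g (y + t * u) - x * g1 (y + t * u) - x ^+ 2 * g2 (y + t * u)).
    rewrite RintB//; last by apply: intRB => //; exact: intRB.
    rewrite RintB//; last exact: intRB.
    rewrite RintB// !RintZ//; [|exact: intR_affine_comp b2|exact: intR_affine_comp b1].
    by rewrite /heat; ring.
  apply: Rint_bounded.
    exact: (intR_measurable (intRB (intRB (intRB i0 i1) i2) i3)).
  move=> u; have := gT (y + t * u) x.
  by rewrite (addrAC y) ![_ * x ^+ _]mulrC (mulrC x).
Qed.

Lemma heat0 g : heat 0 g = g.
Proof.
by apply/funext => y; rewrite /heat; under eq_Rintegral do rewrite mul0r addr0; rewrite Rint_cst.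
Qed.

(** [gaussian_semigroup] applied to g + B, which is nonnegative. *)
Lemma heat_semigroup g B (s t y : R) : continuous g -> (forall x, `|g x| <= B) ->
  continuous (heat t g) ->
  0 < s -> 0 <= t -> heat s (heat t g) y = heat (Num.sqrt (s ^+ 2 + t ^+ 2)) g y.
Proof.
move=> cg gB ch s0; rewrite le_eqVlt => /predU1P[<-|t0].
  by rewrite heat0 expr0n/= addr0 sqrtr_sqr gtr0_norm.
have hB x : `|heat t g x| <= B.
  by apply: Rint_bounded => //; exact: measurable_affine_comp.
pose f x := g x + B.
have cf : continuous f by move=> x; apply: cvgD; [exact: cg|exact: cvg_cst].
have f0 x : 0 <= f x by rewrite /f; have := gB x; rewrite ler_norml => /andP[]; lra.
have E (r x : R) : (\int[N01]_u (f (x + r * u))%:E = (heat r g x + B)%:E)%E.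
  rewrite RintE; last by apply: intRD; [exact: intR_affine_comp gB|exact: intR_cst].
  rewrite RintD ?Rint_cst//; last exact: intR_cst.
  exact: intR_affine_comp gB.
have := gaussian_semigroup y cf f0 s0 t0; rewrite E.
under eq_integral do rewrite E.
rewrite RintE; last by apply: intRD; [exact: intR_affine_comp hB|exact: intR_cst].
rewrite RintD ?Rint_cst//; [|exact: intR_affine_comp hB|exact: intR_cst].
by move=> h; apply: (@addIr _ B); exact: (EFin_inj h).
Qed.

End test_functions.

Section taylor_expectation.
Context d {T : measurableType d} {R : realType} (mu : probability T R).
Variables (phi : R -> R) (B : R) (X : T -> R).
Hypotheses (pB : forall x, `|phi x| <= B) (cphi : continuous phi).
Hypotheses (mX : measurable_fun setT X)
  (iX : intR mu X)
  (iX2 : intR mu (fun w => X w ^+ 2))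
  (iX3 : intR mu (fun w => `|X w| ^+ 3)).
Hypothesis X0 : \int[mu]_w X w = 0.

(** Integrate the expansion; the linear term disappears because [X] is
    centered. *)
Lemma taylor_expectation (y a b c : R) :
  (forall x, `|phi (y + x) - phi y - b * x - c * x ^+ 2| <= B * `|x| ^+ 3) ->
  `|\int[mu]_w phi (y + a * X w) - phi y - c * a ^+ 2 * \int[mu]_w X w ^+ 2|
    <= B * `|a| ^+ 3 * \int[mu]_w `|X w| ^+ 3.
Proof.
move=> H.
have i0 : intR mu (fun w => phi (y + a * X w)).
  apply: (@intR_bounded _ _ _ _ _ B) => //.
  apply: (measurableT_comp (continuous_measurable_fun cphi)).
  by apply: measurable_funD => //; exact: measurable_funM.
have i1 := intR_cst mu (phi y).
have i2 := intRZ (b * a) iX.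
have i3 := intRZ (c * a ^+ 2) iX2.
have -> : \int[mu]_w phi (y + a * X w) - phi y - c * a ^+ 2 * \int[mu]_w X w ^+ 2 =
  \int[mu]_w (phi (y + a * X w) - phi y - b * a * X w - c * a ^+ 2 * X w ^+ 2).
  rewrite RintB//; last by apply: intRB => //; exact: intRB.
  rewrite RintB//; last exact: intRB.
  by rewrite RintB// !RintZ// Rint_cst X0 mulr0 subr0.
rewrite -RintZ//; apply: Rint_norm_le.
- by apply: intRB => //; apply: intRB => //; exact: intRB.
- exact: intRZ.
- move=> w; have := H (a * X w); rewrite normrM !exprMn !mulrA; exact.
Qed.
End taylor_expectation.

Section clt.
Context d {Omega : measurableType d} {R : realType} (P : probability Omega R).
Context d' {T : measurableType d'} (Q : probability T R).
Variable Z : nat -> {RV P >-> T}.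
Hypothesis Zind : mutually_independent Z.
Hypothesis ZQ : forall i A, measurable A -> P (Z i @^-1` A) = Q A.
Variable h : T -> R.
Hypothesis mh : measurable_fun setT h.
Hypothesis h4 : intR Q (fun z => h z ^+ 4).
Hypothesis hc : \int[Q]_z h z = 0.
Variable s : R.
Hypothesis s0 : 0 < s.
Hypothesis hs : \int[Q]_z h z ^+ 2 = s ^+ 2.
Notation N01 := (@normal_prob R 0 1).

Let K := \int[Q]_z `|h z| ^+ 3 + s ^+ 3 * \int[N01]_u `|u| ^+ 3.

(** An observation and a Gaussian variable with the same first two moments
    have expectations that agree up to a cubic remainder. *)
Lemma lindeberg_swap (phi : R -> R) B (a y : R) : taylor_test phi B -> 0 < a ->
  `|\int[Q]_z phi (y + a * h z) - heat (a * s) phi y| <= B * K * a ^+ 3.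
Proof.
move=> [B0 pB pL pT] a0.
have cp := lipschitz_continuous pL.
have [b [c H]] := pT y.
have [i1 i2 i3 e1 e2] := @gaussian_moments R.
have h1 := @taylor_expectation _ _ _ Q phi B h pB cp mh (intR_pow4_id mh h4)
  (@intR_pow4 _ _ _ Q h 2 mh h4 isT) (@intR_pow_le4 _ _ _ Q h 3 mh h4 isT) hc y a b c H.
have h2 := @taylor_expectation _ _ _ N01 phi B (fun u => u) pB cp (@measurable_id _ _ _) i1 i2 i3 e1 y (a * s) b c H.
rewrite hs (gtr0_norm a0) in h1.
rewrite e2 mulr1 (gtr0_norm (mulr_gt0 a0 s0)) -/(heat (a * s) phi y) in h2.
have E : c * a ^+ 2 * s ^+ 2 = c * (a * s) ^+ 2 by ring.
rewrite {}E in h1; set e := c * (a * s) ^+ 2 in h1 h2.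
set I := \int[Q]_z phi _; set J := heat _ _ _ in h2 *.
have -> : I - J = (I - phi y - e) - (J - phi y - e) by ring.
apply: (le_trans (ler_normB _ _)); apply: (le_trans (lerD h1 h2)).
by rewrite /K exprMn le_eqVlt; apply/orP; left; apply/eqP; ring.
Qed.

(** Lindeberg's method: the summands are replaced by Gaussian variables one
    at a time. Each replacement costs a constant times n^(-3/2) by
    [lindeberg_swap], and there are [n] of them. The Gaussian variables that
    have already been put in are merged into a single one by
    [heat_semigroup]. *)
Lemma clt_smooth (g : R -> R) B : smooth_test g B ->
  \int[P]_w g ((Num.sqrt n%:R)^-1 * sample_sum Z h n w) @[n --> \oo] -->
  \int[N01]_u g (s * u).
Proof.
move=> gB; have [B0 gb gL _] := gB.
have cg := lipschitz_continuous gL.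
have ht t := heat_taylor_test t gB.
have cht t : continuous (heat t g) by have [_ _ + _] := ht t; exact: lipschitz_continuous.
have hb t x : `|heat t g x| <= B by have [_ + _ _] := ht t; exact.
have K0 : 0 <= K.
  rewrite /K addr_ge0//; first by apply: Rintegral_ge0 => z _; exact: exprn_ge0.
  by apply: mulr_ge0; [rewrite exprn_ge0 ?ltW|apply: Rintegral_ge0 => z _; exact: exprn_ge0].
have main n : (0 < n)%N ->
  `|\int[P]_w g ((Num.sqrt n%:R)^-1 * sample_sum Z h n w) - \int[N01]_u g (s * u)| <=
   B * K * (Num.sqrt n%:R)^-1.
  move=> n0; set a := (Num.sqrt n%:R)^-1.
  have n0' : 0 < n%:R :> R by rewrite ltr0n.
  have a0 : 0 < a by rewrite invr_gt0 sqrtr_gt0.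
  have a2 : a ^+ 2 = n%:R^-1 by rewrite exprVn sqr_sqrtr// ltW.
  (* The j-th hybrid: j observations, and n - j Gaussian variables merged into one. *)
  pose A j := \int[P]_w heat (a * s * Num.sqrt (n - j)%:R) g (a * sample_sum Z h j w).
  have step j : (j < n)%N -> `|A j.+1 - A j| <= B * K * a ^+ 3.
    move=> jn; rewrite /A; set t := a * s * Num.sqrt (n - j.+1)%:R.
    have t0 : 0 <= t by rewrite !mulr_ge0// ltW.
    have E : a * s * Num.sqrt (n - j)%:R = Num.sqrt ((a * s) ^+ 2 + t ^+ 2).
      have -> : t ^+ 2 = (a * s) ^+ 2 * (n - j.+1)%:R by rewrite /t exprMn sqr_sqrtr.
      have -> : (a * s) ^+ 2 + (a * s) ^+ 2 * (n - j.+1)%:R = (a * s) ^+ 2 * (n - j)%:R.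
        by rewrite -(subnSK jn) -natr1; ring.
      by rewrite sqrtrM ?sqr_ge0// sqrtr_sqr ger0_norm// mulr_ge0// ltW.
    rewrite E.
    pose F (x : j.-tuple T * T) := heat t g (a * (tuple_sum h x.1 + h x.2)).
    have mF : measurable_fun setT F.
      apply: (measurableT_comp (continuous_measurable_fun (cht t))).
      apply: measurable_funM => //; apply: measurable_funD.
        by apply: measurableT_comp => //; exact: measurable_tuple_sum.
      exact: measurableT_comp.
    have [mG bG EG] := @Rint_sample_of_next _ _ _ P _ _ Q Z Zind ZQ j F B mF (fun x => hb t _).
    have -> : \int[P]_w heat t g (a * sample_sum Z h j.+1 w) = \int[P]_w \int[Q]_z F (sample_of Z j w, z).
      by rewrite -EG; apply: eq_Rintegral => w _; rewrite sample_sumS.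
    have mS := @measurable_sample_of _ _ _ P _ _ Z j.
    rewrite -RintB; last 2 first.
    - by apply: (@intR_bounded _ _ _ _ _ B) => //; exact: (measurableT_comp mG mS).
    - apply: (@intR_bounded _ _ _ _ _ B) => //.
      apply: (measurableT_comp (continuous_measurable_fun (cht _))).
      by apply: measurable_funM => //; exact: measurable_sample_sum.
    apply: Rint_bounded.
      apply: measurable_funB; first exact: (measurableT_comp mG mS).
      apply: (measurableT_comp (continuous_measurable_fun (cht _))).
      by apply: measurable_funM => //; exact: measurable_sample_sum.
    move=> w; rewrite -(heat_semigroup _ cg gb (cht t)) ?mulr_gt0//.
    rewrite /F/=; under eq_Rintegral do rewrite mulrDr.
    exact: lindeberg_swap.
  have tel j : (j <= n)%N -> `|A j - A 0%N| <= j%:R * (B * K * a ^+ 3).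
    elim: j => [|j IH] jn; first by rewrite subrr normr0 mul0r.
    have -> : A j.+1 - A 0%N = (A j.+1 - A j) + (A j - A 0%N) by rewrite addrA subrK.
    rewrite -natr1 mulrDl mul1r [leRHS]addrC.
    apply: (le_trans (ler_normD _ _)); apply: lerD; first exact: step.
    exact/IH/ltnW.
  have An : A n = \int[P]_w g (a * sample_sum Z h n w).
    by rewrite /A subnn sqrtr0 mulr0 heat0.
  have A0 : A 0%N = \int[N01]_u g (s * u).
    rewrite /A subn0.
    have -> : a * s * Num.sqrt n%:R = s by rewrite mulrAC mulVf ?mul1r// gt_eqF// sqrtr_gt0.
    under eq_Rintegral do rewrite /sample_sum /tuple_sum big_ord0 mulr0.
    by rewrite Rint_cst; apply: eq_Rintegral => u _; rewrite add0r.
  rewrite -An -A0; apply: (le_trans (tel n (leqnn n))).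
  rewrite (exprS a 2) a2 le_eqVlt; apply/orP; left; apply/eqP.
  by field; rewrite gt_eqF.
apply/cvgrPdist_le => e e0; near=> n.
rewrite distrC; apply: (le_trans (main n _)); first by near: n; exact: nbhs_infty_gt.
have n0 : 0 < n%:R :> R by rewrite ltr0n; near: n; exact: nbhs_infty_gt.
rewrite ler_pdivrMr ?sqrtr_gt0// -ler_pdivrMl// mulrC.
apply: (@le_trans _ _ (Num.sqrt ((B * K / e) ^+ 2))).
  by rewrite sqrtr_sqr ler_norm.
apply: ler_wsqrtr; near: n; exact: nbhs_infty_ger.
Unshelve. all: by end_near. Qed.
End clt.

(** * Convergence in distribution *)

Section smooth_approximation.
Context {R : realType}.
Implicit Types (g : R -> R).

Lemma vanishing_bounded g K : continuous g -> vanishes_off K g ->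
  exists2 M : R, 0 <= M & forall x, `|g x| <= M.
Proof.
move=> cg g0.
have K0 : - `|K| <= `|K| by have := normr_ge0 K; lra.
have cw : {within `[- `|K|, `|K|], continuous (fun x => `|g x|)}.
  by apply: continuous_subspaceT => x; apply: cvg_norm; exact: cg.
have [c _ H] := EVT_max K0 cw.
exists `|g c| => // x; have [xK|xK] := leP `|x| `|K|.
  by apply: H; rewrite in_itv/= -ler_norml.
by rewrite g0 ?normr0//; apply: le_lt_trans xK; exact: ler_norm.
Qed.

(** Three moving averages over windows of a third of the modulus of continuity:
    every value of the result is a value of [g] at a distance where [g] varies
    by at most [e], and the result has three bounded derivatives. *)
Lemma smooth_approximation g K (e : R) : continuous g -> vanishes_off K g -> 0 < e ->
  exists h B, smooth_test h B /\ forall x, `|h x - g x| <= e.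
Proof.
move=> cg g0 e0.
have [M M0 gM] := vanishing_bounded cg g0.
have [d d0 hd] := uniform_continuity cg g0 e0.
pose r := d / 3; have r0 : 0 < r by rewrite divr_gt0.
have [h1 [d1 v1 a1]] := average_step cg g0 r0.
have c1 : continuous h1 by move=> x; exact: is_derive_continuous (d1 x).
have [h2 [d2 v2 a2]] := average_step c1 v1 r0.
have c2 : continuous h2 by move=> x; exact: is_derive_continuous (d2 x).
have [h3 [d3 v3 a3]] := average_step c2 v2 r0.
pose D (f : R -> R) x := (f (x + r) - f x) / r.
have dD f f' (x : R) : (forall x : R, is_derive x 1 f (f' x)) -> is_derive x 1 (D f) (D f' x).
  move=> df; apply: (is_derive_eq (derM (derB (der_comp (df _) (derD (der_id _) (der_cst _ _))) (df _)) (der_cst _ _))).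
  by rewrite /D; ring.
have bD f (C : R) x : (forall x, `|f x| <= C) -> `|D f x| <= 2 * C / r.
  move=> fC; rewrite /D normrM normfV (gtr0_norm r0) ler_pM2r ?invr_gt0//.
  by apply: (le_trans (ler_normB _ _)); rewrite mulr_natl mulr2n lerD.
have b1 x : `|h1 x| <= M by have [c _ ->] := a1 x.
have b2 x : `|h2 x| <= M by have [c _ ->] := a2 x.
have b3 x : `|h3 x| <= M by have [c _ ->] := a3 x.
pose C1 := 2 * M / r; pose C2 := 2 * C1 / r; pose C3 := 2 * C2 / r.
have C10 : 0 <= C1 by apply: divr_ge0; [exact: mulr_ge0|exact: ltW].
have C20 : 0 <= C2 by apply: divr_ge0; [exact: mulr_ge0|exact: ltW].
have C30 : 0 <= C3 by apply: divr_ge0; [exact: mulr_ge0|exact: ltW].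
have q1 (x : R) : is_derive x 1 h3 (D h2 x) by exact: d3.
have q2 (x : R) : is_derive x 1 (D h2) (D (D h1) x) by apply: dD => y; exact: d2.
have q3 (x : R) : is_derive x 1 (D (D h1)) (D (D (D g)) x).
  by apply: dD => y; apply: dD => z; exact: d1.
have e1 x : `|D h2 x| <= C1 by exact: bD.
have e2 x : `|D (D h1) x| <= C2 by apply: (bD _ _ _) => y; exact: bD.
have e3 x : `|D (D (D g)) x| <= C3 by apply: (bD _ _ _) => y; apply: (bD _ _ _) => z; exact: bD.
pose B := M + C1 + C2 + C3.
exists h3, B; split; last first.
  move=> x; have [c3 h3c ->] := a3 x; have [c2' h2c ->] := a2 c3; have [c1' h1c ->] := a1 c2'.
  apply: hd; move: h1c h2c h3c => /andP[? ?] /andP[? ?] /andP[? ?].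
  have rE : d = r + r + r by rewrite /r; lra.
  by rewrite ger0_norm; lra.
split.
- by rewrite /B; lra.
- by move=> x; apply: (le_trans (b3 x)); rewrite /B; lra.
- move=> x y; apply: (@le_trans _ _ (C1 * `|x - y|)).
    by apply: (@mean_value_bound _ h3 (D h2)) => t _; split.
  by rewrite ler_wpM2r//= /B; lra.
- exists (D h2), (fun x => D (D h1) x / 2); split.
  + split; first by move=> x; exact: is_derive_continuous (q2 x).
    by move=> x; apply: (le_trans (e1 x)); rewrite /B; lra.
  + split.
      move=> x; apply: cvgM; last exact: cvg_cst.
      exact: is_derive_continuous (q3 x).
    move=> x; rewrite normrM normfV (ger0_norm (_ : 0 <= 2))//.
    by have := e2 x; have := normr_ge0 (D (D h1) x); rewrite /B; lra.
  move=> y x.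
  have T1 t : `|t - y| <= `|x| -> `|D (D h1) t - D (D h1) y| <= C3 * `|t - y| ^+ 1.
    apply: (@taylor_step _ _ (D (D (D g)))) => // s _; rewrite expr0 mulr1; exact: e3.
  have T2 t : `|t - y| <= `|x| ->
     `|(D h2 t - D (D h1) y * t) - (D h2 y - D (D h1) y * y)| <= C3 * `|t - y| ^+ 2.
    apply: (@taylor_step _ (fun t => D h2 t - D (D h1) y * t) (fun t => D (D h1) t - D (D h1) y)) => // s _.
    apply: (is_derive_eq (derB (q2 s) (derM (der_cst _ _) (der_id _)))).
    by rewrite mul0r mulr1 add0r.
  have := @taylor_step _ (fun t => h3 t - D h2 y * t - D (D h1) y / 2 * ((t - y) * (t - y)))
     (fun t => D h2 t - D h2 y - D (D h1) y * (t - y)) y `|x| C3 2 C30 _ _ (y + x).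
  rewrite (addrC y x) addrK (addrC x y) => T3.
  apply: (@le_trans _ _ (C3 * `|x| ^+ 3)); last first.
    by rewrite ler_wpM2r ?exprn_ge0//= /B; lra.
  rewrite (_ : h3 _ - _ - _ - _ = h3 (y + x) - D h2 y * (y + x) - D (D h1) y / 2 * (x * x) -
       (h3 y - D h2 y * y - D (D h1) y / 2 * ((y - y) * (y - y)))); last by ring.
  apply: T3 => //.
  + move=> s _.
    have db := derB (der_id s) (der_cst s y).
    apply: (is_derive_eq (derB (derB (q1 s) (derM (der_cst _ _) (der_id _)))
      (derM (der_cst _ _) (derM db db)))).
    by field.
  + move=> s /T2.
    by rewrite (_ : _ - _ - _ = D h2 s - D h2 y - D (D h1) y * (s - y))//; ring.
Qed.
End smooth_approximation.

Section bounded_convergence.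
Context d {Omega : measurableType d} {R : realType} (P : probability Omega R).

Lemma bounded_convergence (f_ : nat -> Omega -> R) (f : Omega -> R) (C : R) :
  (forall n, measurable_fun setT (f_ n)) -> measurable_fun setT f ->
  (forall n x, `|f_ n x| <= C) ->
  {ae P, forall x, f_ n x @[n --> \oo] --> f x} ->
  \int[P]_x f_ n x @[n --> \oo] --> \int[P]_x f x.
Proof.
move=> mf_ mf fC ff.
have [|||||i1 _ H] := @dominated_convergence _ _ _ P setT measurableT (fun n x => (f_ n x)%:E)
  (EFin \o f) (cst C%:E).
- by move=> n; exact/measurable_EFinP.
- exact/measurable_EFinP.
- by apply: filterS ff => x + _; apply: cvg_EFin; exact: nearW.
- exact: intR_cst.
- by apply: aeW => x n _ /=; rewrite lee_fin.
by apply: fine_cvg; rewrite fineK//; exact: integrable_fin_num.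
Qed.

End bounded_convergence.

Section weak_convergence.
Context d {Omega : measurableType d} {R : realType} (P : probability Omega R).
Variable (mu : probability (measurableTypeR R) R) (X : nat -> Omega -> R).
Hypothesis mX : forall n, measurable_fun setT (X n).

Let iX g M n : continuous g -> (forall x, `|g x| <= M) ->
  intR P (fun w => g (X n w)).
Proof.
move=> cg gM; apply: (@intR_bounded _ _ _ _ _ M) => //.
exact: (measurableT_comp (continuous_measurable_fun cg)).
Qed.

Let imu g M : continuous g -> (forall x, `|g x| <= M) ->
  intR mu g.
Proof.
by move=> cg gM; apply: (@intR_bounded _ _ _ _ _ M) => //; exact: continuous_measurable_fun.
Qed.

Lemma cvg_compact_support g K : continuous g -> vanishes_off K g ->
  (forall h B, smooth_test h B -> \int[P]_w h (X n w) @[n --> \oo] --> \int[mu]_x h x) ->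
  \int[P]_w g (X n w) @[n --> \oo] --> \int[mu]_x g x.
Proof.
move=> cg g0 H; apply/cvgrPdist_le => e e0.
have e30 : 0 < e / 3 by rewrite divr_gt0.
have [h [B [hB hg]]] := smooth_approximation cg g0 e30.
have [_ hb hL _] := hB; have ch := lipschitz_continuous hL.
have [M _ gM] := vanishing_bounded cg g0.
have /cvgrPdist_le /(_ _ e30) := H _ _ hB.
apply: filterS => n Hn.
have E1 : `|\int[P]_w h (X n w) - \int[P]_w g (X n w)| <= e / 3.
  rewrite -RintB; [|exact: iX hb|exact: iX gM].
  apply: Rint_bounded => //; apply: measurable_funB;
   by apply: (measurableT_comp (continuous_measurable_fun _)).
have E2 : `|\int[mu]_x h x - \int[mu]_x g x| <= e / 3.
  rewrite -RintB; [|exact: imu hb|exact: imu gM].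
  by apply: Rint_bounded => //; apply: measurable_funB; exact: continuous_measurable_fun.
move: E1 E2 Hn; rewrite !ler_norml => /andP[? ?] /andP[? ?] /andP[? ?].
by apply/andP; split; lra.
Qed.

(** A trapezoidal bump, 1 on [-K, K] and 0 outside [-(K + 1), K + 1]. *)
Definition cutoff (K x : R) : R := Num.max 0 (Num.min 1 (K + 1 - `|x|)).

Lemma cutoff_continuous K : continuous (cutoff K).
Proof.
apply: (@lipschitz_continuous _ _ 1) => x y; rewrite mul1r.
apply: (@le_trans _ _ `| `|x| - `|y| |); last exact: ler_dist_dist.
have H (z : R) : [\/ z <= 0 /\ Num.max 0 (Num.min 1 z) = 0, 1 <= z /\ Num.max 0 (Num.min 1 z) = 1
    | 0 <= z <= 1 /\ Num.max 0 (Num.min 1 z) = z].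
  have [z0|z0] := leP z 0.
    by apply: Or31; rewrite max_l// ge_min z0 orbT.
  have [z1|z1] := leP z 1; last first.
    by apply: Or32; rewrite max_r ?ltW.
  by apply: Or33; rewrite max_r ltW.
have N : `| `|x| - `|y| | = `|(K + 1 - `|x|) - (K + 1 - `|y|)|.
  by rewrite distrC; congr (`|_|); ring.
rewrite N /cutoff; move: (K + 1 - `|x|) (K + 1 - `|y|) => a b.
have := H b; have := H a; move: (Num.max _ _) (Num.max _ _) => a' b'.
have := ler_norm (a - b); have := ler_norm (b - a); rewrite (distrC b a) => h1 h2.
by move=> [[p ->]|[p ->]|[/andP[p1 p2] ->]] [[q ->]|[q ->]|[/andP[q1 q2] ->]];
  rewrite ler_norml; apply/andP; split; lra.
Qed.

Lemma cutoff_bounds K x : 0 <= cutoff K x <= 1.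
Proof. by rewrite le_max lexx/= ge_max ler01/= ge_min lexx. Qed.

Lemma cutoff_vanishes K : vanishes_off (K + 1) (cutoff K).
Proof.
move=> x hx; rewrite /cutoff max_l// ge_min; apply/orP; right; lra.
Qed.

Lemma cutoff1 K x : `|x| <= K -> cutoff K x = 1.
Proof. by move=> hx; rewrite /cutoff min_l ?max_r//; lra. Qed.

(** The limit law has little mass outside a large segment; testing against a
    [cutoff] transfers this to the laws of X_n, so that a bounded continuous
    function may be replaced by its product with the cutoff, which is uniformly
    approximated by smooth functions. *)
Lemma cvg_in_distribution_smooth :
  (forall h B, smooth_test h B -> \int[P]_w h (X n w) @[n --> \oo] --> \int[mu]_x h x) ->
  cvg_in_distribution P X mu.
Proof.
move=> H g cg [M0 gM0].
have [M [M1 gM]] : exists M, 1 <= M /\ forall x, `|g x| <= M.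
  exists (`|M0| + 1); split; first by rewrite lerDr.
  by move=> x; apply: (le_trans (gM0 x)); have := ler_norm M0; lra.
have -> : (\int[mu]_x (g x)%:E = (\int[mu]_x g x)%R%:E)%E by rewrite RintE//; exact: imu gM.
have -> : (fun n => 'E_P[g \o X n])%E = (fun n => (\int[P]_w g (X n w))%R%:E).
  by apply/funext => n; rewrite unlock RintE//; exact: iX gM.
apply: cvg_EFin; first exact: nearW.
have cutM K x : `|cutoff K x| <= 1.
  by have /andP[h1 h2] := cutoff_bounds K x; rewrite ger0_norm.
apply/cvgrPdist_le => e e0.
(* The tails of the limit and of X_n and the error for the truncated function
   will add up to at most 5 M r. *)
pose r := e / (5 * M).
have r0 : 0 < r by rewrite divr_gt0// mulr_gt0//; lra.
have [K HK] : exists K, 1 - \int[mu]_x cutoff K x <= r.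
  have c1 : \int[mu]_x cutoff n%:R x @[n --> \oo] --> (1 : R).
    rewrite -[X in _ --> X](Rint_cst mu 1).
    apply: (@bounded_convergence _ (measurableTypeR R) R mu _ _ 1) => //.
      by move=> n; exact: continuous_measurable_fun (@cutoff_continuous _).
    apply: aeW => x; apply: cvg_near_cst; near=> n.
    by apply: cutoff1; near: n; exact: nbhs_infty_ger.
  have /cvgrPdist_le /(_ _ r0) [n _ /(_ n (leqnn n))] := c1.
  by move=> /ler_normlP[_ h]; exists n%:R; exact: h.
have cc := @cutoff_continuous K.
pose g' x := g x * cutoff K x.
have cg' : continuous g' by move=> x; apply: cvgM; [exact: cg|exact: cc].
have g'0 : vanishes_off (K + 1) g' by move=> x hx; rewrite /g' cutoff_vanishes ?mulr0.
have g'M x : `|g' x| <= M.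
  by rewrite normrM -[leRHS]mulr1 ler_pM.
have := cvg_compact_support cg' g'0 H => /cvgrPdist_le /(_ _ (divr_gt0 e0 (ltr0n _ 5))).
have := cvg_compact_support cc (@cutoff_vanishes K) H => /cvgrPdist_le /(_ _ r0).
apply: filterS2 => n h1 h2.
have B1 : `|\int[P]_w g (X n w) - \int[P]_w g' (X n w)| <= M * (1 - \int[P]_w cutoff K (X n w)).
  have i0 := iX n cg gM; have i1 := iX n cg' g'M; have i2 := iX n cc (cutM K).
  rewrite -RintB// -[X in X - \int[P]_w cutoff _ _](Rint_cst P 1) -RintB//; last exact: intR_cst.
  rewrite -RintZ; last by apply: intRB => //; exact: intR_cst.
  apply: Rint_norm_le; [exact: intRB|by apply: intRZ; apply: intRB => //; exact: intR_cst|].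
  move=> w; rewrite /g' -{1}[g _]mulr1 -mulrBr normrM.
  have /andP[c0 c1] := cutoff_bounds K (X n w).
  by rewrite (ger0_norm (_ : 0 <= 1 - _)) ?subr_ge0// ler_wpM2r// subr_ge0.
have B2 : `|\int[mu]_x g x - \int[mu]_x g' x| <= M * (1 - \int[mu]_x cutoff K x).
  have i0 := imu cg gM; have i1 := imu cg' g'M; have i2 := imu cc (cutM K).
  rewrite -RintB// -[X in X - \int[mu]_x cutoff _ _](Rint_cst mu 1) -RintB//; last exact: intR_cst.
  rewrite -RintZ; last by apply: intRB => //; exact: intR_cst.
  apply: Rint_norm_le; [exact: intRB|by apply: intRZ; apply: intRB => //; exact: intR_cst|].
  move=> w; rewrite /g' -{1}[g _]mulr1 -mulrBr normrM.
  have /andP[c0 c1] := cutoff_bounds K w.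
  by rewrite (ger0_norm (_ : 0 <= 1 - _)) ?subr_ge0// ler_wpM2r// subr_ge0.
have rM : M * r = e / 5 by rewrite /r; field; lra.
have m1 : M * (1 - \int[mu]_x cutoff K x) <= e / 5 by rewrite -rM ler_wpM2l//; lra.
have m2 : M * (1 - \int[P]_w cutoff K (X n w)) <= 2 * (e / 5).
  rewrite -rM mulrCA ler_wpM2l//; first by lra.
  by move: h1; rewrite ler_norml => /andP[? ?]; lra.
move: h2 B1 B2; rewrite /= !ler_norml => /andP[? ?] /andP[? ?] /andP[? ?].
by apply/andP; split; lra.
Unshelve. all: by end_near. Qed.

End weak_convergence.

Section slutsky.
Context d {Omega : measurableType d} {R : realType} (P : probability Omega R).
Variables (X Y : nat -> Omega -> R) (v : R) (l : (R -> R) -> R).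
Hypotheses (mX : forall n, measurable_fun setT (X n)) (mY : forall n, measurable_fun setT (Y n)).
Hypothesis v0 : 0 <= v.
Hypothesis Yv : forall n, (\int[P]_w (Y n w ^+ 2)%:E <= v%:E)%E.
Hypothesis XY : forall r, 0 < r ->
  {ae P, forall w, \forall n \near \oo, `|X n w - Y n w| <= r * `|Y n w|}.

(** If X_n and Y_n are eventually close relatively to Y_n, and Y_n is bounded in
    quadratic mean, then they have the same limit law. A relative form of
    closeness suits the likelihood equation, whose root is the normalized score
    multiplied by a factor tending to 1. *)
Lemma slutsky_smooth (h : R -> R) B (c : R) : smooth_test h B ->
  \int[P]_w h (Y n w) @[n --> \oo] --> c -> \int[P]_w h (X n w) @[n --> \oo] --> c.
Proof.
move=> [B0 hb hL _] hY.
have ch := lipschitz_continuous hL.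
have i (Z : nat -> Omega -> R) : (forall n, measurable_fun setT (Z n)) ->
    forall n, intR P (fun w => h (Z n w)).
  move=> mZ n; apply: (@intR_bounded _ _ _ _ _ B) => //.
  exact: (measurableT_comp (continuous_measurable_fun ch)).
have iX := i X mX; have iY := i Y mY.
have iY2 n : intR P (fun w => Y n w ^+ 2).
  apply: (@ge0_intR _ _ _ _ _ v) => //; first exact: measurable_funX.
  by move=> w; exact: sqr_ge0.
have Y2 n : \int[P]_w (Y n w ^+ 2) <= v by rewrite -lee_fin -RintE.
have iYa n : intR P (fun w => `|Y n w|).
  apply: (@intR_le _ _ _ _ _ (fun w => 1 + Y n w ^+ 2)).
  - exact: measurableT_comp.
  - move=> w; rewrite normr_id -[_ ^+ 2]ger0_norm ?sqr_ge0// normrX.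
    by have := sqr_ge0 (`|Y n w| - 1); nra.
  - by apply: intRD => //; exact: intR_cst.
have Ya n : \int[P]_w `|Y n w| <= 1 + v.
  apply: (@le_trans _ _ (\int[P]_w (1 + Y n w ^+ 2))).
    apply: Rint_le => //; first by apply: intRD => //; exact: intR_cst.
    move=> w; rewrite -[_ ^+ 2]ger0_norm ?sqr_ge0// normrX.
    by have := sqr_ge0 (`|Y n w| - 1); nra.
  by rewrite RintD ?Rint_cst ?lerD2l//; exact: intR_cst.
apply/cvgrPdist_le => e e0.
have B1 : 0 < B + 1 by apply: ltr_wpDl.
have v1 : 0 < 1 + v by apply: ltr_pwDl.
pose r := e / (3 * (B + 1) * (1 + v)).
have r0 : 0 < r.
  by rewrite /r divr_gt0// mulr_gt0// mulr_gt0.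
(* The part of the difference that the relative bound does not control: bounded,
   and eventually 0 almost surely. *)
pose D n w := Num.min (2 * B) (B * Num.max 0 (`|X n w - Y n w| - r * `|Y n w|)).
have mD n : measurable_fun setT (D n).
  apply: measurable_minr => //; apply: measurable_funM => //; apply: measurable_maxr => //.
  apply: measurable_funB; first by apply: measurableT_comp => //; exact: measurable_funB.
  by apply: measurable_funM => //; exact: measurableT_comp.
have D0 n w : 0 <= D n w.
  by rewrite le_min !mulr_ge0//= le_max lexx.
have DB n w : `|D n w| <= 2 * B by rewrite ger0_norm// ge_min lexx.
have cD : \int[P]_w D n w @[n --> \oo] --> (0 : R).
  rewrite -[X in _ --> X](Rint_cst P 0).
  apply: (@bounded_convergence _ _ _ P D (fun=> 0) (2 * B)) => //.
  apply: filterS (XY r0) => w; rewrite /= => hw.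
  apply: cvg_near_cst; apply: filterS hw => n hn.
  rewrite /D max_l ?subr_le0// mulr0 min_r// mulr_ge0//.
have key n : `|\int[P]_w h (X n w) - \int[P]_w h (Y n w)| <= B * r * (1 + v) + \int[P]_w D n w.
  have iD : intR P (D n) by exact: intR_bounded (DB n).
  apply: (@le_trans _ _ (\int[P]_w (B * r * `|Y n w| + D n w))).
    rewrite -RintB//; apply: Rint_norm_le.
    - exact: intRB.
    - by apply: intRD => //; exact: intRZ.
    move=> w; have a1 := hL (X n w) (Y n w).
    have a2 : `|h (X n w) - h (Y n w)| <= 2 * B.
      by apply: (le_trans (ler_normB _ _)); have := hb (X n w); have := hb (Y n w); lra.
    have a3 : `|X n w - Y n w| <= r * `|Y n w| + Num.max 0 (`|X n w - Y n w| - r * `|Y n w|).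
      have : `|X n w - Y n w| - r * `|Y n w| <= Num.max 0 (`|X n w - Y n w| - r * `|Y n w|).
        by rewrite le_max lexx orbT.
      lra.
    rewrite /D; set m := Num.max _ _ in a3 *.
    have p : 0 <= B * r * `|Y n w| by apply: mulr_ge0 => //; apply: mulr_ge0 => //; exact: ltW.
    case: (lerP (2 * B) (B * m)) => _; first by lra.
    by apply: (le_trans a1); have := ler_wpM2l B0 a3; lra.
  rewrite RintD//; last exact: intRZ.
  rewrite RintZ// lerD2r ler_wpM2l//.
  by rewrite mulr_ge0// ltW.
have B3 : B * r * (1 + v) <= e / 3.
  have -> : B * r * (1 + v) = (B / (B + 1)) * (e / 3) by rewrite /r; field; rewrite !gt_eqF.
  by rewrite ler_piMl ?(ltW (divr_gt0 e0 _))// ler_pdivrMr// mul1r lerDl.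
have e30 : 0 < e / 3 by rewrite divr_gt0.
move/cvgrPdist_le : cD => /(_ _ e30); move/cvgrPdist_le : hY => /(_ _ e30).
apply: filterS2 => n; have := key n.
rewrite !ler_norml => /andP[? ?] /andP[? ?] /andP[? ?]; apply/andP; split; lra.
Qed.
End slutsky.

Section normal_limit.
Context {R : realType}.

Lemma Rint_normal_scale (h : R -> R) B (s : R) : 0 < s -> continuous h ->
  (forall x, `|h x| <= B) ->
  \int[normal_prob 0 1]_u h (s * u) = \int[normal_prob 0 s]_x h x.
Proof.
move=> s0 ch hB.
pose f x := h x + B.
have cf : continuous f by move=> x; apply: cvgD; [exact: ch|exact: cvg_cst].
have f0 x : 0 <= f x by rewrite /f; have := hB x; rewrite ler_norml => /andP[]; lra.
have := gaussian_affine 0 cf f0 s0; rewrite /f.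
have i1 := intR_affine_comp 0 s ch hB.
have i2 : intR (normal_prob 0 s) h.
  by apply: (@intR_bounded _ _ _ _ _ B) => //; exact: continuous_measurable_fun.
rewrite RintE; last by apply: intRD => //; exact: intR_cst.
rewrite RintE; last by apply: intRD => //; exact: intR_cst.
rewrite (RintD i1 (intR_cst _ B)) (RintD i2 (intR_cst _ B)).
rewrite (Rint_cst (normal_prob 0 1) B) (Rint_cst (normal_prob 0 s) B).
move=> E; have <- := @addIr _ B _ _ (EFin_inj E).
by apply: eq_Rintegral => u _; rewrite add0r.
Qed.
End normal_limit.

(** * The root of the likelihood equation *)

Section root_estimator.
Context {R : realType}.

(** A sequence that runs through the rational points of the segment. *)
Definition rational_point (lo hi : R) (j : nat) : R :=
  if (choice.unpickle j : option rat) is Some q then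
    if (lo <= ratr q <= hi)%R then ratr q else lo
  else lo.

(** For a function that is positive before and nonpositive after some point,
    this supremum is that point. Since only countably many values of [f] enter,
    the result depends measurably on parameters of [f], which makes it an
    estimator. *)
Definition last_positive_point (f : R -> R) (lo hi : R) : R :=
  sups (fun j => if 0 < f (rational_point lo hi j) then rational_point lo hi j else lo) 0.

Lemma rational_point_bounds (lo hi : R) j : lo <= hi -> lo <= rational_point lo hi j <= hi.
Proof.
move=> lohi; rewrite /rational_point; case: (choice.unpickle j : option rat) => [q|].
  by case: ifP => //; rewrite lexx.
by rewrite lexx.
Qed.

Let cand (f : R -> R) (lo hi : R) j := if 0 < f (rational_point lo hi j) then rational_point lo hi j else lo.

Lemma last_positive_point_ub (f : R -> R) (lo hi : R) : lo <= hi ->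
  has_ubound (range (cand f lo hi)).
Proof.
move=> lohi; exists hi => _ [j _ <-]; rewrite /cand; have /andP[_ h] := rational_point_bounds j lohi.
by case: ifP.
Qed.

Lemma last_positive_point_root (f : R -> R) (lo hi t : R) : lo < t < hi ->
  (forall x, lo <= x < t -> 0 < f x) -> (forall x, t <= x <= hi -> f x <= 0) ->
  last_positive_point f lo hi = t.
Proof.
move=> /andP[lt th] fpos fneg; have lohi := ltW (lt_trans lt th).
have ub : ubound [set cand f lo hi j | j in [set j | (0 <= j)%N]] t.
  move=> _ [j _ <-]; rewrite /cand; have /andP[h1 h2] := rational_point_bounds j lohi.
  case: ifP => [fp|_]; last exact: ltW.
  rewrite leNgt; apply/negP => tx; have := fneg _ (introT andP (conj (ltW tx) h2)).
  by rewrite leNgt fp.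
apply/eqP; rewrite eq_le; apply/andP; split.
  by apply: ge_sup => //; exists (cand f lo hi 0%N); exists 0%N.
apply/ler_addgt0Pr => e e0; rewrite -lerBlDr.
have : Num.max lo (t - e) < t by rewrite gt_max lt ltrBlDr ltrDl.
move=> /rat_in_itvoo[q]; rewrite in_itv/= gt_max => /andP[/andP[q1 q2] q3].
apply: (le_trans (ltW q2)).
apply: ub_le_sup; first by exists t.
exists (choice.pickle q) => //; rewrite /rational_point choice.pickleK.
have -> : lo <= ratr q <= hi by rewrite !ltW// (lt_trans q3).
by rewrite fpos// ltW//= q3.
Qed.

Lemma measurable_last_positive_point d (T : measurableType d) (f : R -> T -> R) (lo hi : R) :
  lo <= hi -> (forall x, lo <= x <= hi -> measurable_fun setT (f x)) ->
  measurable_fun setT (fun z => last_positive_point (f ^~ z) lo hi).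
Proof.
move=> lohi mf; apply: (@measurable_fun_sups _ _ _ setT
  (fun j z => if 0 < f (rational_point lo hi j) z then rational_point lo hi j else lo)).
  by move=> z _; exact: (@last_positive_point_ub (f ^~ z) lo hi lohi).
move=> j; apply: measurable_fun_ifT => //.
by apply: measurable_fun_ltr => //; apply: mf; exact: rational_point_bounds.
Qed.

End root_estimator.

Section local_root.
Context {R : realType}.
Variables (L s s1 : R -> R) (t0 r I m : R).
Hypotheses (r0 : 0 < r) (I0 : 0 < I) (m0 : 0 <= m).
Hypothesis rI : r * (m + 1) <= I / 4.
Hypothesis dL : forall t : R, t0 - r <= t <= t0 + r -> is_derive t 1 L (s t).
Hypothesis ds : forall t : R, t0 - r <= t <= t0 + r -> is_derive t 1 s (s1 t).
Hypothesis lip : forall t : R, t0 - r <= t <= t0 + r -> `|s1 t - s1 t0| <= `|t - t0| * (m + 1).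
Hypothesis curv : `|s1 t0 + I| <= I / 8.
Hypothesis small : `|s t0| < r * I / 4.

(** The deterministic half of the analysis of the likelihood equation, for a
    log-likelihood [L] with derivatives [s] and [s1]. Near [t0] the second
    derivative stays below - I / 2, because it is close to - I at [t0] and varies
    slowly. So [s] decreases with slope at least I / 2, and since it is small at
    [t0] it changes sign inside the interval. The last claim is the mean value
    theorem for [s] between [t0] and the root. *)
Lemma local_root (Theta : set R) : (forall t, t0 - r <= t <= t0 + r -> Theta t) ->
  let t := last_positive_point s (t0 - r) (t0 + r) in
  [/\ local_maximum Theta L t, `|t - t0| <= 2 * `|s t0| / I &
      exists2 sg, - s t0 = sg * (t - t0) &
        `|sg + I| <= `|s1 t0 + I| + `|t - t0| * (m + 1)].
Proof.
move=> Th.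
have abs_r (t : R) : t0 - r <= t <= t0 + r -> `|t - t0| <= r.
  by move=> /andP[? ?]; rewrite ler_norml; apply/andP; split; lra.
have sgb (t : R) : t0 - r <= t <= t0 + r -> s1 t <= - (I / 2).
  move=> ht; have h1 := lip ht; have h2 := abs_r _ ht.
  have h3 : `|t - t0| * (m + 1) <= r * (m + 1) by rewrite ler_wpM2r// addr_ge0.
  have h4 := le_trans h1 (le_trans h3 rI).
  by move: h4 curv; rewrite !ler_norml => /andP[? ?] /andP[? ?]; lra.
have cs (t : R) : t0 - r <= t <= t0 + r -> {for t, continuous s}.
  by move=> ht; exact: is_derive_continuous (ds ht).
have mid : t0 - r <= t0 <= t0 + r by rewrite gerBl lerDl !ltW.
have slope (u v : R) : t0 - r <= u -> u <= v -> v <= t0 + r -> s v - s u <= - (I / 2) * (v - u).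
  move=> hu uv hv.
  have [|c] := @mean_value _ s s1 u v.
    rewrite min_l// max_r// => t /andP[h1 h2]; apply: ds.
    by rewrite (le_trans hu h1) (le_trans h2 hv).
  rewrite min_l// max_r// => /andP[h1 h2] ->.
  rewrite ler_wpM2r ?subr_ge0// sgb// (le_trans hu h1) (le_trans h2 hv)//.
move: small; rewrite ltr_norml => /andP[sm1 sm2].
have shi : s (t0 + r) < 0.
  by have := slope t0 (t0 + r) ltac:(lra) ltac:(lra) ltac:(lra); lra.
have slo : 0 < s (t0 - r).
  by have := slope (t0 - r) t0 ltac:(lra) ltac:(lra) ltac:(lra); lra.
have [|||t] := @IVT R s (t0 - r) (t0 + r) 0.
- lra.
- apply: continuous_in_subspaceT => x; rewrite inE/= in_itv/=; exact: cs.
- by rewrite ge_min le_max (ltW shi) (ltW slo) orbT.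
rewrite in_itv/= => /andP[t1 t2] st.
have tlo : t0 - r < t by rewrite lt_neqAle t1 andbT; apply/eqP => E; rewrite E st ltxx in slo.
have thi : t < t0 + r by rewrite lt_neqAle t2 andbT; apply/eqP => E; rewrite -E st ltxx in shi.
have spos (x : R) : t0 - r <= x < t -> 0 < s x.
  move=> /andP[h1 h2]; have := slope x t h1 (ltW h2) t2; rewrite st.
  have : 0 < (I / 2) * (t - x) by rewrite mulr_gt0 ?subr_gt0// divr_gt0.
  lra.
have sneg (x : R) : t <= x <= t0 + r -> s x <= 0.
  move=> /andP[h1 h2]; have := slope t x t1 h1 h2; rewrite st.
  have : 0 <= (I / 2) * (x - t) by rewrite mulr_ge0 ?subr_ge0// divr_ge0// ltW.
  lra.
have -> : last_positive_point s (t0 - r) (t0 + r) = t.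
  by apply: last_positive_point_root => //; rewrite tlo.
have hm (c : R) : Num.min t0 t <= c <= Num.max t0 t -> t0 - r <= c <= t0 + r /\ `|c - t0| <= `|t - t0|.
  case: (leP t0 t) => h /andP[h1 h2]; split; try by apply/andP; split; lra.
    by rewrite !ger0_norm; lra.
  by rewrite !ler0_norm; lra.
have [|c hc sc] := @mean_value _ s s1 t0 t.
  by move=> c /hm[h _]; exact: ds.
have [c1 c2] := hm _ hc.
rewrite st sub0r in sc.
split => //.
- split; first by apply: Th; rewrite t1 t2.
  near=> u => _.
  have u1 : t0 - r < u by near: u; exact: lt_nbhsr.
  have u2 : u < t0 + r by near: u; exact: lt_nbhsl.
  have [|e he E] := @mean_value _ L s t u.
    move=> e; rewrite ge_min le_max => /andP[/orP[] h1 /orP[] h2]; apply: dL; apply/andP; split; lra.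
  rewrite -subr_le0 E.
  move: he; have [tu|ut] := leP t u.
    move=> /andP[h1 h2].
    apply: mulr_le0_ge0; last by rewrite subr_ge0.
    by apply: sneg; rewrite h1/=; lra.
  move=> /andP[h1 h2].
  apply: mulr_ge0_le0; last by rewrite subr_le0 ltW.
  move: h2; rewrite le_eqVlt => /predU1P[->|h2]; first by rewrite st.
  by apply: ltW; apply: spos; rewrite h2 andbT; lra.
- have h := sgb _ c1; have p := normr_ge0 (t - t0).
  have s10 : s1 c <= 0 by apply: (le_trans h); rewrite oppr_le0 divr_ge0// ltW.
  rewrite ler_pdivlMr// -(normrN (s t0)) sc normrM (ler0_norm s10).
  have : `|t - t0| * (I / 2) <= `|t - t0| * (- s1 c) by apply: ler_wpM2l => //; lra.
  lra.
- exists (s1 c) => //.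
  have := ler_normD (s1 c - s1 t0) (s1 t0 + I); rewrite addrA subrK => /le_trans; apply.
  rewrite addrC lerD2l; apply: (le_trans (lip c1)).
  by rewrite ler_wpM2r// addr_ge0.
Unshelve. all: by end_near. Qed.
End local_root.

(** * Asymptotic normality of the likelihood root *)

Section cramer.
Context d' {T : measurableType d'} {R : realType} (Q : probability T R).
Variables (ell s s1 : R -> T -> R) (M : T -> R) (a b t0 I : R).
Variable Theta : set R.
Hypothesis t0ab : a < t0 < b.
Hypothesis Theta_ab : forall t, a < t < b -> Theta t.
Hypothesis I0 : 0 < I.
Hypothesis dell : forall (t : R) z, a < t < b -> is_derive t 1 (ell ^~ z) (s t z).
Hypothesis ds : forall (t : R) z, a < t < b -> is_derive t 1 (s ^~ z) (s1 t z).
Hypothesis lip : forall t z, a < t < b -> `|s1 t z - s1 t0 z| <= `|t - t0| * M z.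
Hypothesis M0 : forall z, 0 <= M z.
Hypothesis ms : forall t, a < t < b -> measurable_fun setT (s t).
Hypothesis ms1 : measurable_fun setT (s1 t0).
Hypothesis mM : measurable_fun setT M.
Hypothesis is4 : intR Q (fun z => s t0 z ^+ 4).
Hypothesis is14 : intR Q (fun z => s1 t0 z ^+ 4).
Hypothesis iM4 : intR Q (fun z => M z ^+ 4).
Hypothesis Es : \int[Q]_z s t0 z = 0.
Hypothesis Es2 : \int[Q]_z s t0 z ^+ 2 = I.
Hypothesis Es1 : \int[Q]_z s1 t0 z = - I.

Let m := \int[Q]_z M z.
Let r := Num.min (Num.min ((t0 - a) / 2) ((b - t0) / 2)) (I / (4 * (m + 1))).

(** The radius [r] of the search interval depends on the information and on the
    mean [m] of the Lipschitz constant of [s1], not on the sample: over an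
    interval of this size the second derivative cannot leave the negative
    axis. *)
Definition likelihood_root n (x : n.-tuple T) : R :=
  last_positive_point (fun t => n%:R^-1 * tuple_sum (s t) x) (t0 - r) (t0 + r).

Let m0 : 0 <= m. Proof. exact: Rintegral_ge0. Qed.

Let r0 : 0 < r.
Proof.
have [h1 h2] := andP t0ab.
by rewrite !lt_min !divr_gt0 ?subr_gt0// mulr_gt0// ltr_wpDl.
Qed.

Let rab (t : R) : t0 - r <= t <= t0 + r -> a < t < b.
Proof.
have [h1 h2] := andP t0ab.
have : r <= (t0 - a) / 2 by rewrite !ge_min lexx.
have : r <= (b - t0) / 2 by rewrite !ge_min lexx orbT.
by move=> ? ? /andP[? ?]; apply/andP; split; lra.
Qed.

Let rI : r * (m + 1) <= I / 4.
Proof.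
have m1 : 0 < m + 1 by apply: ltr_wpDl.
have h : r <= I / (4 * (m + 1)) by rewrite ge_min lexx orbT.
apply: (@le_trans _ _ (I / (4 * (m + 1)) * (m + 1))); first by rewrite ler_wpM2r// ltW.
by rewrite le_eqVlt; apply/orP; left; apply/eqP; field; rewrite gt_eqF.
Qed.

Lemma measurable_likelihood_root n : measurable_fun setT (@likelihood_root n).
Proof.
apply: (@measurable_last_positive_point _ _ _ (fun t x => n%:R^-1 * tuple_sum (s t) x)).
  by have := r0; lra.
move=> t /rab tab; apply: measurable_funM => //.
by apply: measurable_tuple_sum; exact: ms.
Qed.

Lemma tuple_sum_derive (f df : R -> T -> R) (t : R) n (x : n.-tuple T) :
  (forall z, is_derive t 1 (f ^~ z) (df t z)) ->
  is_derive t 1 (fun t => n%:R^-1 * tuple_sum (f t) x) (n%:R^-1 * tuple_sum (df t) x).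
Proof.
move=> h; apply: (is_derive_eq (derM (der_cst _ _) (der_sum _))).
by rewrite mul0r add0r.
Qed.

Lemma likelihood_root_spec n (x : n.-tuple T) : (0 < n)%N ->
  n%:R^-1 * tuple_sum M x <= m + 1 ->
  `|n%:R^-1 * tuple_sum (s1 t0) x + I| <= I / 8 ->
  `|n%:R^-1 * tuple_sum (s t0) x| < r * I / 4 ->
  let t := likelihood_root x in
  [/\ local_maximum Theta (fun t => tuple_sum (ell t) x) t,
      `|t - t0| <= 2 * `|n%:R^-1 * tuple_sum (s t0) x| / I &
      exists2 sg, - (n%:R^-1 * tuple_sum (s t0) x) = sg * (t - t0) &
        `|sg + I| <= `|n%:R^-1 * tuple_sum (s1 t0) x + I| + `|t - t0| * (m + 1)].
Proof.
move=> n0 hM hs1 hs.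
have ni : 0 < n%:R^-1 :> R by rewrite invr_gt0 ltr0n.
have [||||h1 h2 h3] := @local_root R (fun t => n%:R^-1 * tuple_sum (ell t) x)
  (fun t => n%:R^-1 * tuple_sum (s t) x) (fun t => n%:R^-1 * tuple_sum (s1 t) x) t0 r I m
  r0 I0 m0 rI _ _ _ hs1 hs Theta.
- by move=> t /rab tab; apply: tuple_sum_derive => z; exact: dell.
- by move=> t /rab tab; apply: tuple_sum_derive => z; exact: ds.
- move=> t /rab tab; rewrite -mulrBr -sumrB normrM (gtr0_norm ni).
  apply: (@le_trans _ _ (`|t - t0| * (n%:R^-1 * tuple_sum M x))); last by rewrite ler_wpM2l.
  rewrite mulrCA ler_pM2l// mulr_sumr; apply: (le_trans (ler_norm_sum _ _ _)).
  by apply: ler_sum => i _; exact: lip.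
- by move=> t /rab; exact: Theta_ab.
split => //; case: h1 => [p1 p2]; split => //.
by apply: filterS p2 => u hu /hu; rewrite ler_pM2l.
Qed.

Context d {Omega : measurableType d} (P : probability Omega R).
Variable Z : nat -> {RV P >-> T}.
Hypothesis Zind : mutually_independent Z.
Hypothesis ZQ : forall i A, measurable A -> P (Z i @^-1` A) = Q A.

Let A n w := n%:R^-1 * sample_sum Z (s t0) n w.
Let H n w := n%:R^-1 * sample_sum Z (s1 t0) n w.

(** By the strong law, the averages of [s t0], [s1 t0] and [M] satisfy the
    hypotheses of [local_root] eventually; and the slope between [t0] and the
    root tends to - I. *)
Lemma likelihood_root_ae : {ae P, forall w, (\forall n \near \oo,
  local_maximum Theta (fun t => tuple_sum (ell t) (sample_of Z n w)) (likelihood_root (sample_of Z n w))) /\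
  (forall r', 0 < r' -> \forall n \near \oo,
    exists2 sg, - A n w = sg * (likelihood_root (sample_of Z n w) - t0) & `|sg + I| <= r')}.
Proof.
have l1 := slln Zind ZQ (ms t0ab) is4.
have l2 := slln Zind ZQ ms1 is14.
have l3 := slln Zind ZQ mM iM4.
rewrite Es in l1; rewrite Es1 in l2.
apply: filterS3 l1 l2 l3 => w c1 c2 c3.
have spec : \forall n \near \oo, [/\
   local_maximum Theta (fun t => tuple_sum (ell t) (sample_of Z n w)) (likelihood_root (sample_of Z n w)),
   `|likelihood_root (sample_of Z n w) - t0| <= 2 * `|A n w| / I &
      exists2 sg, - A n w = sg * (likelihood_root (sample_of Z n w) - t0) &
        `|sg + I| <= `|H n w + I| + `|likelihood_root (sample_of Z n w) - t0| * (m + 1)].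
  have p1 : 0 < r * I / 4 by rewrite divr_gt0// mulr_gt0.
  have p2 : 0 < I / 8 by rewrite divr_gt0.
  move/cvgr0Pnorm_lt : c1 => /(_ _ p1) h1.
  move/cvgrPdist_le : c2 => /(_ _ p2) h2.
  move/cvgrPdist_le : c3 => /(_ _ ltr01) h3.
  near=> n; apply: likelihood_root_spec.
  - by near: n; exact: nbhs_infty_gt.
  - have : `|m - n%:R^-1 * sample_sum Z M n w| <= 1 by near: n.
    by rewrite ler_norml /sample_sum => /andP[? ?]; lra.
  - have : `|- I - n%:R^-1 * sample_sum Z (s1 t0) n w| <= I / 8 by near: n.
    by rewrite -opprD normrN addrC.
  - by near: n.
split; first by apply: filterS spec => n [].
move=> r' r'0; have m1 : 0 < m + 1 by apply: ltr_wpDl.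
have q1 : 0 < r' / 2 by rewrite divr_gt0.
have q2 : 0 < r' * I / (4 * (m + 1)) by rewrite divr_gt0 ?mulr_gt0.
move/cvgrPdist_le : c2 => /(_ _ q1) h2.
move/cvgr0Pnorm_le : c1 => /(_ _ q2) h1.
apply: filterS3 spec h1 h2 => n [_ p1 [sg e1 e2]] p2 p3.
exists sg => //; apply: (le_trans e2).
rewrite -opprD normrN addrC in p3.
have p4 : `|likelihood_root (sample_of Z n w) - t0| * (m + 1) <= r' / 2.
  apply: (@le_trans _ _ (2 * (r' * I / (4 * (m + 1))) / I * (m + 1))).
    apply: ler_wpM2r; first exact: ltW.
    apply: (le_trans p1); apply: ler_wpM2r; first by rewrite invr_ge0 ltW.
    by apply: ler_wpM2l.
  by rewrite le_eqVlt; apply/orP; left; apply/eqP; field; rewrite !gt_eqF.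
by have := lerD p3 p4; rewrite -splitr.
Unshelve. all: by end_near. Qed.

(** The error of the root is minus the score average divided by a slope tending
    to - I; so [slutsky_smooth] compares it with the score average divided by
    [I], to which the central limit theorem applies. *)
Lemma likelihood_root_normal :
  cvg_in_distribution P (fun n w => Num.sqrt n%:R * (likelihood_root (sample_of Z n w) - t0))
    (normal_prob 0 (Num.sqrt I^-1)).
Proof.
pose h z := I^-1 * s t0 z.
have mh : measurable_fun setT h by apply: measurable_funM => //; exact: ms.
have ih4 : intR Q (fun z => h z ^+ 4).
  have -> : (fun z => h z ^+ 4) = (fun z => I^-1 ^+ 4 * s t0 z ^+ 4).
    by apply/funext => z; rewrite exprMn.
  exact: intRZ.
have is' := intR_pow4_id (ms t0ab) is4.
have is2 := @intR_pow4 _ _ _ Q (s t0) 2 (ms t0ab) is4 isT.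
have hc : \int[Q]_z h z = 0 by rewrite /h RintZ// Es mulr0.
have sI0 : 0 < Num.sqrt I^-1 by rewrite sqrtr_gt0 invr_gt0.
have hs : \int[Q]_z h z ^+ 2 = Num.sqrt I^-1 ^+ 2.
  rewrite sqr_sqrtr ?invr_ge0 ?ltW//.
  under eq_Rintegral do rewrite exprMn.
  by rewrite RintZ// Es2; field; rewrite gt_eqF.
pose Y n w := (Num.sqrt n%:R)^-1 * sample_sum Z h n w.
have mY n : measurable_fun setT (Y n).
  by apply: measurable_funM => //; exact: measurable_sample_sum.
apply: cvg_in_distribution_smooth.
  move=> n; apply: measurable_funM => //; apply: measurable_funB => //.
  exact: (measurableT_comp (@measurable_likelihood_root n) (@measurable_sample_of _ _ _ _ _ _ Z n)).
move=> g B gB.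
have [_ gb gL _] := gB.
apply: (@slutsky_smooth _ _ R P _ Y I^-1 _ _ _ _ _ g B) => //.
- move=> n; apply: measurable_funM => //; apply: measurable_funB => //.
  exact: (measurableT_comp (@measurable_likelihood_root n) (@measurable_sample_of _ _ _ _ _ _ Z n)).
- by rewrite invr_ge0 ltW.
- move=> n; rewrite /Y; under eq_integral do rewrite exprMn EFinM.
  rewrite ge0_integralZl//.
  + rewrite (sample_sum_second_moment Zind ZQ mh (intR_pow4_id mh ih4) (@intR_pow4 _ _ _ Q h 2 mh ih4 isT) hc).
    rewrite -EFinM lee_fin hs sqr_sqrtr ?invr_ge0 ?(ltW I0)// exprVn sqr_sqrtr//.
    case: n => [|n]; first by rewrite invr0 mul0r invr_ge0 ltW.
    by rewrite mulrA mulVf// mul1r.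
  + by apply/measurable_EFinP; apply: measurable_funX; exact: measurable_sample_sum.
  + by move=> w _; rewrite lee_fin sqr_ge0.
- move=> r' r'0; apply: filterS likelihood_root_ae => w [_ H'].
  have q : 0 < Num.min (I / 2) (r' * I / 2) by rewrite lt_min !divr_gt0// mulr_gt0.
  apply: filterS (H' _ q) => n [sg e1]; rewrite le_min => /andP[e2 e3].
  set t := likelihood_root _ in e1 *.
  have sgI : sg <= - (I / 2) by move: e2; rewrite ler_norml => /andP[_]; lra.
  have sg0 : sg < 0 by apply: (le_lt_trans sgI); rewrite oppr_lt0 divr_gt0.
  have tE : t - t0 = - A n w / sg by rewrite e1 mulrC mulKf// lt_eqF.
  have YE : Y n w = Num.sqrt n%:R * A n w / I.
    rewrite /Y /A /sample_sum /tuple_sum -mulr_sumr.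
    have [->|n0] := posnP n; first by rewrite big_ord0 !(mulr0,mul0r).
    have n0' : n%:R = Num.sqrt n%:R ^+ 2 :> R by rewrite sqr_sqrtr.
    have sn0 : 0 < Num.sqrt n%:R :> R by rewrite sqrtr_gt0 ltr0n.
    rewrite [in n%:R^-1]n0'; field.
    by rewrite !gt_eqF.
  have E : Num.sqrt n%:R * (t - t0) - Y n w = - (sg + I) / sg * Y n w.
    rewrite tE YE; field; rewrite gt_eqF// lt_eqF//.
  rewrite E normrM ler_wpM2r// normrM normrN normfV (ltr0_norm sg0).
  rewrite ler_pdivrMr ?oppr_gt0//; apply: (le_trans e3).
  by rewrite -mulrA ler_pM2l//; lra.
- have cg := lipschitz_continuous gL.
  rewrite -(@Rint_normal_scale R g B _ sI0 cg gb).
  exact: (clt_smooth Zind ZQ mh ih4 hc sI0 hs gB).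
Qed.
End cramer.

(** * Derivatives of the generator of the distribution function *)

Section derivatives_of_generator.
Context {R : realType}.
Implicit Types (th s x : R).

(** The coefficients of [phi]. With n = [m], differentiating
    s^(theta j - n) exp (- s^theta) gives (theta j - n) times the term with index
    (n + 1, j) minus theta times the term with index (n + 1, j + 1); the
    recursion collects these contributions with the opposite sign. *)
Fixpoint qcoef (th : R) (m j : nat) : R :=
  if m is m'.+1 then
    (m'%:R - th * j%:R) * qcoef th m' j + th * (if j is j'.+1 then qcoef th m' j' else 0)
  else (j == 0%N)%:R.

Lemma qcoef_big th m j : (m < j)%N -> qcoef th m j = 0.
Proof.
elim: m j => [|m IH] [|j] //= mj.
by rewrite !IH ?mulr0 ?addr0// ltnW.
Qed.

Lemma qcoef_ge0 th m j : 0 < th < 1 -> 0 <= qcoef th m j.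
Proof.
move=> /andP[t0 t1]; elim: m j => [|m IH] j /=; first exact: ler0n.
apply: addr_ge0; last by apply: mulr_ge0; [exact: ltW|case: j].
have [jm|mj] := leqP j m; last by rewrite qcoef_big ?mulr0.
apply: mulr_ge0 => //; rewrite subr_ge0; apply: (@le_trans _ _ j%:R); last by rewrite ler_nat.
by apply: ler_piMl; [exact: ler0n|exact: ltW].
Qed.

Lemma qcoefS0 th m : qcoef th m.+1 0 = 0.
Proof.
elim: m => [|m IH]; first by rewrite /= !mulr0n !mulr0 subrr mul0r addr0.
by rewrite -[LHS]/((m.+1%:R - th * 0%:R) * qcoef th m.+1 0 + th * 0) IH !mulr0 addr0.
Qed.

(** The coefficient of index 1 is theta times the product of the i - theta for
    0 < i <= m; bounded away from 0 locally uniformly in theta, it keeps the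
    logarithm of the density under control. *)
Lemma qcoefS1_ge th a b m : 0 < a -> a < th < b -> b < 1 ->
  a * (1 - b) ^+ m <= qcoef th m.+1 1.
Proof.
move=> a0 /andP[at_ tb] b1; elim: m => [|m IH].
  by rewrite expr0 mulr1 /= mulr0 add0r mulr1 ltW.
rewrite -[leRHS]/((m.+1%:R - th * 1) * qcoef th m.+1 1 + th * qcoef th m.+1 0).
rewrite qcoefS0 mulr0 addr0 exprSr mulrA mulrC.
apply: ler_pM => //.
- by rewrite subr_ge0 ltW.
- by rewrite mulr_ge0 ?exprn_ge0 ?subr_ge0 ?ltW.
- by rewrite mulr1; apply: lerB; [rewrite ler1n|exact: ltW].
Qed.

(** The function s^(theta j - m) exp (- s^theta). *)
Definition pterm th (m j : nat) s : R := expR ((th * j%:R - m%:R) * ln s - expR (th * ln s)).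

(** The [m]-th derivative of exp (- s^theta) times (-1)^m, see [phi_derive]. *)
Definition phi th (m : nat) s : R := \sum_(j < m.+1) qcoef th m j * pterm th m j s.

Lemma phi_ge0 th m s : 0 < th < 1 -> 0 <= phi th m s.
Proof.
by move=> ht; apply: sumr_ge0 => j _; rewrite mulr_ge0 ?qcoef_ge0// expR_ge0.
Qed.

Lemma ptermS th m j s : 0 < s -> pterm th m.+1 j s = pterm th m j s / s.
Proof.
move=> s0; rewrite /pterm -[in RHS](lnK s0) -expRN -expRD; congr expR.
by rewrite lnK// -natr1; ring.
Qed.

Lemma ptermSS th m j s : 0 < s ->
  pterm th m.+1 j.+1 s = pterm th m j s * expR (th * ln s) / s.
Proof.
move=> s0; rewrite /pterm -[X in _ / X](lnK s0) -expRN -!expRD; congr expR.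
by rewrite -!natr1; ring.
Qed.

Lemma pterm_derive th m j s : 0 < s ->
  is_derive s 1 (pterm th m j)
    (- ((m%:R - th * j%:R) * pterm th m.+1 j s + th * pterm th m.+1 j.+1 s)).
Proof.
move=> s0; have dln := is_derive1_ln s0.
apply: (is_derive_eq (der_exp (derB (derM (der_cst _ _) dln)
  (der_exp (derM (der_cst _ _) dln))))).
rewrite ptermS// ptermSS// -/(pterm th m j s); field; by rewrite gt_eqF.
Qed.

Lemma phi_derive th m s : 0 < s -> is_derive s 1 (phi th m) (- phi th m.+1 s).
Proof.
move=> s0.
apply: (is_derive_eq (der_sum (fun j => derM (der_cst s (qcoef th m j)) (pterm_derive th m j s0)))).
rewrite /phi -sumrN.
have -> : \sum_(j < m.+2) - (qcoef th m.+1 j * pterm th m.+1 j s) =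
   \sum_(j < m.+2) - ((m%:R - th * j%:R) * qcoef th m j * pterm th m.+1 j s) +
   \sum_(j < m.+2) - (th * (if (j : nat) is j'.+1 then qcoef th m j' else 0) * pterm th m.+1 j s).
  by rewrite -big_split/=; apply: eq_bigr => j _; rewrite mulrDl opprD.
rewrite [X in _ = X + _]big_ord_recr/= qcoef_big// mulr0 mul0r oppr0 addr0.
rewrite [X in _ = _ + X]big_ord_recl/= mulr0 mul0r oppr0 add0r -big_split/=.
by apply: eq_bigr => j _; ring.
Qed.

(** The power x^(-1/theta), whose sum over the coordinates is the argument of
    [phi]. *)
Definition upow th x : R := expR (- (th^-1 * ln x)).

(** Minus the derivative of [upow], extended by 0 to the negative axis. *)
Definition wpos th x : R := if 0 < x then th^-1 * expR (- ((1 + th^-1) * ln x)) else 0.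

Lemma upow_gt0 th x : 0 < upow th x. Proof. exact: expR_gt0. Qed.

Lemma wpos_ge0 th x : 0 < th -> 0 <= wpos th x.
Proof.
by move=> t0; rewrite /wpos; case: ifP => // _; rewrite mulr_ge0 ?expR_ge0// invr_ge0 ltW.
Qed.

Lemma upow_derive th x : 0 < x -> is_derive x 1 (upow th) (- wpos th x).
Proof.
move=> x0; apply: (is_derive_eq (der_exp (derN (derM (der_cst _ _) (is_derive1_ln x0))))).
rewrite /wpos x0 mul0r add0r mulrDl mul1r opprD expRD [expR (- ln x)]expRN lnK ?posrE//.
by ring.
Qed.

(** The chain rule behind the density formula: both signs cancel. *)
Lemma phi_comp_derive th m (c : R) x : 0 < x -> 0 <= c ->
  is_derive x 1 (fun y => phi th m (upow th y + c)) (phi th m.+1 (upow th x + c) * wpos th x).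
Proof.
move=> x0 c0.
have p : 0 < upow th x + c by rewrite ltr_wpDr// upow_gt0.
have d := derD (upow_derive th x0) (der_cst x c).
have dc := @der_comp _ (phi th m) (fun y => upow th y + c) x _ _ (phi_derive th m p) d.
by apply: (is_derive_eq dc); rewrite addr0 mulrNN.
Qed.

(** As x tends to 0 the argument tends to infinity, where exp (- s^theta) beats
    every power. The explicit bound is linear in x because s^theta is at least
    1/x. *)
Lemma phi_cvg0 th m (c : R) : 0 < th < 1 -> 0 <= c ->
  phi th m (upow th x + c) @[x --> 0^'+] --> (0 : R).
Proof.
move=> ht c0; have /andP[t0 t1] := ht.
pose C := \sum_(j < m.+1) qcoef th m j.
have C0 : 0 <= C by apply: sumr_ge0 => j _; exact: qcoef_ge0.
apply: (@squeeze_cvgr _ _ _ _ (fun=> 0) (fun x => C * x)); last 2 first.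
- exact: cvg_cst.
- rewrite -[X in _ --> X](mulr0 C); apply: cvgM; first exact: cvg_cst.
  by apply: cvg_at_right_filter; exact: cvg_id.
near=> x.
have x0 : 0 < x by near: x; exact: nbhs_right_gt.
have x1 : x < 1 by near: x; exact: nbhs_right_lt.
rewrite phi_ge0//= /phi /C mulr_suml; apply: ler_sum => j _.
rewrite ler_wpM2l ?qcoef_ge0// /pterm.
apply: (@le_trans _ _ (expR (ln x))); last by rewrite lnK ?posrE.
rewrite ler_expR.
have lx : ln x < 0 by rewrite -ln1 ltr_ln ?posrE.
(* The logarithm of the argument is at least - ln x / theta > 0, and the
   exponents of the powers are nonpositive; theta times this logarithm is thus
   at least - ln x, and exp y >= 1 + y concludes. *)
have hl : - (th^-1 * ln x) <= ln (upow th x + c).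
  by rewrite -[leLHS]expRK ler_ln ?posrE ?ltr_wpDr ?expR_gt0// lerDl.
have h1 : 0 <= - (th^-1 * ln x) by rewrite oppr_ge0 mulr_ge0_le0 ?invr_ge0 ?ltW.
have h2 : (th * j%:R - m%:R) * ln (upow th x + c) <= 0.
  apply: mulr_le0_ge0; last exact: le_trans hl.
  rewrite subr_le0; apply: (@le_trans _ _ j%:R); last by rewrite ler_nat -ltnS ltn_ord.
  by apply: ler_piMl; [exact: ler0n|exact: ltW].
have h3 : th * (- (th^-1 * ln x)) <= th * ln (upow th x + c) by rewrite ler_wpM2l// ltW.
have h4 : th * (- (th^-1 * ln x)) = - ln x by field; rewrite gt_eqF.
have h5 := expR_ge1Dx (th * ln (upow th x + c)).
lra.
Unshelve. all: by end_near. Qed.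

Lemma upow_cvg0 th : 0 < th -> upow th x @[x --> +oo] --> (0 : R).
Proof.
move=> t0.
apply/cvgr0Pnorm_lt => e e0; near=> x.
have x0 : 0 < x by near: x; exact: nbhs_pinfty_gt.
have hx : expR (th * - ln e) < x by near: x; exact: nbhs_pinfty_gt.
have hl : th * - ln e < ln x by rewrite -[ltLHS]expRK ltr_ln ?posrE ?expR_gt0.
rewrite gtr0_norm ?expR_gt0// /upow -[ltRHS](lnK e0) ltr_expR.
by rewrite ltrNl -ltr_pdivrMl ?invr_gt0// invrK.
Unshelve. all: by end_near. Qed.

Lemma phi_cvgy th m (c : R) : 0 < th < 1 -> 0 < c ->
  phi th m (upow th x + c) @[x --> +oo] --> phi th m c.
Proof.
move=> /andP[t0 t1] c0.
have cu := upow_cvg0 t0.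
have cphi : {for c, continuous (phi th m)} by exact: is_derive_continuous (phi_derive th m c0).
apply: (@cvg_comp _ _ _ (fun x => upow th x + c) (phi th m) _ (nbhs c)); last exact: cphi.
have H : upow th x + c @[x --> +oo] --> 0 + c by apply: cvgD => //; exact: cvg_cst.
by rewrite add0r in H; exact: H.
Qed.

Lemma phi0_cvgy th : 0 < th -> phi th 0 (upow th x + 0) @[x --> +oo] --> (1 : R).
Proof.
move=> t0.
have E (x : R) : phi th 0 (upow th x + 0) = expR (- upow 1 x).
  rewrite /phi big_ord1/= mul1r /pterm addr0 mulr0 subrr mul0r add0r /upow expRK.
  by rewrite invr1 mul1r mulrN mulrA mulfV ?gt_eqF// mul1r.
have -> : (fun x => phi th 0 (upow th x + 0)) = (fun x => expR (- upow 1 x)) by apply/funext.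
suff : expR (- upow 1 x) @[x --> +oo] --> expR (- (0 : R)) by rewrite oppr0 expR0.
apply: (@cvg_comp _ _ _ (fun x : R => - upow 1 x) expR _ (nbhs (- (0 : R)))); last exact: continuous_expR.
by apply: cvgN; exact: upow_cvg0.
Qed.

Lemma measurable_phi th m : measurable_fun setT (phi th m).
Proof.
apply: measurable_sum => j; apply: measurable_funM => //.
apply: measurableT_comp => //; apply: measurable_funB.
  by apply: measurable_funM => //; exact: measurable_ln.
by apply: measurableT_comp => //; apply: measurable_funM => //; exact: measurable_ln.
Qed.

Lemma measurable_upow th : measurable_fun setT (upow th).
Proof.
apply: measurableT_comp => //; apply: measurableT_comp => //.
by apply: measurable_funM => //; exact: measurable_ln.
Qed.

Lemma measurable_wpos th : measurable_fun setT (wpos th).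
Proof.
apply: measurable_fun_ifT => //; first exact: measurable_fun_ltr.
apply: measurable_funM => //; apply: measurableT_comp => //; apply: measurableT_comp => //.
by apply: measurable_funM => //; exact: measurable_ln.
Qed.

(** Integrating one coordinate out lowers the order of the derivative by one. *)
Lemma integral_phi_step th m (c l : R) : 0 < th < 1 -> 0 <= c ->
  phi th m (upow th x + c) @[x --> +oo] --> (l : R) ->
  (\int[lebesgue_measure]_x (phi th m.+1 (upow th x + c) * wpos th x)%:E = l%:E)%E.
Proof.
move=> ht c0 hl; have /andP[t0 t1] := ht.
pose f x := phi th m.+1 (upow th x + c) * wpos th x.
have E : (\int[lebesgue_measure]_(x in [set x | (0 < x)%R]) (f x)%:E = (l - 0)%:E)%E.
  apply: (@FTC_positive_axis R f (fun x => phi th m (upow th x + c))) => //.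
  - by move=> x x0; rewrite mulr_ge0 ?phi_ge0 ?wpos_ge0.
  - move=> x x0.
    pose g (y : R) : R := phi th m.+1 (upow th y + c) * (th^-1 * expR (- ((1 + th^-1) * ln y))).
    have h : g y @[y --> x] --> g x.
      apply: cvgM; first exact: is_derive_continuous (phi_comp_derive th m.+1 x0 c0).
      have d := derM (der_cst x th^-1) (der_exp (derN (derM (der_cst x (1 + th^-1)) (is_derive1_ln x0)))).
      exact: (is_derive_continuous d).
    have fx : f x = g x by rewrite /f /g /wpos x0.
    suff : f y @[y --> x] --> g x by rewrite -fx.
    apply: (@cvg_trans _ (g y @[y --> x])); last exact: h.
    apply: near_eq_cvg; near=> y.
    have y0 : 0 < y by near: y; exact: lt_nbhsr.
    by rewrite /f /g /wpos y0.
  - by move=> x x0; exact: phi_comp_derive.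
  - exact: phi_cvg0.
rewrite subr0 in E; rewrite -E [RHS]integral_mkcond/=.
apply: eq_integral => x _; rewrite patchE; case: ifPn => //.
by rewrite notin_setE /wpos => /negP/negbTE ->; rewrite mulr0.
Unshelve. all: by end_near. Qed.
End derivatives_of_generator.

(** * The logistic density *)

Section density_formula.
Context {R : realType} (k : nat).
Implicit Types (th : R) (z : k.-tuple R).

Definition usum th z : R := \sum_(i < k) upow th (tnth z i).

Lemma usum_gt0 th z : (0 < k)%N -> 0 < usum th z.
Proof.
move=> k0; rewrite /usum (bigD1 (Ordinal k0))//=.
by rewrite ltr_pwDl ?upow_gt0// sumr_ge0// => i _; rewrite ltW ?upow_gt0.
Qed.

Lemma logistic_cdfE th z : (0 < k)%N -> positive_orthant z ->
  logistic_cdf th z = phi th 0 (usum th z).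
Proof.
move=> k0 zp; rewrite /logistic_cdf asboolT//.
rewrite /phi big_ord1 /= mul1r /pterm mulr0 subrr mul0r add0r.
congr expR; congr (- _); rewrite /logistic_exponent.
have -> : \sum_(i < k) tnth z i `^ (- th^-1) = usum th z.
  by apply: eq_bigr => i _; rewrite /powR gt_eqF ?zp// mulNr.
by rewrite /powR gt_eqF ?usum_gt0.
Qed.

Lemma tnth_tuple_set z i (x : R) j :
  tnth (tuple_set z i x) j = if j == i then x else tnth z j.
Proof. by rewrite tnth_mktuple. Qed.

(** Each partial derivative acts on one new coordinate, since the coordinates in
    [s] are distinct; it raises the order of [phi] and contributes a factor
    [wpos]. *)
Lemma iterated_partial th z (s : seq 'I_k) : (0 < k)%N -> uniq s -> positive_orthant z ->
  foldr (fun i G => partial i G) (@logistic_cdf R k th) s z =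
  phi th (size s) (usum th z) * \prod_(i <- s) wpos th (tnth z i).
Proof.
move=> k0; elim: s z => [|i s IH] z /=.
  by move=> _ zp; rewrite big_nil mulr1 logistic_cdfE.
move=> /andP[nis us] zp.
rewrite /partial derive1E.
pose c := \sum_(j < k | j != i) upow th (tnth z j).
have c0 : 0 <= c by apply: sumr_ge0 => j _; rewrite ltW ?upow_gt0.
pose w := \prod_(j <- s) wpos th (tnth z j).
have E x : usum th (tuple_set z i x) = upow th x + c.
  rewrite /usum (bigD1 i)//= tnth_tuple_set eqxx; congr (_ + _).
  by apply: eq_bigr => j ji; rewrite tnth_tuple_set (negbTE ji).
have -> : usum th z = upow th (tnth z i) + c by rewrite /usum (bigD1 i).
have d := derM (phi_comp_derive th (size s) (zp i) c0) (der_cst (tnth z i) w).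
pose g x := foldr (fun i G => partial i G) (@logistic_cdf R k th) s (tuple_set z i x).
suff [_] : is_derive (tnth z i) 1 g (phi th (size s).+1 (upow th (tnth z i) + c) * wpos th (tnth z i) * w +
       phi th (size s) (upow th (tnth z i) + c) * 0).
  by rewrite mulr0 addr0 big_cons mulrA; apply.
apply: near_eq_is_derive d; near=> x; rewrite /g.
have x0 : 0 < x by near: x; exact: lt_nbhsr.
rewrite IH// ?E; last by move=> j; rewrite tnth_tuple_set; case: ifP.
congr (_ * _); rewrite /w big_seq [RHS]big_seq; apply: eq_bigr => j js.
by rewrite tnth_tuple_set; case: eqP => // ji; rewrite ji (negbTE nis) in js.
Unshelve. all: by end_near. Qed.

Lemma logistic_densityE th z : (0 < k)%N ->
  logistic_density th z = phi th k (usum th z) * \prod_(i < k) wpos th (tnth z i).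
Proof.
move=> k0; rewrite /logistic_density; case: asboolP => zp.
  by rewrite /mixed_partial iterated_partial ?enum_uniq// size_enum_ord big_enum.
have [i /negP zi] : exists i, ~ (0 < tnth z i) by apply/existsNP.
by rewrite (bigD1 i)//= /wpos (negbTE zi) mul0r mulr0.
Qed.

Lemma measurable_usum th : measurable_fun setT (usum th).
Proof.
apply: measurable_sum => i.
by apply: measurableT_comp; [exact: measurable_upow|exact: measurable_tnth].
Qed.

Lemma measurable_prod_tnth (e : R -> R) : measurable_fun setT e ->
  measurable_fun setT (fun z => \prod_(i < k) e (tnth z i)).
Proof.
move=> me; apply: measurable_prod => i _.
by apply: measurableT_comp; [exact: me|exact: measurable_tnth].
Qed.

Lemma measurable_logistic_density th : (0 < k)%N ->
  measurable_fun setT (@logistic_density R k th).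
Proof.
move=> k0; rewrite (funext (fun z => logistic_densityE th z k0)).
apply: measurable_funM; last exact: measurable_prod_tnth (measurable_wpos th).
by apply: measurableT_comp; [exact: measurable_phi|exact: measurable_usum].
Qed.

Lemma logistic_density_ge0 th z : (0 < k)%N -> 0 < th < 1 -> 0 <= logistic_density th z.
Proof.
move=> k0 ht; rewrite logistic_densityE// mulr_ge0 ?phi_ge0// prodr_ge0// => i _.
by rewrite wpos_ge0//; case/andP: ht.
Qed.
End density_formula.

Section mass.
Context {R : realType}.
Implicit Types (th : R).

Lemma ge0_integral_lebesgue_tupleS n (f : n.+1.-tuple R -> \bar R) :
  measurable_fun setT f -> (forall z, 0 <= f z)%E ->
  (\int[@lebesgue_tuple R n.+1]_z f z =
   \int[lebesgue_measure]_x \int[@lebesgue_tuple R n]_z f (tcons (x, z)))%E.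
Proof.
move=> mf f0.
pose m1 : {sigma_finite_measure set (measurableTypeR R) -> \bar R} := @lebesgue_measure R.
rewrite (@ge0_integral_pushforward _ _ _ _ R _ (@measurable_tcons R n) (m1 \x @lebesgue_tuple R n)%E)//=.
rewrite fubini_tonelli1//.
by apply: measurableT_comp => //; exact: measurable_tcons.
Qed.

Lemma integral_lebesgue_tuple0 (f : 0.-tuple R -> \bar R) : measurable_fun setT f ->
  (\int[@lebesgue_tuple R 0]_z f z = f [tuple])%E.
Proof.
move=> mf; transitivity (\int[\d_([tuple] : 0.-tuple R)]_z f z)%E; first by [].
by rewrite integral_dirac// diracE in_setT mul1e.
Qed.

Lemma usum_tcons th n (x : R) (z : n.-tuple R) :
  usum th (tcons (x, z)) = upow th x + usum th z.
Proof.
rewrite /usum big_ord_recl /=; congr (_ + _).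
by apply: eq_bigr => i _; rewrite tnthS.
Qed.

Lemma prod_tcons (e : R -> R) n (x : R) (z : n.-tuple R) :
  \prod_(i < n.+1) e (tnth (tcons (x, z)) i) = e x * \prod_(i < n) e (tnth z i).
Proof.
rewrite big_ord_recl /=; congr (_ * _).
by apply: eq_bigr => i _; rewrite tnthS.
Qed.

Lemma measurable_phi_usum n th m (c : R) : measurable_fun setT (fun z : n.-tuple R =>
  (phi th m (usum th z + c) * \prod_(i < n) wpos th (tnth z i))%:E).
Proof.
apply/measurable_EFinP; apply: measurable_funM; last exact: measurable_prod_tnth (measurable_wpos th).
apply: measurableT_comp; first exact: measurable_phi.
by apply: measurable_funD => //; exact: measurable_usum.
Qed.

(** All but the outermost coordinate are integrated for a positive constant
    [c]; the outermost one may start from c = 0, where [phi] is singular and the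
    limit [l] has to be supplied. *)
Lemma integral_phi_tupleS th m n (c l : R) : 0 < th < 1 -> 0 <= c ->
  phi th m (upow th x + c) @[x --> +oo] --> (l : R) ->
  (\int[@lebesgue_tuple R n.+1]_z (phi th (m + n.+1) (usum th z + c) *
     \prod_(i < n.+1) wpos th (tnth z i))%:E = l%:E)%E.
Proof.
move=> ht; have /andP[t0 t1] := ht.
elim: n m c l => [|n IH] m c l c0 hl; (rewrite ge0_integral_lebesgue_tupleS; last 2 first).
- exact: measurable_phi_usum.
- move=> z; rewrite lee_fin mulr_ge0 ?phi_ge0// prodr_ge0// => i _; exact: wpos_ge0.
- rewrite -(integral_phi_step ht c0 hl); apply: eq_integral => x _.
  rewrite integral_lebesgue_tuple0; last first.
    apply: (measurableT_comp (f := fun z : 1.-tuple R => (phi th (m + 1) (usum th z + c) *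
       \prod_(i < 1) wpos th (tnth z i))%:E)); last exact: (measurableT_comp (@measurable_tcons R 0)).
    exact: measurable_phi_usum.
  by rewrite usum_tcons prod_tcons /usum !big_ord0 addr0 mulr1 addn1.
- exact: measurable_phi_usum.
- move=> z; rewrite lee_fin mulr_ge0 ?phi_ge0// prodr_ge0// => i _; exact: wpos_ge0.
rewrite -(integral_phi_step ht c0 hl); apply: eq_integral => x _.
have c1 : 0 < upow th x + c by rewrite ltr_wpDr ?upow_gt0.
rewrite mulrC EFinM -(IH m.+1 (upow th x + c) _ (ltW c1) (phi_cvgy (m:=m.+1) ht c1)).
rewrite -ge0_integralZl//.
- apply: eq_integral => z _; rewrite usum_tcons prod_tcons -EFinM; congr EFin.
  rewrite (addSnnS m n.+1).
  have -> : upow th x + usum th z + c = usum th z + (upow th x + c) by ring.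
  by rewrite mulrCA.
- exact: measurable_phi_usum.
- move=> z _; rewrite lee_fin mulr_ge0 ?phi_ge0// prodr_ge0// => i _; exact: wpos_ge0.
- by rewrite lee_fin wpos_ge0.
Qed.

Lemma logistic_mass k th : (0 < k)%N -> 0 < th < 1 ->
  (\int[@lebesgue_tuple R k]_z (logistic_density th z)%:E = 1)%E.
Proof.
case: k => // n _ ht.
have t0 : 0 < th by case/andP: ht.
have H := @integral_phi_tupleS th 0 n 0 1 ht (lexx _) (phi0_cvgy t0).
apply: etrans H; apply: eq_integral => z _; congr EFin.
by rewrite (logistic_densityE th z (ltn0Sn n)) (addr0 (usum th z)) (add0n n.+1).
Qed.

Lemma ge0_integral_prod_tnth n (e : R -> R) (c : R) : measurable_fun setT e ->
  (forall x, 0 <= e x) -> (\int[lebesgue_measure]_x (e x)%:E = c%:E)%E ->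
  (\int[@lebesgue_tuple R n]_z (\prod_(i < n) e (tnth z i))%:E = (c ^+ n)%:E)%E.
Proof.
move=> me e0 ec; elim: n => [|n IH].
  rewrite integral_lebesgue_tuple0 ?big_ord0//; apply/measurable_EFinP.
  exact: (@measurable_prod_tnth R 0 e me).
have p0 n' (z : n'.-tuple R) : (0 <= (\prod_(i < n') e (tnth z i))%:E)%E.
  by rewrite lee_fin prodr_ge0.
have mp n' : measurable_fun setT (fun z : n'.-tuple R => (\prod_(i < n') e (tnth z i))%:E).
  by apply/measurable_EFinP; exact: (@measurable_prod_tnth R n' e me).
rewrite ge0_integral_lebesgue_tupleS//.
transitivity (\int[lebesgue_measure]_x ((c ^+ n)%:E * (e x)%:E))%E.
  apply: eq_integral => x _; rewrite muleC -IH -ge0_integralZl//.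
    by apply: eq_integral => z _; rewrite prod_tcons EFinM.
    by apply/measurable_EFinP; exact: (@measurable_prod_tnth R n e me).
  by rewrite lee_fin.
have cn : (0 <= (c ^+ n)%:E)%E by rewrite -IH; apply: integral_ge0.
rewrite ge0_integralZl//; first by rewrite ec -EFinM -exprSr.
  exact/measurable_EFinP.
by move=> x _; rewrite lee_fin.
Qed.
End mass.

(** * Polynomially bounded smooth families *)

Section tame.
Context {R : realType} d (T : measurableType d) (a b : R) (M : T -> R).
Hypothesis M1 : forall z, 1 <= M z.
Implicit Types (g h : R -> T -> R).

Definition poly_bounded g :=
  exists C p, forall th z, a < th < b -> `|g th z| <= C * M z ^+ p.

(** [n] times differentiable in the parameter, with the function and all these
    derivatives measurable in [z] and bounded by a power of [M] uniformly in the
    parameter. The class is closed under the operations from which the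
    log-density is built, so no derivative is ever written down. *)
Fixpoint tame (n : nat) g : Prop :=
  [/\ poly_bounded g, (forall th, a < th < b -> measurable_fun setT (g th)) &
   if n is n'.+1 then
     exists2 g', (forall th z, a < th < b -> is_derive th 1 (g^~ z) (g' th z)) & tame n' g'
   else True].

Let M0 z : 0 <= M z. Proof. exact: le_trans ler01 (M1 z). Qed.
Let Mp0 z p : 0 <= M z ^+ p. Proof. exact: exprn_ge0. Qed.
Let Mp1 z p : 1 <= M z ^+ p. Proof. exact: exprn_ege1. Qed.

Lemma poly_bounded_normalize g : poly_bounded g -> exists2 C, 0 <= C &
  exists p, forall th z, a < th < b -> `|g th z| <= C * M z ^+ p.
Proof.
move=> [C [p H]]; exists `|C| => //; exists p => th z ht.
by apply: le_trans (H th z ht) _; rewrite ler_wpM2r// ler_norm.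
Qed.

Lemma tame_bounded n g : tame n g -> poly_bounded g.
Proof. by case: n => [|n] []. Qed.

Lemma tame_measurable n g th : tame n g -> a < th < b -> measurable_fun setT (g th).
Proof. by case: n => [|n] [_ m _]; exact: m. Qed.

Lemma tameW n g : tame n.+1 g -> tame n g.
Proof.
elim: n g => [|n IH] g [gb gm [g' dg tg']]; split => //.
by exists g' => //; exact: IH.
Qed.

Lemma tame_eq n g h : (forall th z, a < th < b -> g th z = h th z) -> tame n g -> tame n h.
Proof.
move=> gh tg.
have gb : poly_bounded h.
  have [C [p H]] := tame_bounded tg; exists C, p => th z ht.
  by rewrite -gh//; exact: H.
have hm th : a < th < b -> measurable_fun setT (h th).
  move=> ht; have -> : h th = g th by apply/funext => z; rewrite gh.
  exact: tame_measurable tg ht.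
case: n tg => [|n] [_ _ tg]; split => //.
have [g' dg tg'] := tg; exists g' => // th z ht.
apply: near_eq_is_derive (dg th z ht).
have : th \in `]a, b[ by rewrite in_itv.
by move=> /near_in_itvoo; apply: filterS => t; rewrite in_itv => /gh.
Qed.

Lemma tame_cst n (h : T -> R) : measurable_fun setT h ->
  (exists C p, forall z, `|h z| <= C * M z ^+ p) -> tame n (fun=> h).
Proof.
move=> mh [C [p H]]; case: n => [|n]; split => //; [by exists C, p|by exists C, p|].
exists (fun _ _ => 0); first by move=> th z _; exact: der_cst.
elim: n => [|n IH]; split => //.
- by exists 0, 0%N => th z _; rewrite normr0 mul0r.
- by exists 0, 0%N => th z _; rewrite normr0 mul0r.
- by exists (fun _ _ => 0) => // th z _; exact: der_cst.
Qed.

Lemma tame_num n (c : R) : tame n (fun _ _ => c).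
Proof.
by apply: tame_cst => //; exists `|c|, 0%N => z; rewrite expr0 mulr1.
Qed.

Lemma poly_boundedD g h : poly_bounded g -> poly_bounded h ->
  poly_bounded (fun th z => g th z + h th z).
Proof.
move=> /poly_bounded_normalize[C C0 [p H]] /poly_bounded_normalize[D D0 [q K]].
exists (C + D), (p + q)%N => th z ht.
apply: le_trans (ler_normD _ _) _; rewrite mulrDl; apply: lerD.
  apply: le_trans (H th z ht) _; rewrite ler_wpM2l//.
  by rewrite exprD ler_peMr.
apply: le_trans (K th z ht) _; rewrite ler_wpM2l//.
by rewrite exprD ler_peMl.
Qed.

Lemma poly_boundedM g h : poly_bounded g -> poly_bounded h ->
  poly_bounded (fun th z => g th z * h th z).
Proof.
move=> /poly_bounded_normalize[C C0 [p H]] /poly_bounded_normalize[D D0 [q K]].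
exists (C * D), (p + q)%N => th z ht.
by rewrite normrM exprD mulrACA ler_pM ?H ?K.
Qed.

Lemma tameD n g h : tame n g -> tame n h -> tame n (fun th z => g th z + h th z).
Proof.
elim: n g h => [|n IH] g h [gb gm tg] [hb hm th]; split => //.
- exact: poly_boundedD.
- by move=> t ht; apply: measurable_funD; [exact: gm|exact: hm].
- exact: poly_boundedD.
- by move=> t ht; apply: measurable_funD; [exact: gm|exact: hm].
have [g' dg tg'] := tg; have [h' dh th'] := th.
exists (fun t z => g' t z + h' t z); last exact: IH.
by move=> t z ht; exact: derD (dg t z ht) (dh t z ht).
Qed.

Lemma tameM n g h : tame n g -> tame n h -> tame n (fun th z => g th z * h th z).
Proof.
elim: n g h => [|n IH] g h gt_ ht_.
  move: gt_ ht_ => [gb gm tg] [hb hm th]; split => //.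
    exact: poly_boundedM.
  by move=> t ht; apply: measurable_funM; [exact: gm|exact: hm].
have gw := tameW gt_; have hw := tameW ht_.
move: gt_ ht_ => [gb gm tg] [hb hm th]; split => //.
- exact: poly_boundedM.
- by move=> t ht; apply: measurable_funM; [exact: gm|exact: hm].
have [g' dg tg'] := tg; have [h' dh th'] := th.
exists (fun t z => g' t z * h t z + g t z * h' t z).
  by move=> t z ht; exact: derM (dg t z ht) (dh t z ht).
by apply: tameD; exact: IH.
Qed.

Lemma tameN n g : tame n g -> tame n (fun th z => - g th z).
Proof.
move=> tg; apply: (tame_eq (g := fun th z => -1 * g th z)).
  by move=> th z _; rewrite mulN1r.
by apply: tameM => //; exact: tame_num.
Qed.

Lemma tame_sum n m (g : 'I_m -> R -> T -> R) : (forall i, tame n (g i)) ->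
  tame n (fun th z => \sum_(i < m) g i th z).
Proof.
elim: m g => [|m IH] g tg.
  apply: (tame_eq (g := fun _ _ => 0)); last exact: tame_num.
  by move=> th z _; rewrite big_ord0.
apply: (tame_eq (g := fun th z => \sum_(i < m) g (widen_ord (leqnSn m) i) th z + g ord_max th z)).
  by move=> th z _; rewrite big_ord_recr.
by apply: tameD => //; exact: IH.
Qed.

Lemma tameX n g j : tame n g -> tame n (fun th z => g th z ^+ j).
Proof.
move=> tg; elim: j => [|j IH].
  by apply: (tame_eq (g := fun _ _ => 1)) => //; exact: tame_num.
apply: (tame_eq (g := fun th z => g th z * g th z ^+ j)).
  by move=> th z _; rewrite exprS.
exact: tameM.
Qed.

Lemma tameV n g c : 0 < c -> (forall th z, a < th < b -> c <= g th z) ->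
  tame n g -> tame n (fun th z => (g th z)^-1).
Proof.
move=> c0 gc.
have g0 th z : a < th < b -> 0 < g th z by move=> ht; exact: lt_le_trans c0 (gc th z ht).
have Vb : poly_bounded (fun th z => (g th z)^-1).
  exists c^-1, 0%N => th z ht; rewrite expr0 mulr1 ger0_norm ?invr_ge0 ?(ltW (g0 _ _ ht))//.
  by rewrite lef_pV2 ?posrE ?g0 ?gc.
have Vm th : a < th < b -> measurable_fun setT (g th) ->
    measurable_fun setT (fun z => (g th z)^-1).
  move=> ht mg; rewrite (_ : (fun z => _) = (fun z => expR (- ln (g th z)))).
    by apply: measurableT_comp => //; apply: measurableT_comp => //; exact: measurableT_comp.
  by apply/funext => z; rewrite expRN lnK// posrE g0.
elim: n => [|n IH] tg.
  by split => // th ht; apply: Vm => //; exact: tame_measurable tg ht.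
split => //; first by move=> th ht; apply: Vm => //; exact: tame_measurable tg ht.
have tV := IH (tameW tg); have [_ _ [g' dg tg']] := tg.
exists (fun th z => - (g' th z * ((g th z)^-1 * (g th z)^-1))).
  move=> th z ht; have gn0 : g th z != 0 by rewrite gt_eqF ?g0.
  by apply: (is_derive_eq (derV gn0 (dg th z ht))); rewrite expr2 invfM.
by apply: tameN; apply: tameM => //; exact: tameM.
Qed.

(** The derivative of the exponential contains the exponential itself; so only
    a bound on the latter is needed, and the rest follows by induction. *)
Lemma tame_exp n g : tame n g -> poly_bounded (fun th z => expR (g th z)) ->
  tame n (fun th z => expR (g th z)).
Proof.
move=> tg eb.
have em th : a < th < b -> measurable_fun setT (fun z => expR (g th z)).
  by move=> ht; apply: measurableT_comp => //; exact: tame_measurable tg ht.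
elim: n tg => [|n IH] tg; split => //.
have te := IH (tameW tg); have [_ _ [g' dg tg']] := tg.
exists (fun th z => expR (g th z) * g' th z); last exact: tameM.
by move=> th z ht; exact: der_exp (dg th z ht).
Qed.

Lemma tame_ln n g c : 0 < c -> (forall th z, a < th < b -> c <= g th z) ->
  tame n g -> tame n (fun th z => ln (g th z)).
Proof.
move=> c0 gc tg.
have g0 th z : a < th < b -> 0 < g th z by move=> ht; exact: lt_le_trans c0 (gc th z ht).
have lb : poly_bounded (fun th z => ln (g th z)).
  have [C C0 [p H]] := poly_bounded_normalize (tame_bounded tg).
  exists (C + `|ln c|), p => th z ht.
  have h1 : ln (g th z) <= C * M z ^+ p.
    apply: le_trans (H th z ht); rewrite (gtr0_norm (g0 _ _ ht)).
    by have := expR_ge1Dx (ln (g th z)); rewrite lnK ?posrE ?g0//; lra.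
  have h2 : ln c <= ln (g th z) by rewrite ler_ln ?posrE ?g0 ?gc.
  have h3 : `|ln c| <= `|ln c| * M z ^+ p by rewrite ler_peMr.
  have h4 : - `|ln c| <= ln c by rewrite lerNl ler_normr lexx orbT.
  have h5 : 0 <= C * M z ^+ p by rewrite mulr_ge0.
  have h6 := normr_ge0 (ln c).
  by rewrite mulrDl ler_norml; apply/andP; split; lra.
have lm th : a < th < b -> measurable_fun setT (fun z => ln (g th z)).
  by move=> ht; apply: measurableT_comp => //; exact: tame_measurable tg ht.
case: n tg => [|n] tg; split => //.
have [_ _ [g' dg tg']] := tg.
exists (fun th z => (g th z)^-1 * g' th z).
  by move=> th z ht; exact: der_ln (g0 _ _ ht) (dg th z ht).
by apply: tameM => //; apply: tameV gc (tameW tg).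
Qed.

Lemma tame_id n : 0 < a -> b < 1 -> tame n (fun th _ => th).
Proof.
move=> a0 b1.
have ib : poly_bounded (fun th _ => th).
  exists 1, 0%N => th z /andP[at_ tb]; rewrite expr0 mulr1 ger0_norm; lra.
case: n => [|n]; split => //.
by exists (fun _ _ => 1); [move=> th z _; exact: der_id|exact: tame_num].
Qed.

Lemma tame_derivative n g : tame n.+1 g -> exists2 g',
  (forall th z, a < th < b -> is_derive th 1 (g^~ z) (g' th z)) & tame n g'.
Proof. by move=> [_ _]. Qed.

End tame.

(** * The logistic log-density *)

Section log_density.
Context {R : realType} (k : nat) (a b : R).
Hypotheses (k0 : (0 < k)%N) (a0 : 0 < a) (b1 : b < 1).
Implicit Types (th : R) (z : k.-tuple R).

(** Powers of this function bound the log-density and its derivatives. The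
    exponential is needed for small coordinates, where V is of the order of
    1/z_i; on large coordinates only the logarithm matters. *)
Definition envelope z : R :=
  1 + \sum_(i < k) (`|ln (tnth z i)| + expR (- ln (tnth z i))).

Lemma envelope_ge z i : `|ln (tnth z i)| + expR (- ln (tnth z i)) <= envelope z - 1.
Proof.
rewrite /envelope [leRHS]addrC addKr (bigD1 i)//= lerDl sumr_ge0//.
Qed.

Lemma envelope_ge1 z : 1 <= envelope z.
Proof. by rewrite lerDl sumr_ge0// => j _; rewrite addr_ge0 ?expR_ge0. Qed.

Lemma envelope_norm z i : `|ln (tnth z i)| <= envelope z.
Proof. have := envelope_ge z i; have := expR_gt0 (- ln (tnth z i)); lra. Qed.

Lemma envelope_exp z i : expR (- ln (tnth z i)) <= envelope z.
Proof. have := envelope_ge z i; have := normr_ge0 (ln (tnth z i)); lra. Qed.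

Lemma measurable_ln_tnth i : measurable_fun setT (fun z => ln (tnth z i)).
Proof. by apply: measurableT_comp => //; exact: measurable_tnth. Qed.

Lemma measurable_envelope : measurable_fun setT envelope.
Proof.
apply: measurable_funD => //; apply: measurable_sum => i; apply: measurable_funD.
  by apply: measurableT_comp => //; exact: measurable_ln_tnth.
by do 2 apply: measurableT_comp => //; exact: measurable_ln_tnth.
Qed.

Local Notation tame := (tame a b envelope).

Let th0 th : a < th < b -> 0 < th. Proof. by move=> /andP[+ _]; exact: lt_trans. Qed.
Let th01 th : a < th < b -> 0 < th < 1.
Proof. by move=> /andP[at_ tb]; rewrite (lt_trans a0 at_) (lt_trans tb b1). Qed.

Lemma tame_coord n i : tame n (fun _ z => ln (tnth z i)).
Proof.
apply: tame_cst.
  exact: measurable_ln_tnth.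
by exists 1, 1%N => z; rewrite mul1r expr1 envelope_norm.
Qed.

Lemma tame_inv n : tame n (fun th _ => th^-1).
Proof.
apply: (tameV envelope_ge1 a0); last exact: tame_id.
by move=> th z /andP[/ltW].
Qed.

Definition lsum th z : R := ln (usum th z).

Lemma usum_ge th z i : upow th (tnth z i) <= usum th z.
Proof. by rewrite /usum (bigD1 i)//= lerDl sumr_ge0// => j _; rewrite ltW ?upow_gt0. Qed.

Lemma lsum_ge th z i : - (th^-1 * ln (tnth z i)) <= lsum th z.
Proof.
rewrite -[leLHS]expRK /lsum ler_ln ?posrE ?usum_gt0 ?expR_gt0//; exact: usum_ge.
Qed.

(** A sum is at most the number of its terms times the largest one. *)
Lemma lsum_le th z y : 0 < th -> (forall i, - ln (tnth z i) <= y) ->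
  lsum th z <= ln k%:R + th^-1 * y.
Proof.
move=> t0 zy; have kp : 0 < k%:R :> R by rewrite ltr0n.
rewrite -[X in _ + X]expRK -lnM ?posrE ?expR_gt0// /lsum ler_ln ?posrE ?usum_gt0 ?mulr_gt0 ?expR_gt0//.
apply: (@le_trans _ _ (\sum_(i < k) expR (th^-1 * y))); last first.
  by rewrite sumr_const card_ord mulr_natl.
apply: ler_sum => i _; rewrite ler_expR -mulrN ler_wpM2l ?zy// invr_ge0 ltW //.
Qed.

Lemma lnk_bound : 0 <= ln (k%:R : R) <= k%:R.
Proof.
have kp : 0 < k%:R :> R by rewrite ltr0n.
by rewrite ln_ge0 ?ler1n//=; have := expR_ge1Dx (ln (k%:R : R)); rewrite lnK ?posrE//; lra.
Qed.

Lemma lsum_bounded : poly_bounded a b envelope lsum.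
Proof.
exists (k%:R + a^-1), 1%N => th z ht; rewrite expr1.
have t0 := th0 ht; have V0 : 0 < a^-1 by rewrite invr_gt0.
have tV : th^-1 <= a^-1 by rewrite lef_pV2 ?posrE//; case/andP: ht => /ltW.
have tV0 : 0 < th^-1 by rewrite invr_gt0.
have /andP[l0 lk] := lnk_bound; have E1 := envelope_ge1 z.
have A : lsum th z <= ln k%:R + th^-1 * envelope z.
  apply: lsum_le => // i; apply: le_trans (envelope_norm z i).
  by rewrite ler_normr lexx orbT.
have B : - (th^-1 * envelope z) <= lsum th z.
  apply: le_trans (lsum_ge th z (Ordinal k0)); rewrite lerN2 ler_wpM2l ?(ltW tV0)//.
  by apply: le_trans (envelope_norm z _); exact: ler_norm.
have C : th^-1 * envelope z <= a^-1 * envelope z by rewrite ler_wpM2r// (le_trans ler01).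
have D : k%:R <= k%:R * envelope z by rewrite ler_peMr.
by rewrite ler_norml mulrDl; apply/andP; split; lra.
Qed.

(** The weights upow z_i / usum, in a form whose boundedness by 1 is
    visible. *)
Definition softmax i th z : R := expR (- (th^-1 * ln (tnth z i)) - lsum th z).

Lemma softmax_bounded i : poly_bounded a b envelope (softmax i).
Proof.
exists 1, 0%N => th z _; rewrite expr0 mulr1 ger0_norm ?expR_ge0// -[leRHS]expR0 ler_expR.
by rewrite subr_le0 lsum_ge.
Qed.

Lemma measurable_lsum th : measurable_fun setT (lsum th).
Proof. by apply: measurableT_comp => //; exact: measurable_usum. Qed.

Lemma lsum_derive th z : 0 < th -> is_derive th 1 (lsum^~ z)
  (\sum_(i < k) softmax i th z * (ln (tnth z i) * (th^-1 * th^-1))).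
Proof.
move=> t0; have tn0 : th != 0 by rewrite gt_eqF.
have S0 : 0 < usum th z by exact: usum_gt0.
apply: (is_derive_eq (der_ln S0 (der_sum (fun i => der_exp (derN (derM (derV tn0 (der_id th)) (der_cst th (ln (tnth z i))))))))).
rewrite mulr_sumr; apply: eq_bigr => i _.
rewrite -/(usum th z) /softmax expRD [expR (- lsum th z)]expRN /lsum lnK ?posrE// /upow; field.
by rewrite tn0 gt_eqF.
Qed.

(** The derivative of [lsum] is a combination of the weights [softmax], which
    are bounded exponentials of [lsum]: induction on the order closes the
    loop. *)
Lemma tame_lsum n : tame n lsum.
Proof.
elim: n => [|n IH]; split => //.
- exact: lsum_bounded.
- by move=> th _; exact: measurable_lsum.
- exact: lsum_bounded.
- by move=> th _; exact: measurable_lsum.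
eexists; first by move=> th z /th0; exact: lsum_derive.
apply: (tame_sum envelope_ge1) => i; apply: (tameM envelope_ge1).
  apply: (tame_exp envelope_ge1 _ (softmax_bounded i)); apply: (tameD envelope_ge1).
    apply: (tameN envelope_ge1); apply: (tameM envelope_ge1); [exact: tame_inv|exact: tame_coord].
  exact: (tameN envelope_ge1).
apply: (tameM envelope_ge1); first exact: tame_coord.
by apply: (tameM envelope_ge1); exact: tame_inv.
Qed.

(** The exponent function V as an exponential of [lsum]. *)
Definition vexp th z : R := expR (th * lsum th z).

(** V is at most k times the largest 1/z_i. *)
Lemma vexp_le th z : 0 < th < 1 -> vexp th z <= k%:R * envelope z.
Proof.
move=> /andP[t0 t1]; have E0 : 0 < envelope z by exact: lt_le_trans (envelope_ge1 z).
have kp : 0 < k%:R :> R by rewrite ltr0n.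
rewrite -[leRHS]lnK ?posrE ?mulr_gt0// ler_expR lnM ?posrE//.
have H : lsum th z <= ln k%:R + th^-1 * ln (envelope z).
  apply: lsum_le => // i; rewrite -[leLHS]expRK ler_ln ?posrE ?expR_gt0//; exact: envelope_exp.
have /andP[l0 _] := lnk_bound.
have H2 : th * lsum th z <= th * (ln k%:R + th^-1 * ln (envelope z)) by rewrite ler_wpM2l// ltW.
have H3 : th * ln k%:R <= ln k%:R :> R by apply: ler_piMl => //; exact: ltW.
have H4 : th * (th^-1 * ln (envelope z)) = ln (envelope z) by rewrite mulVKf ?gt_eqF.
lra.
Qed.

Lemma tame_vexp n : tame n vexp.
Proof.
apply: (tame_exp envelope_ge1).
  by apply: (tameM envelope_ge1); [exact: tame_id|exact: tame_lsum].
exists k%:R, 1%N => th z /th01 ht; rewrite expr1 ger0_norm ?expR_ge0//; exact: vexp_le.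
Qed.

Lemma tame_qcoef n m j : tame n (fun th _ => qcoef th m j).
Proof.
elim: m j => [|m IH] j; first exact: tame_num.
apply: (tameD envelope_ge1).
  apply: (tameM envelope_ge1) => //; apply: (tameD envelope_ge1).
    exact: tame_num.
  apply: (tameN envelope_ge1); apply: (tameM envelope_ge1); first exact: tame_id.
  exact: tame_num.
apply: (tameM envelope_ge1); first exact: tame_id.
by case: j => [|j] //; exact: tame_num.
Qed.

(** The density on the orthant is a product of exponentials with this polynomial
    in V; its constant coefficient is bounded below by [qcoefS1_ge]. *)
Definition vpoly th z : R := \sum_(j < k) qcoef th k j.+1 * vexp th z ^+ j.

Lemma vpoly_ge th z : a < th < b -> a * (1 - b) ^+ k.-1 <= vpoly th z.
Proof.
move=> ht; rewrite /vpoly (bigD1 (Ordinal k0))//= expr0 mulr1.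
have := @qcoefS1_ge R th a b k.-1 a0 ht b1; rewrite prednK// => H.
apply: le_trans H _; rewrite lerDl sumr_ge0// => j _.
by rewrite mulr_ge0 ?exprn_ge0 ?expR_ge0// qcoef_ge0 ?th01.
Qed.

Lemma tame_vpoly n : tame n vpoly.
Proof.
apply: (tame_sum envelope_ge1) => i; apply: (tameM envelope_ge1); first exact: tame_qcoef.
by apply: (tameX envelope_ge1); exact: tame_vexp.
Qed.

Definition indic_orthant z : R := if `[< positive_orthant z >] then 1 else 0.

Lemma phi_vpoly th z :
  phi th k (usum th z) =
  expR (th * lsum th z - k%:R * lsum th z - vexp th z) * vpoly th z.
Proof.
rewrite /phi big_ord_recl/= -[in qcoef th k 0](prednK k0) qcoefS0 mul0r add0r.
rewrite /vpoly mulr_sumr; apply: eq_bigr => j _.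
rewrite mulrCA; congr (_ * _).
rewrite /pterm /vexp -/(lsum th z) -expRM_natl -expRD; congr expR.
rewrite /bump/= -mulr_natl natrD; ring.
Qed.

Definition log_density th z : R := indic_orthant z *
  (th * lsum th z - k%:R * lsum th z - vexp th z + ln (vpoly th z)
   - \sum_(i < k) (ln th + (1 + th^-1) * ln (tnth z i))).

Lemma logistic_density_exp th z : a < th < b -> logistic_density th z =
  indic_orthant z * expR (log_density th z).
Proof.
move=> ht; rewrite /log_density /indic_orthant; case: asboolP => zp; last first.
  by rewrite mul0r /logistic_density asboolF.
rewrite !mul1r logistic_densityE// phi_vpoly.
have q0 : 0 < vpoly th z.
  by apply: lt_le_trans (vpoly_ge z ht); rewrite mulr_gt0// exprn_gt0// subr_gt0.
rewrite [in RHS]expRD [in RHS]expRD [X in _ = _ * X * _](lnK q0); congr (_ * _).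
rewrite -sumrN expR_sum; apply: eq_bigr => i _.
by rewrite /wpos zp opprD expRD [expR (- ln th)]expRN lnK// posrE th0.
Qed.

Lemma ln_logistic_density th z : a < th < b -> ln (logistic_density th z) = log_density th z.
Proof.
move=> ht; rewrite logistic_density_exp//.
rewrite [in LHS]/indic_orthant; case: ifPn => zp; first by rewrite mul1r expRK.
by rewrite mul0r ln0// /log_density /indic_orthant (negbTE zp) mul0r.
Qed.

Lemma measurable_positive_orthant : measurable (@positive_orthant R k).
Proof.
rewrite (_ : @positive_orthant R k = \bigcap_(i in [set: 'I_k]) ((fun z => tnth z i) @^-1` `]0, +oo[%classic)).
  apply: fin_bigcap_measurable => // i _.
  by rewrite -[X in measurable X]setTI; exact: measurable_tnth.
apply/seteqP; split => z /= H i => [_|]; first by rewrite /= in_itv/= H.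
by have := H i I; rewrite /= in_itv/= andbT.
Qed.

Lemma measurable_indic_orthant : measurable_fun setT indic_orthant.
Proof.
have -> : indic_orthant = \1_(@positive_orthant R k).
  apply/funext => z; rewrite /indic_orthant indicE.
  case: asboolP => h; first by rewrite mem_set.
  by rewrite memNset.
by apply: measurable_indic; exact: measurable_positive_orthant.
Qed.

Lemma tame_log_density n : tame n log_density.
Proof.
apply: (tameM envelope_ge1).
  apply: tame_cst; first exact: measurable_indic_orthant.
  exists 1, 0%N => z; rewrite expr0 mulr1 /indic_orthant.
  by case: ifP => _; rewrite ?normr1// normr0.
have tN := tameN envelope_ge1; have tD := tameD envelope_ge1; have tM := tameM envelope_ge1.
apply: (tD); last first.
  apply: (tN); apply: (tame_sum envelope_ge1) => i; apply: (tD).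
    by apply: (tame_ln envelope_ge1 a0); [move=> th z /andP[/ltW]|exact: tame_id].
  apply: (tM); last exact: tame_coord.
  by apply: (tD); [exact: tame_num|exact: tame_inv].
apply: (tD); last first.
  apply: (tame_ln envelope_ge1 _ vpoly_ge (tame_vpoly n)).
  by rewrite mulr_gt0// exprn_gt0// subr_gt0.
apply: (tD); last by apply: (tN); exact: tame_vexp.
apply: (tD).
  by apply: (tM); [exact: tame_id|exact: tame_lsum].
apply: (tN); apply: (tM); [exact: tame_num|exact: tame_lsum].
Qed.
End log_density.

(** * An integrable bound for the density *)

Section domination.
Context {R : realType}.
Implicit Types (c v x : R).

(** From v / D <= exp (v / D), raised to the power n, with D = (n + 1) / c. *)
Lemma pow_exp_bound n c : 0 < c ->
  exists2 C, 0 <= C & forall v, 0 <= v -> v ^+ n * expR (- (c * v)) <= C.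
Proof.
move=> c0; pose D : R := n.+1%:R / c.
have D0 : 0 < D by rewrite divr_gt0.
exists (D ^+ n) => [|v v0]; first by rewrite exprn_ge0 ?ltW.
have h : v <= D * expR (v / D).
  have := expR_ge1Dx (v / D); rewrite -ler_pdivrMl// mulrC; lra.
have h2 : v ^+ n <= D ^+ n * expR (n%:R * (v / D)).
  by rewrite expRM_natl -exprMn lerXn2r ?nnegrE// mulr_ge0 ?expR_ge0 ?(ltW D0).
apply: (le_trans (ler_wpM2r (expR_ge0 _) h2)).
rewrite -mulrA -expRD ler_piMr ?exprn_ge0 ?(ltW D0)// -[leRHS]expR0 ler_expR.
rewrite subr_le0 /D invf_div !mulrA ler_pdivrMr// -natr1.
have : 0 <= c * v by rewrite mulr_ge0// ltW.
lra.
Qed.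

(** Integrable, but only just when [c] is small: at infinity the logistic density
    is bounded in each coordinate by the power 1 + 1/k of 1/z_i. *)
Definition heavy_tail c x : R := if 0 < x then expR (- ((1 + c) * ln (1 + x))) else 0.

Lemma heavy_tail_ge0 c x : 0 <= heavy_tail c x.
Proof. by rewrite /heavy_tail; case: ifP => // _; exact: expR_ge0. Qed.

Lemma measurable_heavy_tail c : measurable_fun setT (heavy_tail c).
Proof.
apply: measurable_fun_ifT => //; first exact: measurable_fun_ltr.
apply: measurableT_comp => //; apply: measurableT_comp => //.
apply: measurable_funM => //; apply: measurableT_comp; first exact: measurable_ln.
exact: measurable_funD.
Qed.

Lemma heavy_tail_derive c x : 0 < c -> -1 < x ->
  is_derive x 1 (fun y => - (c^-1 * expR (- (c * ln (1 + y))))) (expR (- ((1 + c) * ln (1 + x)))).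
Proof.
move=> c0 x0; have p : 0 < 1 + x by lra.
have d1 := der_ln p (derD (der_cst x 1) (der_id x)).
apply: (is_derive_eq (derN (derM (der_cst x c^-1) (der_exp (derN (derM (der_cst x c) d1)))))).
rewrite [in RHS]mulrDl [in RHS]mul1r [in RHS]opprD [in RHS]expRD [expR (- ln (1 + x))]expRN (lnK p); field.
by rewrite !gt_eqF.
Qed.

Lemma integral_heavy_tail c : 0 < c ->
  (\int[lebesgue_measure]_x (heavy_tail c x)%:E = (c^-1)%:E)%E.
Proof.
move=> c0.
pose F x := - (c^-1 * expR (- (c * ln (1 + x)))).
have d0 : is_derive (0 : R) 1 F (expR (- ((1 + c) * ln (1 + 0)))) by apply: heavy_tail_derive => //; lra.
have E : (\int[lebesgue_measure]_(x in [set x | (0 < x)%R])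
    (expR (- ((1 + c) * ln (1 + x))))%:E = (0 - F 0)%:E)%E.
  apply: (@FTC_positive_axis R (fun x => expR (- ((1 + c) * ln (1 + x)))) F 0 (F 0)).
  - by move=> x x0; exact: expR_ge0.
  - move=> x x0; have p : 0 < 1 + x by lra.
    have d1 := der_ln p (derD (der_cst x 1) (der_id x)).
    exact: (is_derive_continuous (der_exp (derN (derM (der_cst x (1 + c)) d1)))).
  - by move=> x x0; apply: heavy_tail_derive => //; lra.
  - suff : - (c^-1 * expR (- (c * ln (1 + x)))) @[x --> +oo] --> - (c^-1 * (0 : R)) by rewrite mulr0 oppr0.
    apply: cvgN; apply: cvgM; first exact: cvg_cst.
    have cV : 0 < c^-1 by rewrite invr_gt0.
    apply: (@squeeze_cvgr _ _ _ _ (fun=> 0) (upow c^-1)); last 2 first.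
    - exact: cvg_cst.
    - exact: upow_cvg0.
    near=> x; have x0 : 0 < x by near: x; exact: nbhs_pinfty_gt.
    rewrite expR_ge0 /upow invrK ler_expR lerN2 ler_wpM2l ?(ltW c0)// ler_ln ?posrE//; lra.
  - by apply: cvg_at_right_filter; exact: (is_derive_continuous d0).
rewrite /F addr0 ln1 mulr0 oppr0 expR0 mulr1 opprK add0r in E.
rewrite -E [RHS]integral_mkcond/=.
apply: eq_integral => x _; rewrite patchE /heavy_tail; have [x0|x0] := boolP (0 < x); first by rewrite mem_set.
by rewrite memNset//=; exact/negP.
Unshelve. all: by end_near. Qed.

Lemma one_plus_sum_le_prod n (u : 'I_n -> R) : (forall i, 0 <= u i) ->
  1 + \sum_i u i <= \prod_i (1 + u i).
Proof.
move=> u0; suff /andP[] : (0 <= \sum_i u i) && (1 + \sum_i u i <= \prod_i (1 + u i)) by [].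
apply: (big_rec2 (fun s p => (0 <= s) && (1 + s <= p))); first by rewrite lexx addr0/=.
move=> i s p _ /andP[s0 sp]; rewrite addr_ge0//=.
apply: (@le_trans _ _ ((1 + u i) * (1 + s))); last by rewrite ler_wpM2l// addr_ge0.
have : 0 <= u i * s by rewrite mulr_ge0.
lra.
Qed.

(** With w = exp (- x), the sum x + w is at least 1 and grows linearly at both
    ends in |x| + w, so it absorbs powers of the left-hand side in exponentials. *)
Lemma exp_plus_id_ge x : 1 + `|x| + expR (- x) <= 4 * (x + expR (- x)).
Proof.
have h1 := expR_ge1Dx (- x); have [x0|x0] := lerP 0 x; first by rewrite ger0_norm//; lra.
rewrite ltr0_norm//.
have h2 : (1 + (- x) / 2) ^+ 2 <= expR (- x).
  have -> : expR (- x) = expR (- x / 2) ^+ 2 by rewrite -expRM_natl; congr expR; field.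
  by rewrite lerXn2r ?nnegrE ?expR_ge0 ?expR_ge1Dx//; lra.
have : 0 <= (1 + x / 2) ^+ 2 by exact: sqr_ge0.
move: h2; rewrite !expr2; lra.
Qed.

(** One coordinate of the domination, in the logarithmic variable x. Half of
    the decay exp (- 2 c x) pays for the powers on the right end, and
    exp (- c exp (- x)) pays for them on the left end; the other half makes the
    tail integrable. *)
Lemma coordinate_bound p c : 0 < c <= 1 -> exists2 C, 0 <= C & forall x : R,
  (1 + `|x| + expR (- x)) ^+ p * expR (- ((1 + 2 * c) * x + c * expR (- x))) <=
  C * heavy_tail c (expR x).
Proof.
move=> /andP[c0 c1]; have [C C0 HC] := pow_exp_bound p.+2 c0.
exists (4 ^+ p.+2 * C) => [|x]; first by rewrite mulr_ge0 ?exprn_ge0.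
rewrite /heavy_tail expR_gt0.
set w := expR (- x); have w0 : 0 < w by exact: expR_gt0.
set m := 1 + `|x| + w; have m1 : 1 <= m by rewrite /m; have := normr_ge0 x; lra.
pose v := x + w.
have v0 : 0 <= v by have := expR_ge1Dx (- x); rewrite -/w /v; lra.
have mv : m <= 4 * v by exact: exp_plus_id_ge.
(* Factoring out exp x turns the tail function into powers of exp x and of
   1 + w, and the latter are at most powers of m. *)
have -> : 1 + expR x = expR x * (1 + w) by rewrite mulrDr mulr1 /w -expRD subrr expR0 addrC.
have w1 : 0 < 1 + w by lra.
rewrite lnM ?posrE ?expR_gt0// expRK [(1 + c) * (_ + _)]mulrDr [- (_ + (1 + c) * _)]opprD [expR (_ - (1 + c) * _)]expRD.
set A := expR (- ((1 + c) * ln (1 + w))).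
have hA : (m ^+ 2)^-1 <= A.
  have m0 : 0 < m by lra.
  rewrite -[leLHS]lnK ?posrE ?invr_gt0 ?exprn_gt0// lnV ?posrE ?exprn_gt0// ler_expR lerN2.
  have lm : ln (1 + w) <= ln m by rewrite ler_ln ?posrE//; rewrite /m; have := normr_ge0 x; lra.
  have lw : 0 <= ln (1 + w) by rewrite ln_ge0//; lra.
  rewrite lnXn// -mulr_natl; apply: ler_pM => //; lra.
have m2 : 0 < m ^+ 2 by rewrite exprn_gt0//; lra.
have {}hA : 1 <= m ^+ 2 * A by rewrite -ler_pdivrMl// mulr1.
rewrite mulrCA mulrA.
rewrite (_ : - ((1 + 2 * c) * x + c * w) = - ((1 + c) * x) - c * v); last by rewrite /v; ring.
rewrite expRD.
set e1 := expR (- ((1 + c) * x)).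
rewrite (_ : m ^+ p * (e1 * _) = e1 * (m ^+ p * expR (- (c * v)))); last by ring.
rewrite (_ : e1 * _ * A = e1 * (4 ^+ p.+2 * C * A)); last by ring.
apply: ler_wpM2l; first exact: expR_ge0.
apply: (@le_trans _ _ ((m ^+ p * expR (- (c * v))) * (m ^+ 2 * A))).
  by rewrite ler_peMr// mulr_ge0 ?expR_ge0// exprn_ge0//; lra.
rewrite (_ : _ * (_ * A) = (m ^+ p.+2 * expR (- (c * v))) * A); last first.
  by rewrite -[p.+2]addn2 exprD; ring.
apply: ler_wpM2r; first exact: expR_ge0.
apply: (@le_trans _ _ ((4 * v) ^+ p.+2 * expR (- (c * v)))).
  by rewrite ler_wpM2r ?expR_ge0// lerXn2r ?nnegrE//; lra.
by rewrite exprMn -mulrA ler_wpM2l ?exprn_ge0// HC.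
Qed.

Lemma qcoef_le (th : R) m j : 0 < th < 1 -> qcoef th m j <= m`!%:R.
Proof.
move=> ht; have /andP[t0 t1] := ht; elim: m j => [|m IH] j; first by rewrite /= fact0; case: (j == 0%N).
rewrite factS mulSn addnC natrD natrM /=; apply: lerD.
  apply: (@le_trans _ _ (m%:R * qcoef th m j)); last by rewrite ler_wpM2l.
  by rewrite ler_wpM2r ?qcoef_ge0// lerBlDr lerDl mulr_ge0// ltW.
apply: (@le_trans _ _ (1 * m`!%:R)); last by rewrite mul1r.
by apply: ler_pM; [exact: ltW| |exact: ltW|]; case: j => [|j]//; rewrite ?qcoef_ge0 ?ler0n.
Qed.
End domination.

Section logistic_domination.
Context {R : realType} (k : nat) (a b : R).
Hypotheses (k0 : (0 < k)%N) (a0 : 0 < a) (b1 : b < 1).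
Implicit Types (th : R) (z : k.-tuple R).

(** Half of the excess 1/k of the decay exponent 1 + 1/k of the density in each
    coordinate, see [lsum_average]; the other half absorbs powers of
    [envelope]. *)
Definition tail_rate : R := (2 * k%:R)^-1.

Definition dominating z : R := \prod_(i < k) heavy_tail tail_rate (tnth z i).

Let kp : 0 < k%:R :> R. Proof. by rewrite ltr0n. Qed.

Lemma tail_rate_itv : 0 < tail_rate <= 1.
Proof.
rewrite invr_gt0 mulr_gt0//= invf_le1 ?mulr_gt0//.
have : 1 <= k%:R :> R by rewrite ler1n.
lra.
Qed.

Lemma dominating_ge0 z : 0 <= dominating z.
Proof. by apply: prodr_ge0 => i _; exact: heavy_tail_ge0. Qed.

Lemma measurable_dominating : measurable_fun setT dominating.
Proof. exact: measurable_prod_tnth (measurable_heavy_tail _). Qed.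

Lemma intR_dominating : intR (@lebesgue_tuple R k) dominating.
Proof.
apply: (@ge0_intR _ _ _ _ _ (tail_rate^-1 ^+ k)).
- exact: measurable_dominating.
- exact: dominating_ge0.
have /andP[c0 _] := tail_rate_itv.
rewrite (@ge0_integral_prod_tnth R k _ _ (measurable_heavy_tail _) (@heavy_tail_ge0 R _) (integral_heavy_tail c0)).
exact: lexx.
Qed.

(** The lower bounds [lsum_ge] for the k coordinates are averaged with equal
    weights 1/k, so that every coordinate receives a share of the decay of
    S^(theta - k). *)
Lemma lsum_average th z : 0 < th < 1 ->
  (th - k%:R) * lsum th z <= \sum_(i < k) (th^-1 - k%:R^-1) * ln (tnth z i).
Proof.
move=> /andP[t0 t1].
have -> : (th - k%:R) * lsum th z = \sum_(i < k) ((k%:R - th) / k%:R) * (- lsum th z).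
  by rewrite sumr_const card_ord -mulr_natl; field; rewrite gt_eqF.
apply: ler_sum => i _.
have -> : (th^-1 - k%:R^-1) * ln (tnth z i) = ((k%:R - th) / k%:R) * (th^-1 * ln (tnth z i)).
  by field; rewrite !gt_eqF.
apply: ler_wpM2l; last by rewrite lerNl lsum_ge.
have : 1 <= k%:R :> R by rewrite ler1n.
by move=> k1; apply: divr_ge0; [lra|exact: ltW].
Qed.

Lemma vexp_ge th z i : 0 < th -> expR (- ln (tnth z i)) <= vexp th z.
Proof.
move=> t0; rewrite ler_expR; have := lsum_ge k0 th z i.
rewrite -(ler_pM2l t0) mulrN mulVKf ?gt_eqF//.
Qed.

(** V is at least each 1/z_i, hence at least their average; only half of V is
    spent here, the other half bounds [vpoly]. *)
Lemma vexp_average th z : 0 < th ->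
  \sum_(i < k) tail_rate * expR (- ln (tnth z i)) <= vexp th z / 2.
Proof.
move=> t0; apply: (@le_trans _ _ (\sum_(i < k) tail_rate * vexp th z)).
  apply: ler_sum => i _; rewrite ler_wpM2l ?vexp_ge//.
  by have /andP[/ltW] := tail_rate_itv.
rewrite sumr_const card_ord -mulr_natl /tail_rate le_eqVlt; apply/orP; left; apply/eqP.
by field; rewrite gt_eqF.
Qed.

Lemma vpoly_exp_le : exists2 C, 0 <= C & forall th z, 0 < th < 1 ->
  vpoly th z * expR (- vexp th z) <= C * expR (- (vexp th z / 2)).
Proof.
have h : 0 < (2^-1 : R) by [].
have [C C0 HC] := pow_exp_bound k h.
exists (k%:R * k`!%:R * (C * expR 2^-1)) => [|th z ht].
  by rewrite !mulr_ge0 ?ler0n ?expR_ge0.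
set V := vexp th z; have V0 : 0 <= V by exact: expR_ge0.
have hq : vpoly th z <= k%:R * k`!%:R * (1 + V) ^+ k.
  rewrite -mulrA mulr_natl -[X in _ *+ X]card_ord -sumr_const; apply: ler_sum => j _.
  apply: ler_pM; rewrite ?qcoef_ge0 ?qcoef_le ?exprn_ge0//.
  apply: (@le_trans _ _ ((1 + V) ^+ j)).
    by rewrite lerXn2r ?nnegrE ?addr_ge0//; rewrite -/V; lra.
  by rewrite ler_weXn2l ?(ltnW (ltn_ord j))//; lra.
apply: (le_trans (ler_wpM2r (expR_ge0 _) hq)).
have := HC (1 + V); rewrite addr_ge0// => /(_ isT) H.
rewrite -!mulrA; do 2 (apply: ler_wpM2l; first exact: ler0n).
have -> : expR (- V) = expR (- (2^-1 * (1 + V))) * (expR 2^-1 * expR (- (V / 2))).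
  by rewrite -!expRD; congr expR; field.
by rewrite [leLHS]mulrA; apply: ler_wpM2r => //; rewrite mulr_ge0 ?expR_ge0.
Qed.

(** In the logarithmic coordinates the density is at most a constant times a
    product of functions exp (- (1 + 1/k) x_i - exp (- x_i) / (2 k)), and the
    envelope is at most a product too; the claim is then [coordinate_bound] in
    each coordinate. *)
Lemma density_domination p : exists2 C, 0 <= C & forall th z, a < th < b ->
  envelope z ^+ p * logistic_density th z <= C * dominating z.
Proof.
have [Cq Cq0 Hq] := vpoly_exp_le.
have [C C0 HC] := coordinate_bound p tail_rate_itv.
exists (Cq * (a^-1 * C) ^+ k) => [|th z ht].
  by rewrite mulr_ge0 ?exprn_ge0// mulr_ge0// invr_ge0 ltW.
have ht1 : 0 < th < 1.
  by case/andP: ht => at_ tb; rewrite (lt_trans a0 at_) (lt_trans tb b1).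
have t0 : 0 < th by case/andP: ht1.
have [zp|zn] := pselect (positive_orthant z); last first.
  rewrite /logistic_density asboolF// mulr0; apply: mulr_ge0; last exact: dominating_ge0.
  by rewrite mulr_ge0 ?exprn_ge0// mulr_ge0// invr_ge0 ltW.
pose x i := ln (tnth z i); pose w i := expR (- x i).
pose V := vexp th z.
have f1 : logistic_density th z <=
    Cq * \prod_(i < k) (a^-1 * expR (- ((1 + 2 * tail_rate) * x i + tail_rate * w i))).
  rewrite logistic_densityE// phi_vpoly//.
  rewrite (_ : th * lsum th z - k%:R * lsum th z - vexp th z = (th - k%:R) * lsum th z - V); last first.
    by rewrite /V; ring.
  rewrite expRD -[X in X * \prod_(i < k) _]mulrA [expR (- V) * _]mulrC.
  (* The three factors: the power of S, the polynomial with exp (- V), and the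
     Jacobian. *)
  have h1 : expR ((th - k%:R) * lsum th z) <= \prod_(i < k) expR ((th^-1 - k%:R^-1) * x i).
    by rewrite -expR_sum ler_expR; exact: lsum_average.
  have h2 : vpoly th z * expR (- V) <= Cq * \prod_(i < k) expR (- (tail_rate * w i)).
    apply: (le_trans (Hq th z ht1)); rewrite ler_wpM2l// -expR_sum ler_expR sumrN lerN2.
    exact: vexp_average.
  have h3 : \prod_(i < k) wpos th (tnth z i) <= \prod_(i < k) (a^-1 * expR (- ((1 + th^-1) * x i))).
    apply: ler_prod => i _; rewrite wpos_ge0//= /wpos zp ler_wpM2r ?expR_ge0//.
    by rewrite lef_pV2 ?posrE//; case/andP: ht => /ltW.
  have q0 : 0 <= vpoly th z.
    by rewrite /vpoly sumr_ge0// => j _; rewrite mulr_ge0 ?qcoef_ge0 ?exprn_ge0 ?expR_ge0.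
  have P0 : 0 <= \prod_(i < k) wpos th (tnth z i) by apply: prodr_ge0 => i _; exact: wpos_ge0.
  apply: (@le_trans _ _ ((\prod_(i < k) expR ((th^-1 - k%:R^-1) * x i) *
     (Cq * \prod_(i < k) expR (- (tail_rate * w i)))) * \prod_(i < k) (a^-1 * expR (- ((1 + th^-1) * x i))))).
    apply: ler_pM => //; first by rewrite !mulr_ge0 ?expR_ge0.
    by apply: ler_pM; rewrite ?expR_ge0// mulr_ge0 ?expR_ge0.
  rewrite mulrCA -mulrA -!big_split/= ler_wpM2l//.
  rewrite le_eqVlt; apply/orP; left; apply/eqP; apply: eq_bigr => i _.
  rewrite mulrCA -!expRD; congr (_ * expR _).
  by rewrite /tail_rate; field; rewrite !gt_eqF.
have f2 : envelope z ^+ p <= \prod_(i < k) (1 + `|x i| + w i) ^+ p.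
  rewrite prodrXl lerXn2r ?nnegrE//.
  - exact: le_trans ler01 (envelope_ge1 z).
  - by rewrite prodr_ge0// => i _; rewrite !addr_ge0 ?expR_ge0.
  rewrite /envelope; under [leRHS]eq_bigr do rewrite -addrA.
  by apply: one_plus_sum_le_prod => i; rewrite addr_ge0 ?expR_ge0.
apply: (@le_trans _ _ ((\prod_(i < k) (1 + `|x i| + w i) ^+ p) *
    (Cq * \prod_(i < k) (a^-1 * expR (- ((1 + 2 * tail_rate) * x i + tail_rate * w i)))))).
  apply: ler_pM => //; last exact: logistic_density_ge0.
  by rewrite exprn_ge0// (le_trans ler01 (envelope_ge1 z)).
rewrite mulrCA -big_split/= -mulrA ler_wpM2l//.
apply: (@le_trans _ _ (\prod_(i < k) ((a^-1 * C) * heavy_tail tail_rate (tnth z i)))); last first.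
  by rewrite big_split/= prodr_const card_ord.
apply: ler_prod => i _; apply/andP; split.
  by rewrite mulr_ge0 ?exprn_ge0 ?mulr_ge0 ?addr_ge0 ?expR_ge0// invr_ge0 ltW.
have := HC (x i); rewrite /x lnK ?posrE// => H.
by rewrite mulrCA -mulrA ler_wpM2l// invr_ge0 ltW.
Qed.

Lemma poly_bounded_density (g : R -> k.-tuple R -> R) :
  poly_bounded a b (@envelope R k) g -> exists2 C, 0 <= C & forall th z, a < th < b ->
    `|g th z * logistic_density th z| <= C * dominating z.
Proof.
move=> /(@poly_bounded_normalize _ _ _ _ _ _ (@envelope_ge1 R k))[C C0 [p H]].
have [D D0 HD] := density_domination p.
exists (C * D) => [|th z ht]; first exact: mulr_ge0.
have ht1 : 0 < th < 1.
  by case/andP: ht => at_ tb; rewrite (lt_trans a0 at_) (lt_trans tb b1).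
rewrite normrM (ger0_norm (logistic_density_ge0 _ k0 ht1)).
apply: (le_trans (ler_wpM2r (logistic_density_ge0 z k0 ht1) (H th z ht))).
by rewrite -!mulrA ler_wpM2l// HD.
Qed.
End logistic_domination.

(** * Score, information and quadratic mean differentiability *)

Section quadratic_remainder.
Context {R : realType}.
Implicit Types f df d2f : R -> R.

(** Two applications of the mean value bound; the constant is not optimal. *)
Lemma quadratic_remainder f df d2f (x r B : R) : 0 <= B ->
  (forall t, `|t - x| <= r -> is_derive t 1 f (df t)) ->
  (forall t, `|t - x| <= r -> is_derive t 1 df (d2f t)) ->
  (forall t, `|t - x| <= r -> `|d2f t| <= B) ->
  forall t, `|t - x| <= r -> `|f t - f x - (t - x) * df x| <= B * `|t - x| ^+ 2.
Proof.
move=> B0 d1 d2 hB t ht.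
pose F t := f t - f x - (t - x) * df x.
have itv (u v : R) : `|u - x| <= r -> Num.min x u <= v <= Num.max x u -> `|v - x| <= r.
  by rewrite !ler_norml ge_min le_max => /andP[x1 x2] /andP[/orP[y1|y1] /orP[y2|y2]]; apply/andP; split; lra.
have dF u : `|u - x| <= r -> is_derive u 1 F (df u - df x).
  move=> hu; apply: (is_derive_eq (derB (derB (d1 u hu) (der_cst u (f x)))
    (derM (derB (der_id u) (der_cst u x)) (der_cst u (df x))))).
  by rewrite !subr0 mul1r mulr0 addr0.
have bF u : `|u - x| <= r -> `|df u - df x| <= B * `|u - x| ^+ 1.
  move=> hu; rewrite expr1; apply: (@mean_value_bound _ df d2f) => v hv.
  by split; [apply: d2|apply: hB]; exact: itv hu hv.
have := taylor_step B0 dF bF ht.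
by rewrite (_ : F x = 0) ?subr0// /F !subrr mul0r subr0.
Qed.
End quadratic_remainder.

Section density_probability.
Context d {T : measurableType d} {R : realType} (mu : {measure set T -> \bar R}).

Lemma density_probability (p : T -> R) : measurable_fun setT p -> (forall x, 0 <= p x) ->
  (\int[mu]_x (p x)%:E = 1)%E ->
  exists Q : probability T R, forall A, Q A = (\int[mu]_(x in A) (p x)%:E)%E.
Proof.
move=> mp p0 p1; pose m A := (\int[mu]_(x in A) (p x)%:E)%E.
have m0 : m set0 = 0%E by rewrite /m integral_set0.
have mge0 A : (0 <= m A)%E by apply: integral_ge0 => x _; rewrite lee_fin.
have msigma : semi_sigma_additive m.
  move=> A mA tA mUA; rewrite /m ge0_integral_bigcup//=.
  - by apply: is_cvg_ereal_nneg_natsum_cond => n _ _; exact: mge0.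
  - by apply/measurable_EFinP; apply: measurable_funTS.
  - by move=> x _; rewrite lee_fin.
pose M : {measure set T -> \bar R} := HB.pack m (isMeasure.Build _ _ _ m m0 mge0 msigma).
have M1 : (Measure.sort M) setT = 1%E by exact: p1.
pose Q : probability T R := HB.pack (Measure.sort M) (@Measure_isProbability.Build _ _ R (Measure.sort M) M1).
by exists Q.
Qed.
End density_probability.

Section regularity.
Context {R : realType} (k : nat) (a b : R).
Hypotheses (k0 : (0 < k)%N) (a0 : 0 < a) (b1 : b < 1).
Variables s s1 : R -> k.-tuple R -> R.
Hypothesis dlog : forall th z, a < th < b -> is_derive th 1 ((@log_density R k)^~ z) (s th z).
Hypothesis ds : forall th z, a < th < b -> is_derive th 1 (s^~ z) (s1 th z).
Hypothesis ts : tame a b (@envelope R k) 2 s.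
Hypothesis ts1 : tame a b (@envelope R k) 1 s1.
Implicit Types (th : R) (z : k.-tuple R).

Local Notation f := (@logistic_density R k).
Local Notation leb := (@lebesgue_tuple R k).
Local Notation E1 := (@envelope_ge1 R k).

Let th01 th : a < th < b -> 0 < th < 1.
Proof. by move=> /andP[at_ tb]; rewrite (lt_trans a0 at_) (lt_trans tb b1). Qed.

Let mf th : measurable_fun setT (f th). Proof. exact: measurable_logistic_density. Qed.

Let near_ab th : a < th < b -> \forall t \near th, a < t < b.
Proof.
move=> ht; have : th \in `]a, b[ by rewrite in_itv.
by move=> /near_in_itvoo; apply: filterS => t; rewrite in_itv.
Qed.

Let bs : poly_bounded a b (@envelope R k) s. Proof. exact: tame_bounded ts. Qed.
Let bs1 : poly_bounded a b (@envelope R k) s1. Proof. exact: tame_bounded ts1. Qed.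
Let ms th : a < th < b -> measurable_fun setT (s th). Proof. exact: tame_measurable ts. Qed.
Let ms1 th : a < th < b -> measurable_fun setT (s1 th). Proof. exact: tame_measurable ts1. Qed.

Lemma intR_poly_bounded (g : R -> k.-tuple R -> R) th : a < th < b ->
  poly_bounded a b (@envelope R k) g -> measurable_fun setT (g th) ->
  intR leb (fun z => g th z * f th z).
Proof.
move=> ht /(poly_bounded_density k0 a0 b1)[C C0 HC] mg.
apply: (@intR_le _ _ _ _ _ (fun z => C * dominating z)).
- exact: measurable_funM.
- by move=> z; exact: HC.
- by apply: intRZ; exact: intR_dominating.
Qed.

Lemma density_derive th z : a < th < b -> is_derive th 1 (f^~ z) (s th z * f th z).
Proof.
move=> ht; rewrite [in s th z * _](logistic_density_exp k0 a0 b1 z ht).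
have d := derM (der_cst th (indic_orthant z)) (der_exp (dlog z ht)).
have {}d : is_derive th 1 (fun t => indic_orthant z * expR (log_density t z))
    (s th z * (indic_orthant z * expR (log_density th z))).
  by apply: (is_derive_eq d); ring.
apply: near_eq_is_derive d; near=> t; rewrite (logistic_density_exp k0 a0 b1)//.
by near: t; exact: near_ab.
Unshelve. all: by end_near. Qed.

Lemma log_likelihood_derive th z : a < th < b -> is_derive th 1 (fun t => ln (f t z)) (s th z).
Proof.
move=> ht; apply: near_eq_is_derive (dlog z ht); near=> t.
rewrite (ln_logistic_density k0 a0 b1)//.
by near: t; exact: near_ab.
Unshelve. all: by end_near. Qed.

(** Differentiate the total mass. *)
Lemma score_centered th : a < th < b -> \int[leb]_z (s th z * f th z) = 0.
Proof.
move=> ht; have [C C0 HC] := poly_bounded_density k0 a0 b1 bs.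
apply: (@Rint_derivative_eq0 _ _ _ leb f (fun t z => s t z * f t z) a b th 1 (fun z => C * dominating z)) => //.
- move=> t ht'; apply: (@ge0_intR _ _ _ _ _ 1) => //.
    by move=> z; exact: logistic_density_ge0 (th01 ht').
  by rewrite logistic_mass ?th01.
- by move=> t z ht'; exact: density_derive.
- by apply: intRZ; exact: intR_dominating.
- by move=> t ht'; rewrite /Rintegral logistic_mass ?th01.
Qed.

(** Differentiate the mean of the score. *)
Lemma information_identity th : a < th < b ->
  \int[leb]_z (s1 th z * f th z) = - \int[leb]_z (s th z ^+ 2 * f th z).
Proof.
move=> ht.
have bq : poly_bounded a b (@envelope R k) (fun t z => s1 t z + s t z * s t z).
  by apply: (poly_boundedD E1) => //; exact: (poly_boundedM E1).
have [C C0 HC] := poly_bounded_density k0 a0 b1 bq.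
have H : \int[leb]_z ((s1 th z + s th z * s th z) * f th z) = 0.
  apply: (@Rint_derivative_eq0 _ _ _ leb (fun t z => s t z * f t z) (fun t z => (s1 t z + s t z * s t z) * f t z) a b th 0 (fun z => C * dominating z)) => //.
  - by move=> t ht'; apply: intR_poly_bounded => //; exact: ms.
  - move=> t z ht'; apply: (is_derive_eq (derM (ds z ht') (density_derive z ht'))).
    by ring.
  - by apply: intRZ; exact: intR_dominating.
  - exact: score_centered.
apply/eqP; rewrite -addr_eq0 -RintD.
- rewrite -[X in _ == X]H; apply/eqP; apply: eq_Rintegral => z _.
  by rewrite expr2 mulrDl.
- by apply: intR_poly_bounded => //; exact: ms1.
- apply: (@intR_poly_bounded (fun t z => s t z ^+ 2)) => //.
    exact: (poly_boundedM E1 bs bs).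
  by apply: measurable_funX; exact: ms.
Qed.

Lemma fisher_informationE th : a < th < b ->
  fisher_information f th = (\int[leb]_z (s th z ^+ 2 * f th z))%:E.
Proof.
move=> ht; rewrite -RintE; last first.
  apply: (@intR_poly_bounded (fun t z => s t z ^+ 2)) => //.
    exact: (poly_boundedM E1 bs bs).
  by apply: measurable_funX; exact: ms.
apply: eq_integral => z _; rewrite derive1E.
by have [_ ->] := log_likelihood_derive z ht.
Qed.

Local Notation r := (fun th z => Num.sqrt (f th z)).

Lemma sqrt_density_exp th z : a < th < b ->
  Num.sqrt (f th z) = indic_orthant z * expR (2^-1 * log_density th z).
Proof.
move=> ht; rewrite (logistic_density_exp k0 a0 b1)// /indic_orthant.
case: ifP => _; last by rewrite !mul0r sqrtr0.
rewrite !mul1r (_ : expR (log_density th z) = expR (2^-1 * log_density th z) ^+ 2).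
  by rewrite sqrtr_sqr ger0_norm ?expR_ge0.
by rewrite -expRM_natl mulrA mulfV ?mul1r.
Qed.

Lemma sqrt_density_derive th z : a < th < b ->
  is_derive th 1 (r^~ z) (2^-1 * s th z * r th z).
Proof.
move=> ht; rewrite [in _ * Num.sqrt _](sqrt_density_exp z ht).
have d := derM (der_cst th (indic_orthant z)) (der_exp (derM (der_cst th 2^-1) (dlog z ht))).
have {}d : is_derive th 1 (fun t => indic_orthant z * expR (2^-1 * log_density t z))
    (2^-1 * s th z * (indic_orthant z * expR (2^-1 * log_density th z))).
  by apply: (is_derive_eq d); ring.
apply: near_eq_is_derive d; near=> t; rewrite sqrt_density_exp//.
by near: t; exact: near_ab.
Unshelve. all: by end_near. Qed.

(** The root of the density has second derivative sqrt f (s1 / 2 + s^2 / 4) in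
    theta, whose square is a tame function times the density, hence dominated
    independently of theta. *)
Lemma sqrt_density_remainder th0 : a < th0 < b -> exists2 C, 0 <= C &
  \forall h \near (0 : R), forall z,
   (Num.sqrt (f (th0 + h) z) - Num.sqrt (f th0 z) - 2^-1 * h * s th0 z * Num.sqrt (f th0 z)) ^+ 2
    <= C * h ^+ 4 * dominating z.
Proof.
move=> h0; pose q t z := 2^-1 * s1 t z + 2^-1 * (2^-1 * (s t z * s t z)).
have cb (c : R) : poly_bounded a b (@envelope R k) (fun _ _ => c).
  by exists `|c|, 0%N => *; rewrite expr0 mulr1.
have bq : poly_bounded a b (@envelope R k) q.
  by apply: (poly_boundedD E1); apply: (poly_boundedM E1) => //; apply: (poly_boundedM E1) => //; exact: (poly_boundedM E1).
have [C C0 HC] := poly_bounded_density k0 a0 b1 (poly_boundedM E1 bq bq).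
(* Half of the distance to the ends of the interval. *)
pose rho := Num.min (th0 - a) (b - th0) / 2.
have rho0 : 0 < rho by have [p1 p2] := andP h0; rewrite divr_gt0// lt_min !subr_gt0 p1.
exists C => //; near=> h => z.
pose B := Num.sqrt (C * dominating z).
have D0 : 0 <= C * dominating z by rewrite mulr_ge0 ?dominating_ge0.
have B0 : 0 <= B by exact: sqrtr_ge0.
have rho_ab t : `|t - th0| <= rho -> a < t < b.
  have [p1 p2] := andP h0.
  have h1 : rho <= (th0 - a) / 2 by rewrite ler_wpM2r// ge_min lexx.
  have h2 : rho <= (b - th0) / 2 by rewrite ler_wpM2r// ge_min lexx orbT.
  by rewrite ler_norml => /andP[? ?]; apply/andP; split; lra.
pose g t := 2^-1 * s t z * r t z.
have dg t : a < t < b -> is_derive t 1 g (q t z * r t z).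
  move=> ht; have d := derM (derM (der_cst t 2^-1) (ds z ht)) (sqrt_density_derive z ht).
  by apply: (is_derive_eq d); rewrite /q; ring.
have gB t : a < t < b -> `|q t z * r t z| <= B.
  move=> ht; rewrite -sqrtr_sqr ler_sqrt// exprMn sqr_sqrtr; last exact: logistic_density_ge0 (th01 ht).
  by apply: le_trans (HC t z ht); rewrite expr2 ler_norm.
have hr : `|(th0 + h) - th0| <= rho.
  rewrite addrAC subrr add0r; near: h.
  exact: (@nbhs0_le _ R^o _ rho0).
have H := @quadratic_remainder _ (fun t => Num.sqrt (f t z)) g (fun t => q t z * r t z) th0 rho B B0
  (fun t ht => sqrt_density_derive z (rho_ab t ht)) (fun t ht => dg t (rho_ab t ht))
  (fun t ht => gB t (rho_ab t ht)) (th0 + h) hr.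
move: H; rewrite (_ : th0 + h - th0 = h); last by ring.
rewrite /g !mulrA [h * 2^-1]mulrC => H; rewrite -real_normK ?num_real//.
apply: (@le_trans _ _ ((B * `|h| ^+ 2) ^+ 2)).
  apply: lerXn2r; rewrite ?nnegrE//; last by rewrite [X in _ <= _ * X]expr2 [leRHS]mulrA.
  by apply: mulr_ge0 B0 _; exact: exprn_ge0.
rewrite exprMn sqr_sqrtr// real_normK ?num_real// -exprM.
by rewrite le_eqVlt; apply/orP; left; apply/eqP; ring.
Unshelve. all: by end_near. Qed.

(** The squared remainder integrates to O(h^4). *)
Lemma logistic_dqm th0 : a < th0 < b -> dqm f th0.
Proof.
move=> h0; exists (s th0); first exact: ms.
have [C C0 HC] := sqrt_density_remainder h0.
pose K := \int[leb]_z dominating z.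
have KE : (\int[leb]_z (dominating z)%:E = K%:E)%E by apply: RintE; exact: intR_dominating.
have hab : \forall h \near (0 : R), a < th0 + h < b.
  have [p1 p2] := andP h0; near=> h; apply/andP; split.
    rewrite -ltrBlDl; near: h; apply: lt_nbhsr; lra.
  rewrite -ltrBrDl; near: h; apply: lt_nbhsl; lra.
apply: (@squeeze_cvge _ _ _ _ (fun=> 0%E) _ (fun h => (h ^+ 2 * (C * K))%:E)).
- near=> h.
  have hn0 : h != 0 by near: h; exact: nbhs_dnbhs_neq.
  have h2 : 0 < h ^+ 2 by rewrite exprn_even_gt0.
  apply/andP; split.
    rewrite mule_ge0// ?lee_fin ?invr_ge0 ?(ltW h2)//.
    by apply: integral_ge0 => z _; rewrite lee_fin sqr_ge0.
  rewrite (_ : (h ^+ 2 * (C * K))%:E = ((h ^+ 2)^-1%:E * (C * h ^+ 4 * K)%:E)%E); last first.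
    by rewrite -EFinM; congr EFin; field.
  rewrite lee_pmul2l// ?lte_fin ?invr_gt0//.
  rewrite [leRHS]EFinM -KE -ge0_integralZl//.
  + apply: ge0_le_integral => //.
    * by move=> z _; rewrite lee_fin sqr_ge0.
    * apply/measurable_EFinP; apply: measurable_funX.
      have ab : a < th0 + h < b by near: h; exact: nbhs_dnbhs.
      have mr t : a < t < b -> measurable_fun setT (fun z => Num.sqrt (f t z)).
        move=> ht; rewrite (funext (fun z => sqrt_density_exp z ht)).
        apply: measurable_funM; first exact: measurable_indic_orthant.
        apply: measurableT_comp => //; apply: measurable_funM => //.
        by apply: tame_measurable ht; exact: (tame_log_density k0 a0 b1 0).
      apply: measurable_funB; first by apply: measurable_funB; exact: mr.
      by apply: measurable_funM; [apply: measurable_funM => //; exact: ms|exact: mr].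
    * by apply/measurable_EFinP; apply: measurable_funM => //; exact: measurable_dominating.
    * move=> z _; rewrite -EFinM lee_fin.
      by move: z; near: h; apply: nbhs_dnbhs.
  + by apply/measurable_EFinP; exact: measurable_dominating.
  + by move=> z _; rewrite lee_fin dominating_ge0.
  + by rewrite lee_fin mulr_ge0// exprn_even_ge0.
- exact: cvg_cst.
- apply/fine_cvgP; split; first by near=> h.
  have -> : fine \o (fun h : R => (h ^+ 2 * (C * K))%:E) = (fun h : R => h * h * (C * K)) by apply/funext => h /=; rewrite expr2.
  have H : h * h * (C * K) @[h --> (0 : R)] --> (0 : R) * 0 * (C * K).
    by apply: cvgM; [apply: cvgM; exact: cvg_id|exact: cvg_cst].
  rewrite !mul0r in H.
  by apply: cvg_trans H; apply: cvg_app; exact: nbhs_dnbhs.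
Unshelve. all: by end_near. Qed.

End regularity.

(** * Conclusion *)

Lemma score_existence (R : realType) (k : nat) (a b : R) : (0 < k)%N -> 0 < a -> b < 1 ->
  exists s s1 s2 : R -> k.-tuple R -> R,
  [/\ (forall th z, a < th < b -> is_derive th 1 ((@log_density R k)^~ z) (s th z)),
      (forall th z, a < th < b -> is_derive th 1 (s^~ z) (s1 th z)),
      (forall th z, a < th < b -> is_derive th 1 (s1^~ z) (s2 th z)) &
      [/\ tame a b (@envelope R k) 2 s, tame a b (@envelope R k) 1 s1 &
          tame a b (@envelope R k) 0 s2]].
Proof.
move=> k0 a0 b1.
have [s ds ts] := tame_derivative (tame_log_density k0 a0 b1 3).
have [s1 ds1 ts1] := tame_derivative ts.
have [s2 ds2 ts2] := tame_derivative ts1.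
by exists s, s1, s2.
Qed.

Theorem proposition4p1 (R : realType) (k : nat) (k_ge2 : (2 <= k)%N)
    (theta0 : R) (theta0_in : logistic_parameters theta0) :
  dqm (@logistic_density R k) theta0 /\
  (fisher_information (@logistic_density R k) theta0 != 0%E ->
   exists T : forall n, n.-tuple (k.-tuple R) -> R,
     (forall n, measurable_fun setT (T n)) /\
     forall (d : measure_display) (Omega : measurableType d)
       (P : probability Omega R) (Z : nat -> {RV P >-> k.-tuple R}),
       mutually_independent Z ->
       (forall i, has_density (Z i) (logistic_density theta0)) ->
       {ae P, forall w, \forall n \near \oo,
          local_maximum logistic_parameters
            (log_likelihood (@logistic_density R k) (sample Z n w))
            (T n (sample Z n w))} /\
       cvg_in_distribution P
         (fun n w => Num.sqrt n%:R * (T n (sample Z n w) - theta0))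
         (normal_prob 0
           (Num.sqrt
             (fine (fisher_information (@logistic_density R k) theta0))^-1))).
Proof.
have k0 : (0 < k)%N by exact: ltnW.
have /andP[t0 t1] : 0 < theta0 < 1 by move: theta0_in; rewrite /logistic_parameters/= in_itv.
(* All bounds are locally uniform in the parameter: any interval around theta0
   with closure inside (0, 1) would do. *)
pose a : R := theta0 / 2; pose b : R := (1 + theta0) / 2.
have a0 : 0 < a by rewrite divr_gt0.
have b1 : b < 1 by rewrite /b; lra.
have hab : a < theta0 < b by rewrite /a /b; apply/andP; split; lra.
have hTheta t : a < t < b -> logistic_parameters t.
  by move=> /andP[at_ tb]; rewrite /logistic_parameters/= in_itv/= (lt_trans a0 at_) (lt_trans tb b1).
have [s [s1 [s2 [dlog ds ds1 [ts ts1 ts2]]]]] := score_existence k0 a0 b1.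
split; first exact: (logistic_dqm k0 a0 b1 dlog ds ts ts1 hab).
have E1 := @envelope_ge1 R k.
pose f := @logistic_density R k; pose leb := @lebesgue_tuple R k.
rewrite (fisher_informationE k0 a0 b1 dlog ts hab) /=.
set I := Rintegral _ _ _ => I_neq0.
have f0 z : 0 <= f theta0 z by apply: logistic_density_ge0 => //; rewrite t0 t1.
have mf : measurable_fun setT (f theta0) by exact: measurable_logistic_density.
have I0 : 0 < I.
  rewrite lt0r; apply/andP; split; first by apply: contra I_neq0 => /eqP ->.
  by apply: Rintegral_ge0 => z _; rewrite mulr_ge0 ?sqr_ge0.
(* The estimator must not depend on the probability space of the observations;
   so the law of one observation is built from the density alone. *)
have [Q QE] := density_probability mf f0 (logistic_mass k0 (introT andP (conj t0 t1))).
have [C C0 [p HC]] := poly_bounded_normalize E1 (tame_bounded ts2).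
pose M (z : k.-tuple R) : R := C * envelope z ^+ p.
have M0 (z : k.-tuple R) : 0 <= M z by rewrite mulr_ge0 ?exprn_ge0// (le_trans ler01 (E1 z)).
have mM : measurable_fun setT M.
  by apply: measurable_funM => //; apply: measurable_funX; exact: measurable_envelope.
have lip t z : a < t < b -> `|s1 t z - s1 theta0 z| <= `|t - theta0| * M z.
  move=> ht; rewrite mulrC; apply: (@mean_value_bound _ (s1^~ z) (s2^~ z)) => u hu.
  have hu' : a < u < b.
    move: ht hab hu => /andP[x1 x2] /andP[y1 y2]; rewrite ge_min le_max.
    by move=> /andP[/orP[v1|v1] /orP[v2|v2]]; apply/andP; split; lra.
  by split; [exact: ds1|exact: HC].
have ms t : a < t < b -> measurable_fun setT (s t) by exact: tame_measurable ts.
have ms1 : measurable_fun setT (s1 theta0) by exact: tame_measurable ts1 hab.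
have iQ (g : R -> k.-tuple R -> R) : poly_bounded a b (@envelope R k) g ->
    measurable_fun setT (g theta0) -> intR Q (g theta0).
  move=> bg mg; apply: (@intR_density _ _ _ leb Q (f theta0)) => //; first by move=> A _; exact: QE.
  exact: (intR_poly_bounded k0 a0 b1 hab bg mg).
have rQ (g : R -> k.-tuple R -> R) : poly_bounded a b (@envelope R k) g ->
    measurable_fun setT (g theta0) ->
    \int[Q]_z g theta0 z = \int[leb]_z (g theta0 z * f theta0 z).
  move=> bg mg; apply: (@Rint_density _ _ _ leb Q (f theta0)) => //; first by move=> A _; exact: QE.
  exact: (intR_poly_bounded k0 a0 b1 hab bg mg).
have is4 : intR Q (fun z => s theta0 z ^+ 4).
  apply: (iQ (fun t z => s t z ^+ 4)); last by apply: measurable_funX; exact: ms.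
  exact: (tame_bounded (tameX E1 4 ts)).
have is14 : intR Q (fun z => s1 theta0 z ^+ 4).
  apply: (iQ (fun t z => s1 t z ^+ 4)); last by apply: measurable_funX.
  exact: (tame_bounded (tameX E1 4 ts1)).
have iM4 : intR Q (fun z => M z ^+ 4).
  apply: (iQ (fun _ z => M z ^+ 4)); last by apply: measurable_funX.
  exists (C ^+ 4), (p * 4)%N => th z _.
  by rewrite ger0_norm ?exprn_ge0// /M exprMn -exprM.
have Es : \int[Q]_z s theta0 z = 0.
  rewrite (rQ s (tame_bounded ts) (ms _ hab)).
  exact: (score_centered k0 a0 b1 dlog ts hab).
have Es2 : \int[Q]_z s theta0 z ^+ 2 = I.
  apply: (rQ (fun t z => s t z ^+ 2)); last by apply: measurable_funX; exact: ms.
  exact: (tame_bounded (tameX E1 2 ts)).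
have Es1 : \int[Q]_z s1 theta0 z = - I.
  rewrite (rQ s1 (tame_bounded ts1) ms1).
  exact: (information_identity k0 a0 b1 dlog ds ts ts1 hab).
have dell t z : a < t < b -> is_derive t 1 (fun t => ln (f t z)) (s t z).
  exact: (log_likelihood_derive k0 a0 b1 dlog).
exists (@likelihood_root _ _ _ Q s M a b theta0 I); split.
  by move=> n; exact: (measurable_likelihood_root Q hab I0 M0 ms).
move=> d Omega P Z Zind Zdens.
have ZQ i A : measurable A -> P (Z i @^-1` A) = Q A.
  by move=> mA; rewrite QE -(Zdens i A mA).
split; last exact: (likelihood_root_normal hab hTheta I0 dell ds lip M0 ms ms1 mM is4 is14 iM4 Es Es2 Es1 Zind ZQ).
have := likelihood_root_ae hab hTheta I0 dell ds lip M0 ms ms1 mM is4 is14 iM4 Es Es1 Zind ZQ.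
by apply: filterS => w [].
Qed.
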